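(* Let $m,k$ be nonnegative integers, let $\lambda\in\mathcal{P}_m$, and let $n\ge m$ be such that $n\geq 2k$. Then $$K_{\lambda,\emptyset}^{\mathfrak{sp}_{2n},k}=K_{\lambda,\emptyset}^{\mathfrak{sp},k}\qquad\text{and}\qquad K_{\lambda,\emptyset}^{\mathfrak{so}_{2n+1},k}=K_{\lambda,\emptyset}^{\mathfrak{so}_{2n},k}=K_{\lambda,\emptyset}^{\mathfrak{so},k}.$$ In particular the coefficients $K_{\lambda,\emptyset}^{\mathfrak{sp}_{2n},k}$, $K_{\lambda,\emptyset}^{\mathfrak{so}_{2n+1},k}$ and $K_{\lambda,\emptyset}^{\mathfrak{so}_{2n},k}$ do not depend on the rank $n$.
   Context: $\mathcal{P}$ is the set of all partitions, $\mathcal{P}_m$ those with at most $m$ nonzero parts. Throughout $n\ge2$ for $\mathfrak{so}_{2n+1},\mathfrak{sp}_{2n}$ and $n\ge4$ for $\mathfrak{so}_{2n}$. Finite rank: partitions in $\mathcal{P}_n$ are vectors of $\mathbb{Z}^n$ with standard basis $\varepsilon_i$. Positive roots $R^+$: $\varepsilon_i\pm\varepsilon_j$ ($1\le i<j\le n$) together with all $\varepsilon_i$ for $\mathfrak{so}_{2n+1}$; together with all $2\varepsilon_i$ for $\mathfrak{sp}_{2n}$; and no others for $\mathfrak{so}_{2n}$. $\rho$ is the half sum of positive roots, $W^{\mathfrak g}$ the Weyl group with length $\ell$, $w\circ\beta=w(\beta+\rho)-\rho$, and $\mathcal{P}_q$ is defined by $\prod_{\alpha\in R^+}\frac{1}{1-qe^\alpha}=\sum_\beta\mathcal{P}_q(\beta)e^\beta$.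 The Lusztig $q$-analogue is $K_{\lambda,\mu}^{\mathfrak g}(q)=\sum_{w\in W^{\mathfrak g}}(-1)^{\ell(w)}\mathcal{P}_q(w\circ\lambda-\mu)$, and $K_{\lambda,\mu}^{\mathfrak g,k}$ is its coefficient of $q^k$; $\emptyset$ is the empty partition (weight $0$). Universal side: $\Lambda$ is the ring of symmetric functions over $\mathbb{Z}$ in variables $x_1,x_2,\dots$, with Schur functions $\mathtt{s}_\nu^{\mathfrak{gl}}$ and Littlewood–Richardson coefficients $c_{\lambda,\gamma}^\nu$. $\mathcal{P}^{(2)}$ (resp. $\mathcal{P}^{(1,1)}$) is the set of partitions with all rows (resp. all columns) of even length. The universal orthogonal and symplectic characters $\{\mathtt{s}_\lambda^{\mathfrak{so}}\}_{\lambda\in\mathcal{P}}$ and $\{\mathtt{s}_\lambda^{\mathfrak{sp}}\}_{\lambda\in\mathcal{P}}$ are the $\mathbb{Z}$-bases of $\Lambda$ determined by $\mathtt{s}_\nu^{\mathfrak{gl}}=\sum_{\lambda\in\mathcal{P}}\sum_{\gamma\in\mathcal{P}^{(2)}}c_{\lambda,\gamma}^\nu\mathtt{s}_\lambda^{\mathfrak{so}}$ and $\mathtt{s}_\nu^{\mathfrak{gl}}=\sum_{\lambda\in\mathcal{P}}\sum_{\gamma\in\mathcal{P}^{(1,1)}}c_{\lambda,\gamma}^\nu\mathtt{s}_\lambda^{\mathfrak{sp}}$ for all $\nu\in\mathcal{P}$. The integers $K_{\lambda,\emptyset}^{\mathfrak{so},k}$ and $K_{\lambda,\emptyset}^{\mathfrak{sp},k}$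 are defined by the expansions in $\Lambda[[q]]$ $$\prod_{i\ge1}(1-q^{2i})\prod_{1\le i<j}\frac{1}{1-qx_ix_j}=\sum_{k\ge0}\sum_{\lambda\in\mathcal{P}}K_{\lambda,\emptyset}^{\mathfrak{so},k}\,\mathtt{s}_\lambda^{\mathfrak{so}}q^k,\qquad \prod_{i\ge1}(1-q^{2i})\prod_{1\le i\le j}\frac{1}{1-qx_ix_j}=\sum_{k\ge0}\sum_{\lambda\in\mathcal{P}}K_{\lambda,\emptyset}^{\mathfrak{sp},k}\,\mathtt{s}_\lambda^{\mathfrak{sp}}q^k.$$ *)

(* Defs.v *)
From HB Require Import structures.
From mathcomp Require Import all_boot all_order all_fingroup all_algebra.
From mathcomp Require Import boolp classical_sets cardinality fsbigop.
From mathcomp Require Import mpoly.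

Set Implicit Arguments.
Unset Strict Implicit.
Unset Printing Implicit Defensive.

Import Order.TTheory GRing.Theory Num.Theory.

Local Open Scope ring_scope.

Definition is_part (s : seq nat) : bool := sorted geq s && (0%N \notin s).

Record part := Part { parts :> seq nat; _ : is_part parts }.

HB.instance Definition _ := [isSub for parts].
HB.instance Definition _ := [Countable of part by <:].

Definition empty_part : part := @Part [::] isT.

Definition even_rows (la : part) : bool := all (fun r => ~~ odd r) la.

Definition columns (la : part) : seq nat :=
  [seq count (ltn j) la | j <- iota 0 (head 0%N la)].

Definition even_columns (la : part) : bool :=
  all (fun c => ~~ odd c) (columns la).

(* [so_odd], [sp], [so_even] at rank [n] stand for so_(2n+1), sp_(2n) and
   so_(2n).  Weights have rational coordinates since rho is half-integral for
   so_(2n+1). *)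
Variant lie_type := so_odd | sp | so_even.

Definition eps n (i : 'I_n) : 'rV[rat]_n := delta_mx 0 i.

Definition positive_roots (t : lie_type) (n : nat) : seq 'rV[rat]_n :=
  let pairs := enum [pred p : 'I_n * 'I_n | (p.1 < p.2)%N] in
  [seq eps p.1 - eps p.2 | p <- pairs] ++ [seq eps p.1 + eps p.2 | p <- pairs]
  ++ match t with
     | so_odd => [seq eps i | i <- enum 'I_n]
     | sp => [seq 2 *: eps i | i <- enum 'I_n]
     | so_even => [::]
     end.

Definition rho (t : lie_type) (n : nat) : 'rV[rat]_n :=
  2^-1 *: \sum_(a <- positive_roots t n) a.

(* The Weyl group is realized as a group of permutations of the 2n vectors
   eps_i, -eps_i, encoded as (i, false) and (i, true). *)
Definition signed_eps n (x : 'I_n * bool) : 'rV[rat]_n :=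
  (-1) ^+ x.2 *: eps x.1.

Definition weyl_act n (w : {perm 'I_n * bool}) (b : 'rV[rat]_n) : 'rV[rat]_n :=
  \sum_i b 0 i *: signed_eps (w (i, false)).

(* Reflections in eps_i - eps_j, in eps_i + eps_j (for i <> j), and in eps_i
   or 2 eps_i. *)
Definition refl_sub n (i j : 'I_n) : {perm 'I_n * bool} :=
  (tperm (i, false) (j, false) * tperm (i, true) (j, true))%g.
Definition refl_add n (i j : 'I_n) : {perm 'I_n * bool} :=
  (tperm (i, false) (j, true) * tperm (i, true) (j, false))%g.
Definition refl_one n (i : 'I_n) : {perm 'I_n * bool} :=
  tperm (i, false) (i, true).

Definition simple_reflections (t : lie_type) (n : nat) :
    {set {perm 'I_n * bool}} :=
  [set refl_sub p.1 p.2 | p : 'I_n * 'I_n & p.2 == p.1.+1 :> nat] :|: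
  match t with
  | so_odd | sp => [set refl_one i | i : 'I_n & i.+1 == n]
  | so_even => [set refl_add p.1 p.2 | p : 'I_n * 'I_n
                 & (p.2 == p.1.+1 :> nat) && (p.2.+1 == n)]
  end.

Definition weyl_group (t : lie_type) (n : nat) : {set {perm 'I_n * bool}} :=
  <<simple_reflections t n>>%g.

(* The least l such that w is a product of l simple reflections; on the Weyl
   group this is always smaller than the order of the group. *)
Definition weyl_length (t : lie_type) (n : nat) (w : {perm 'I_n * bool}) : nat :=
  find (fun l => w \in (simple_reflections t n ^+ l)%g)
       (iota 0 #|weyl_group t n|).

(* [kostant R k b] is the coefficient of q^k e^b in the product over a in R of
   1 / (1 - q e^a) = \sum_j q^j e^(j a). *)
Fixpoint kostant n (R : seq 'rV[rat]_n) (k : nat) (b : 'rV[rat]_n) : int :=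
  if R is a :: R' then \sum_(j < k.+1) kostant R' (k - j) (b - a *+ j)
  else ((k == 0%N) && (b == 0))%:R.

Definition part_weight (n : nat) (la : part) : 'rV[rat]_n :=
  \row_(i < n) (nth 0%N la i)%:R.

Definition weyl_dot (t : lie_type) n (w : {perm 'I_n * bool})
    (b : 'rV[rat]_n) : 'rV[rat]_n :=
  weyl_act w (b + rho t n) - rho t n.

Definition lusztig_coef (t : lie_type) (n : nat) (la mu : part) (k : nat) : int :=
  \sum_(w in weyl_group t n) (-1) ^+ weyl_length t w
    * kostant (positive_roots t n) k
        (weyl_dot t w (part_weight n la) - part_weight n mu).

(* Symmetric functions over the integers are the families, of bounded degree,
   of symmetric polynomials f_N in x_0, ..., x_(N-1) such that f_(N+1)
   specializes to f_N at x_N = 0: the ring is the graded projective limit of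
   the rings of symmetric polynomials. *)

Definition drop_last_var N (p : {mpoly int[N.+1]}) : {mpoly int[N]} :=
  p \mPo [tuple if unlift ord_max i is Some j then 'X_j else 0 | i < N.+1].

Definition poly_family : Type := forall N : nat, {mpoly int[N]}.

HB.instance Definition _ := Choice.on poly_family.

Section PolyFamilyRing.

Implicit Types f g h : poly_family.

Let famE f g : (forall N, f N = g N) -> f = g.
Proof. exact: functional_extensionality_dep. Qed.

Definition fam0 : poly_family := fun N => 0.
Definition famN f : poly_family := fun N => - f N.
Definition famD f g : poly_family := fun N => f N + g N.
Definition fam1 : poly_family := fun N => 1.
Definition famM f g : poly_family := fun N => f N * g N.

Fact famDA : associative famD.
Proof. by move=> f g h; apply: famE => N; apply: addrA. Qed.
Fact famDC : commutative famD.
Proof. by move=> f g; apply: famE => N; apply: addrC. Qed.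
Fact fam0D : left_id fam0 famD.
Proof. by move=> f; apply: famE => N; apply: add0r. Qed.
Fact famND : left_inverse fam0 famN famD.
Proof. by move=> f; apply: famE => N; apply: addNr. Qed.

HB.instance Definition _ :=
  GRing.isZmodule.Build poly_family famDA famDC fam0D famND.

Fact famMA : associative famM.
Proof. by move=> f g h; apply: famE => N; apply: mulrA. Qed.
Fact famMC : commutative famM.
Proof. by move=> f g; apply: famE => N; apply: mulrC. Qed.
Fact fam1M : left_id fam1 famM.
Proof. by move=> f; apply: famE => N; apply: mul1r. Qed.
Fact famMDl : left_distributive famM famD.
Proof. by move=> f g h; apply: famE => N; apply: mulrDl. Qed.
Fact fam1_neq0 : fam1 != fam0.
Proof.
by apply/eqP => /(congr1 (fun f : poly_family => f 0%N))/eqP; rewrite oner_eq0.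
Qed.

HB.instance Definition _ :=
  GRing.Zmodule_isComNzRing.Build poly_family famMA famMC fam1M famMDl fam1_neq0.

End PolyFamilyRing.

Definition is_symfun (f : poly_family) : Prop :=
  [/\ forall N, f N \is symmetric,
      forall N, drop_last_var (f N.+1) = f N
    & exists d, forall N, (msize (f N) <= d)%N].

Definition symfun_pred : {pred poly_family} := fun f => `[< is_symfun f >].

Fact symfun_subring_closed : subring_closed symfun_pred.
Proof.
split.
- apply/asboolP; split=> [N|N|].
  + by rewrite -[(1 : poly_family) N]/(1 : {mpoly int[N]}) rpred1.
  + by rewrite /drop_last_var comp_mpoly1.
  + by exists 1%N => N; rewrite msize1.
- move=> f g /asboolP[fS fR [d fd]] /asboolP[gS gR [e ge]].
  apply/asboolP; split=> [N|N|].
  + exact: (rpredB (fS N) (gS N)).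
  + by rewrite -[RHS]/(f N - g N) -fR -gR /drop_last_var -comp_mpolyB.
  + exists (maxn d e) => N; rewrite -[(f - g) N]/(f N - g N).
    apply: leq_trans (msizeD_le _ _) _; rewrite geq_max msizeN.
    by rewrite !leq_max fd ge orbT.
- move=> f g /asboolP[fS fR [d fd]] /asboolP[gS gR [e ge]].
  apply/asboolP; split=> [N|N|].
  + exact: (rpredM (fS N) (gS N)).
  + by rewrite -[RHS]/(f N * g N) -fR -gR /drop_last_var -rmorphM.
  + exists (d + e).+1 => N; rewrite -[(f * g) N]/(f N * g N).
    by apply: leq_trans (msizeM_le _ _) _; rewrite ltnS leq_add.
Qed.

HB.instance Definition _ :=
  GRing.isSubringClosed.Build poly_family symfun_pred symfun_subring_closed.

Record symfun := SymFun { in_vars :> poly_family; _ : in_vars \in symfun_pred }.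

HB.instance Definition _ := [isSub for in_vars].
HB.instance Definition _ := [Choice of symfun by <:].
HB.instance Definition _ := [SubChoice_isSubComNzRing of symfun by <:].

(* Alternants a_(la + delta) in N variables; the Schur polynomial of a
   partition with at most N parts is a_(la + delta) / a_delta. *)
Definition alternant (N : nat) (la : part) : {mpoly int[N]} :=
  \det (\matrix_(i < N, j < N) 'X_j ^+ (nth 0%N la i + (N - i.+1))).

Definition schur_functions (s : part -> symfun) : Prop :=
  forall (la : part) (N : nat), (size la <= N)%N ->
    in_vars (s la) N * alternant N empty_part = alternant N la.

Local Open Scope classical_set_scope.

(* [\sum_(x \in A) F x], with A a classical set, is the sum of the nonzero
   values of F on A, assumed to be finite in number. *)

(* [c la ga nu] is the coefficient c_(la, ga)^nu. *)
Definition littlewood_richardson (s : part -> symfun)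
    (c : part -> part -> part -> int) : Prop :=
  forall la ga : part, finite_set [set nu | c la ga nu != 0] /\
    s la * s ga = \sum_(nu \in [set: part]) s nu *~ c la ga nu.

(* The universal characters attached to a set G of partitions: rows of even
   length give the orthogonal ones, columns of even length the symplectic
   ones. *)
Definition universal_characters (G : set part) (s : part -> symfun)
    (c : part -> part -> part -> int) (u : part -> symfun) : Prop :=
  forall nu : part,
    s nu = \sum_(la \in [set: part]) \sum_(ga \in G) u la *~ c la ga nu.

(* Power series in q over A are encoded by their sequences of coefficients. *)
Definition ser1 (A : pzRingType) : nat -> A := fun k => (k == 0%N)%:R.
Definition serM (A : pzRingType) (f g : nat -> A) : nat -> A :=
  fun k => \sum_(i < k.+1) f i * g (k - i)%N.
Arguments ser1 {A}.

(* 1 / (1 - q a) *)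
Definition geometric (A : pzRingType) (a : A) : nat -> A := fun k => a ^+ k.

(* \prod_(i >= 1) (1 - q^(2i)): the factors with i > k do not contribute to
   the coefficient of q^k. *)
Definition even_euler (A : pzRingType) : nat -> A := fun k =>
  ((\prod_(1 <= i < k.+1) (1 - 'X^(2 * i)) : {poly int})`_k)%:~R.

Definition so_series (N : nat) : nat -> {mpoly int[N]} :=
  serM (even_euler _)
    (\big[@serM _/ser1]_(i < N) \big[@serM _/ser1]_(j < N | (i < j)%N)
       geometric ('X_i * 'X_j)).

Definition sp_series (N : nat) : nat -> {mpoly int[N]} :=
  serM (even_euler _)
    (\big[@serM _/ser1]_(i < N) \big[@serM _/ser1]_(j < N | (i <= j)%N)
       geometric ('X_i * 'X_j)).

(* The coefficient of q^k in the series F is the finite linear combination of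
   the u la with coefficients K k la; F is given by its images F N in the
   series over the polynomial rings in N variables. *)
Definition expansion (F : forall N, nat -> {mpoly int[N]})
    (u : part -> symfun) (K : nat -> part -> int) : Prop :=
  forall k : nat, finite_set [set la | K k la != 0] /\
    forall N : nat,
      in_vars (\sum_(la \in [set: part]) u la *~ K k la) N = F N k.

(* Main.v *)
Require Import Defs.
From mathcomp Require Import all_boot all_algebra.
From mathcomp Require Import classical_sets.
From HB Require Import structures.
From mathcomp Require Import all_order all_fingroup.
From mathcomp Require Import zify ring lra.
From mathcomp Require Import boolp cardinality fsbigop.
From mathcomp Require Import mpoly finmap fraction.
From mathcomp Require monalg.
Import (canonicals) monalg.

(* Let J be the Weyl denominator and p the family of weights of the vector
   representation.  Reindexing the sum over the Weyl group, K_(la,0)(q) is the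
   coefficient of e^(la+rho) in
     sum_w (-1)^l(w) e^(w rho) prod_(a > 0) 1 / (1 - q e^(w a)).
   Multiply and divide the term of w by prod_(a > 0) (1 - q e^(-w a)).  The
   denominator no longer depends on w: up to a power of 1 - q it is the product
   of the 1 - q p_i p_j over i < j (over i <= j for sp).  In the numerator,
   rho minus a sum of distinct positive roots has l1-norm at most that of rho,
   so its alternating sum over the Weyl group is 0, J or -J.  Hence K_(la,0)(q)
   is D(q), a series independent of la, times the multiplicity of the
   irreducible character of highest weight la in prod 1 / (1 - q p_i p_j).

   The universal characters of degree at most n specialize at p to irreducible
   characters: Littlewood's identities turn their definition into a branching
   rule solved by a Jacobi-Trudi determinant, which a row reduction identifies
   with the Weyl bialternant.  So up to q^k with 2k <= n the multiplicities are
   the universal ones, and it remains to see that D is prod (1 - q^(2i)).  For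
   la empty K is 1, while the multiplicity of the trivial character in degree k
   counts the partitions of 2k with even rows and even columns, whose generating
   series is prod 1 / (1 - q^(2i)). *)

Set Implicit Arguments.
Unset Strict Implicit.
Unset Printing Implicit Defensive.
Import GRing.Theory Num.Theory Order.TTheory.
Local Open Scope ring_scope.

(** * Determinants *)

(** Littlewood's identities are infinite sums over partitions. They are proved for variables with
    y_j^M = 0, where all sums are finite, and then applied to y_j = t x_j with t nilpotent, which
    keeps every degree in x up to a chosen bound. The factor D is never computed from its numerator:
    one D serves all la, and the empty partition determines its coefficients one after the other.
    The coefficient of q^k in the pair product has degree 2k in p, so it only involves universal
    characters of partitions of size at most 2k <= n, for which the Jacobi-Trudi determinant of size
    n needs no modification rule. Products and characters are crossed: the symplectic product (i <=
    j) expands in Schur functions with even rows, while symplectic characters are defined by even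
    columns; this is how partitions with both properties arise. In type D the Weyl group has only
    even sign changes, whereas a determinant of row functions allows all of them; for rho the two
    agree because its last coordinate is 0. *)

Lemma det_sum_rows (R : comNzRingType) (n M : nat) (P : 'I_n -> pred 'I_M)
    (w : 'I_n -> 'I_M -> 'I_n -> R) :
  \det (\matrix_(i, j) \sum_(m < M | P i m) w i m j)
    = \sum_(f : {ffun 'I_n -> 'I_M} | [forall i, P i (f i)])
        \det (\matrix_(i, j) w i (f i) j).
Proof.
rewrite /determinant [RHS]exchange_big /=; apply: eq_bigr => s _.
rewrite -mulr_sumr; congr (_ * _).
under eq_bigr do rewrite mxE.
rewrite bigA_distr_big_dep; apply: eq_big => [f|f _].
  by apply/familyP/forallP.
by apply: eq_bigr => i _; rewrite mxE.
Qed.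

Lemma det_scale_rows (R : comNzRingType) n (c : 'I_n -> R) (A : 'M[R]_n) :
  \det (\matrix_(i, j) (c i * A i j)) = (\prod_i c i) * \det A.
Proof.
rewrite /determinant mulr_sumr; apply: eq_bigr => s _.
rewrite mulrCA -big_split /=; congr (_ * _).
by apply: eq_bigr => i _; rewrite mxE.
Qed.

Lemma det_scale_cols (R : comNzRingType) n (c : 'I_n -> R) (A : 'M[R]_n) :
  \det (\matrix_(i, j) (c j * A i j)) = (\prod_i c i) * \det A.
Proof.
rewrite -det_tr -[in RHS]det_tr -det_scale_rows; congr (\det _).
by apply/matrixP => i j; rewrite !mxE.
Qed.

(* [up] tells on which side of the diagonal [e] lies. *)
Lemma det_add_rows (R : comNzRingType) n (up : bool) (e : rel 'I_n) (c : 'I_n -> R) (A B : 'M[R]_n) :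
    (forall i k, e i k -> if up then i < k else k < i)%N ->
    (forall i j, B i j = A i j + \sum_(k < n | e i k) c i * A k j) ->
  \det B = \det A.
Proof.
move=> e_lt BE; pose U : 'M[R]_n := \matrix_(i, k) ((i == k)%:R + (e i k)%:R * c i).
have -> : B = U *m A.
  apply/matrixP => i j; rewrite BE !mxE.
  under [RHS]eq_bigr do rewrite mxE mulrDl.
  rewrite big_split /=; congr (_ + _).
    rewrite (bigD1 i) //= eqxx mul1r big1 ?addr0 // => k /negPf ki.
    by rewrite eq_sym ki mul0r.
  rewrite big_mkcond; apply: eq_bigr => k _.
  by case: (e i k); rewrite ?mul1r // !mul0r.
have U0 (i k : 'I_n) : (if up then k <= i else i <= k)%N -> U i k = (i == k)%:R.
  move=> le_ik; rewrite mxE; case: (boolP (e i k)) => [/e_lt|_]; last by rewrite mul0r addr0.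
  by case: (up) le_ik; lia.
have detU : \prod_i U i i = 1 by apply: big1 => i _; rewrite U0 ?eqxx //; case: (up).
rewrite det_mulmx -[RHS]mul1r -{}detU; congr (_ * _); case: up {e_lt} U0 => U0.
  rewrite -det_tr det_trig; first by apply: eq_bigr => i _; rewrite mxE.
  by apply/is_trig_mxP => i k lt_ik; rewrite mxE U0 ?(ltnW lt_ik) // -val_eqE /= gtn_eqF.
rewrite det_trig //; apply/is_trig_mxP => i k lt_ik.
by rewrite U0 ?(ltnW lt_ik) // -val_eqE /= ltn_eqF.
Qed.

(** * Littlewood's identities *)

Section Alternants.
Variable R : comNzRingType.

(** [l] is a total function of which only the values below [n] count, so that neighbours such as
    [l i.+1] can be named at the last row too. *)
Definition alt n (y : 'I_n -> R) (l : nat -> nat) : R :=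
  \det (\matrix_(i, j) y j ^+ (l i + (n - i.+1))).

Lemma eq_alt n (y : 'I_n -> R) (l l' : nat -> nat) :
  (forall i, (i < n)%N -> l i = l' i) -> alt y l = alt y l'.
Proof.
by move=> ll; congr (\det _); apply/matrixP => i j; rewrite !mxE ll.
Qed.

(** Padding by 0 makes the conditions on consecutive rows uniform: [noninc] then describes the
    partitions with at most n parts, all below M. *)
Definition ext n M (f : {ffun 'I_n -> 'I_M}) (i : nat) : nat :=
  if insub i is Some j then f j else 0%N.

Lemma extE n M (f : {ffun 'I_n -> 'I_M}) (i : 'I_n) : ext f i = f i.
Proof. by rewrite /ext valK. Qed.

Lemma ext_out n M (f : {ffun 'I_n -> 'I_M}) i : (n <= i)%N -> ext f i = 0%N.
Proof. by move=> le_ni; rewrite /ext insubN // -leqNgt. Qed.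

Lemma ext_ltn n M (f : {ffun 'I_n -> 'I_M}) i : (i < n)%N -> (ext f i < M)%N.
Proof. by move=> lt_in; rewrite (extE f (Ordinal lt_in)). Qed.

Definition noninc n M (f : {ffun 'I_n -> 'I_M}) : bool :=
  [forall i : 'I_n, ext f i.+1 <= ext f i]%N.

Lemma nonincP n M (f : {ffun 'I_n -> 'I_M}) :
  reflect (forall i, (ext f i.+1 <= ext f i)%N) (noninc f).
Proof.
apply: (iffP forallP) => [h i|h i]; last exact: h.
have [lt_in|le_ni] := ltnP i n; first exact: (h (Ordinal lt_in)).
by rewrite ext_out // (leq_trans le_ni).
Qed.

Lemma eq_ext n M (f g : {ffun 'I_n -> 'I_M}) :
  (forall i, (i < n)%N -> ext f i = ext g i) -> f = g.
Proof.
by move=> fg; apply/ffunP => i; apply/val_inj; rewrite /= -!extE fg.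
Qed.

Lemma alt_det n M (y : 'I_n -> R) (f : {ffun 'I_n -> 'I_M}) :
  \det (\matrix_(i, j) y j ^+ (f i + (n - i.+1))) = alt y (ext f).
Proof. by congr (\det _); apply/matrixP => i j; rewrite !mxE extE. Qed.

Lemma geom_range (x : R) a b : (a <= b)%N ->
  (1 - x) * \sum_(a <= m < b) x ^+ (m - a) = 1 - x ^+ (b - a).
Proof.
move=> /subnKC <-; elim: (b - a)%N => [|d IH].
  by rewrite addn0 big_geq // mulr0 subnn expr0 subrr.
rewrite addnS big_nat_recr ?leq_addr //= mulrDr IH.
have -> : (a + d - a = d)%N by lia.
have -> : ((a + d).+1 - a = d.+1)%N by lia.
by rewrite exprS; ring.
Qed.

Lemma geom_range2 (t y : R) a b : (a <= b)%N ->
  (y - t) * \sum_(a <= m < b) t ^+ (b.-1 - m) * y ^+ m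
    = y ^+ b - t ^+ (b - a) * y ^+ a.
Proof.
move=> /subnKC <-; elim: (b - a)%N => [|d IH].
  by rewrite addn0 big_geq // mulr0 subnn expr0 mul1r subrr.
rewrite addnS big_nat_recr ?leq_addr //= subnn mul1r.
have -> : \sum_(a <= m < a + d) t ^+ (a + d - m) * y ^+ m
   = t * \sum_(a <= m < a + d) t ^+ ((a + d).-1 - m) * y ^+ m.
  rewrite mulr_sumr; apply: eq_big_nat => m ?; rewrite mulrA -exprS.
  by congr (t ^+ _ * _); lia.
rewrite mulrDr mulrCA IH.
have -> : (a + d - a = d)%N by lia.
have -> : ((a + d).+1 - a = d.+1)%N by lia.
by rewrite !exprS; ring.
Qed.

Lemma sum_ord_range M (F : nat -> R) a b : (forall m, (M <= m)%N -> F m = 0) ->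
  \sum_(m < M | (a <= m < b)%N) F m = \sum_(a <= m < b) F m.
Proof.
move=> F0; rewrite big_geq_mkord.
rewrite (big_ord_widen_cond (maxn M b) (fun m => (a <= m < b)%N)) ?leq_maxl //.
rewrite (big_ord_widen_cond (maxn M b) (fun m => (a <= m)%N) F) ?leq_maxr //.
rewrite [LHS]big_mkcond [RHS]big_mkcond; apply: eq_bigr => m _ /=.
have [lt_mM|/F0->] := ltnP m M; last by rewrite andbF if_same.
by rewrite andbT.
Qed.

(* Pieri's rule: the row of [e_i] times [1 / (1 - t y)] minus a multiple of the
   previous row is a sum over an interval of exponents. *)
Lemma pieri n M (y : 'I_n -> R) (t : R) (l : nat -> nat) :
    (forall j, y j ^+ M = 0) -> (forall i, (l i.+1 <= l i)%N) ->
  alt y l = (\prod_j (1 - t * y j)) *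
    \sum_(f : {ffun 'I_n -> 'I_M} |
          [forall i : 'I_n, (l i <= f i) && ((i == 0%N :> nat) || (f i <= l i.-1))]%N)
      t ^+ (\sum_(i < n) (f i - l i))%N * alt y (ext f).
Proof.
move=> yM l_dec.
have yM' j m : (M <= m)%N -> y j ^+ m = 0.
  by move=> /subnKC <-; rewrite exprD yM mul0r.
pose P (i : 'I_n) (m : 'I_M) := ((l i <= m) && ((i == 0%N :> nat) || (m <= l i.-1)))%N.
pose w (i : 'I_n) (m : 'I_M) (j : 'I_n) := t ^+ (m - l i) * y j ^+ (m + (n - i.+1)).
have -> : \sum_(f : {ffun 'I_n -> 'I_M} | [forall i, P i (f i)])
    t ^+ (\sum_(i < n) (f i - l i))%N * alt y (ext f)
    = \det (\matrix_(i, j) \sum_(m < M | P i m) w i m j).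
  rewrite det_sum_rows; apply: eq_bigr => f _.
  rewrite -alt_det -prodrXr -det_scale_rows; congr (\det _).
  by apply/matrixP => i j; rewrite !mxE.
rewrite -det_scale_cols.
(* The interval of row i stops at l_(i-1). Telescoping leaves the row of [l] minus t^(l_(i-1) - l_i
   + 1) times y^(l_(i-1) + n - i), which is row i - 1. *)
pose c (i : 'I_n) := - t ^+ (l i.-1 - l i).+1.
symmetry; apply: (det_add_rows (up := false) (e := fun i k : 'I_n => k.+1 == i :> nat) (c := c)) => i j.
  by move=> /= /eqP <-.
rewrite !mxE.
have wE (u : nat) : (l i <= u)%N -> (forall m : 'I_M, P i m = (l i <= m < u)%N) ->
    (1 - t * y j) * \sum_(m < M | P i m) w i m j
      = y j ^+ (l i + (n - i.+1)) - t ^+ (u - l i) * y j ^+ (u + (n - i.+1)).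
  move=> le_u PE; rewrite (eq_bigl _ _ PE).
  rewrite (sum_ord_range (F := fun m => t ^+ (m - l i) * y j ^+ (m + (n - i.+1)))); last first.
    by move=> m le_Mm; rewrite yM' ?mulr0 // (leq_trans le_Mm) ?leq_addr.
  transitivity (((1 - t * y j) * \sum_(l i <= m < u) (t * y j) ^+ (m - l i)) *
      y j ^+ (l i + (n - i.+1))).
    rewrite -mulrA mulr_suml; congr (_ * _); apply: eq_big_nat => m /andP[le_m _].
    by rewrite exprMn -mulrA -exprD; congr (_ * _ ^+ _); lia.
  rewrite geom_range // mulrBl mul1r exprMn -mulrA -exprD.
  by congr (_ - _ * _ ^+ _); lia.
have [i0|i_gt0] := posnP i.
  (* The first row has no upper bound: any limit beyond M will do, since its boundary term is a
     vanishing power of [y j]. *)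
  rewrite (wE (l i + M.+1)%N) ?leq_addr //.
    by rewrite [y j ^+ (l i + M.+1 + _)]yM' ?mulr0 ?subr0 ?big_pred0 ?addr0 // => [k|]; [rewrite i0 | lia].
  by move=> m; rewrite /P i0 /= andbT; have := ltn_ord m; lia.
have lt_in := ltn_ord i.
have lt_i : (i.-1 < n)%N by lia.
have := l_dec i.-1; rewrite prednK // => li.
rewrite (wE (l i.-1).+1); first last.
- by move=> m; rewrite /P ltnS; lia.
- by lia.
rewrite (big_pred1 (Ordinal lt_i)) => [|k]; last first.
  by rewrite /= -val_eqE /=; lia.
rewrite !mxE /= /c mulNr; congr (_ - _ ^+ _ * _ ^+ _); lia.
Qed.

(** Subtracting t^(e_i - e_(i+1)) times row i + 1 from row i clears the column of t above its last
    entry. The remaining minor has entries y^a - t^(a-b) y^b, divisible by y - t with quotient a sum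
    over the interlacing interval. *)
Lemma branching n M (y : 'I_n.+1 -> R) (l : nat -> nat) (y' := fun j => y (widen_ord (leqnSn n) j)) (t := y ord_max) :
    (forall j, y j ^+ M = 0) -> (forall i, (l i.+1 <= l i)%N) ->
  alt y l = (\prod_j (y' j - t)) *
    \sum_(f : {ffun 'I_n -> 'I_M} | [forall i : 'I_n, l i.+1 <= f i <= l i]%N)
      t ^+ (l n + \sum_(i < n) (l i - f i))%N * alt y' (ext f).
Proof.
move=> yM l_dec.
have yM' j m : (M <= m)%N -> y j ^+ m = 0.
  by move=> /subnKC <-; rewrite exprD yM mul0r.
pose P (i : 'I_n) (m : 'I_M) := (l i.+1 <= m <= l i)%N.
pose w (i : 'I_n) (m : 'I_M) (j : 'I_n) := t ^+ (l i - m) * y' j ^+ (m + (n - i.+1)).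
transitivity ((\prod_j (y' j - t)) * (t ^+ l n * \det (\matrix_(i, j) \sum_(m < M | P i m) w i m j))); last first.
  congr (_ * _); rewrite det_sum_rows mulr_sumr; apply: eq_bigr => f _.
  rewrite -alt_det exprD -mulrA -prodrXr -det_scale_rows; congr (_ * \det _).
  by apply/matrixP => i j; rewrite !mxE.
rewrite mulrCA -det_scale_cols.
pose e i := (l i + (n.+1 - i.+1))%N.
pose c (i : 'I_n.+1) := - t ^+ (e i - e i.+1).
pose A := \matrix_(i < n.+1, j < n.+1) y j ^+ e i.
pose B := \matrix_(i, j) (A i j + \sum_(k < n.+1 | i.+1 == k :> nat) c i * A k j).
have -> : alt y l = \det B.
  rewrite (det_add_rows (up := true) (e := fun i k : 'I_n.+1 => i.+1 == k :> nat) (c := c) (A := A)) // => i j.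
    by move=> /= /eqP <-.
  by rewrite mxE.
have Blast (i : 'I_n) j : B (widen_ord (leqnSn n) i) j
    = y j ^+ e i - t ^+ (e i - e i.+1) * y j ^+ e i.+1.
  have lt_i1 : (i.+1 < n.+1)%N by have := ltn_ord i; lia.
  rewrite mxE (big_pred1 (Ordinal lt_i1)) => [|k]; last by rewrite /= -val_eqE /= eq_sym.
  by rewrite !mxE /= mulNr.
have widE (i : 'I_n) : lift ord_max i = widen_ord (leqnSn n) i.
  by apply/ord_inj; rewrite lift_max.
have e_dec i : (i < n)%N -> (e i.+1 <= e i)%N by move=> lt_in; have := l_dec i; rewrite /e; lia.
rewrite (expand_det_col _ ord_max) (bigD1 ord_max) //= [X in _ + X]big1 ?addr0 => [|i neq_i]; last first.
  have lt_in : (i < n)%N by move: neq_i (ltn_ord i); rewrite -val_eqE /=; lia.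
  have -> : i = widen_ord (leqnSn n) (Ordinal lt_in) by apply/val_inj.
  by rewrite Blast -/t -exprD subnK ?e_dec //= subrr mul0r.
rewrite /cofactor addnn -signr_odd odd_double mul1r; congr (_ * _).
  rewrite !mxE big_pred0 ?addr0 => [|k]; last by have := ltn_ord k; rewrite /=; lia.
  by rewrite /e /= subnn addn0.
congr (@determinant _ n _).
apply/matrixP => i j; rewrite [LHS]mxE [LHS]mxE [RHS]mxE [X in _ = _ * X]mxE !widE Blast.
rewrite -/(y' j) -geom_range2 ?e_dec //; congr (_ * _).
rewrite (eq_bigl (fun m : 'I_M => l i.+1 <= m < (l i).+1)%N) // (sum_ord_range (F := fun m => t ^+ (l i - m) * y' j ^+ (m + (n - i.+1)))); last first.
  by move=> m le_Mm; rewrite [X in _ * X]yM' ?mulr0 // (leq_trans le_Mm) ?leq_addr.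
have lt_in := ltn_ord i.
have -> : e i.+1 = (l i.+1 + (n - i.+1))%N by rewrite /e subSS.
have -> : e i = ((l i).+1 + (n - i.+1))%N by rewrite /e subSS; lia.
rewrite big_addn addnK; apply: eq_big_nat => m /andP[_ le_m].
by congr (t ^+ _ * _); lia.
Qed.

End Alternants.

Section Littlewood.
Variable R : comNzRingType.

Definition mkpart n M (g : nat -> nat) (h : forall i : 'I_n, (g i < M)%N) :
  {ffun 'I_n -> 'I_M} := [ffun i => Ordinal (h i)].

Lemma ext_mkpart n M g h i : (i < n)%N -> ext (@mkpart n M g h) i = g i.
Proof. by move=> lt_in; rewrite (extE _ (Ordinal lt_in)) ffunE. Qed.

(** Rows are counted from 0: rows 2j and 2j + 1 agree, that is, all columns have even length. *)
Definition evcols n M (f : {ffun 'I_n -> 'I_M}) : bool :=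
  noninc f && [forall i : 'I_n, ~~ odd i ==> (ext f i == ext f i.+1)].

Lemma evcolsP n M (f : {ffun 'I_n -> 'I_M}) :
  reflect ((forall i, ext f i.+1 <= ext f i)%N /\
           forall i, ~~ odd i -> ext f i = ext f i.+1) (evcols f).
Proof.
apply: (iffP andP) => -[/nonincP f_dec h]; split=> //.
  move=> i ev_i; have [lt_in|le_ni] := ltnP i n.
    by have /forallP/(_ (Ordinal lt_in))/implyP/(_ ev_i)/eqP := h.
  by rewrite !ext_out // (leq_trans le_ni).
by apply/forallP => i; apply/implyP => /h ->.
Qed.

Definition sum_cols n M (y : 'I_n -> R) : R :=
  \sum_(f : {ffun 'I_n -> 'I_M} | evcols f) alt y (ext f).
Definition sum_all n M (y : 'I_n -> R) : R :=
  \sum_(f : {ffun 'I_n -> 'I_M} | noninc f) alt y (ext f).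
Definition evrows n M (f : {ffun 'I_n -> 'I_M}) : bool :=
  noninc f && [forall i : 'I_n, ~~ odd (ext f i)].
Definition sum_rows n M (y : 'I_n -> R) : R :=
  \sum_(f : {ffun 'I_n -> 'I_M} | evrows f) alt y (ext f).

(* There are [ext f i.-1 - ext f i] columns of length [i]. *)
Definition odd_cols n M (f : {ffun 'I_n -> 'I_M}) : nat :=
  (\sum_(i < n.+1 | odd i) (ext f i.-1 - ext f i))%N.

Lemma nilp_gt0 n M (y : 'I_n.+1 -> R) : (forall j, y j ^+ M = 0) -> (0 < M)%N.
Proof. by case: M => // /(_ ord0)/eqP; rewrite expr0 oner_eq0. Qed.

(** An even-columned l interlacing with f satisfies l_(2j+1) <= f_(2j) <= l_(2j), so both rows equal
    f_(2j). Thus l is determined by f and adds one box to each odd column of f. *)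
Lemma sum_cols_branching n M (y : 'I_n.+1 -> R)
    (y' := fun j => y (widen_ord (leqnSn n) j)) (t := y ord_max) :
    (forall j, y j ^+ M = 0) ->
  sum_cols M y = (\prod_j (y' j - t)) *
    \sum_(f : {ffun 'I_n -> 'I_M} | noninc f) t ^+ odd_cols f * alt y' (ext f).
Proof.
move=> yM; have M_gt0 := nilp_gt0 yM.
have -> : sum_cols M y = \sum_(l : {ffun 'I_n.+1 -> 'I_M} | evcols l)
    (\prod_j (y' j - t)) *
    \sum_(f : {ffun 'I_n -> 'I_M} | [forall i : 'I_n, ext l i.+1 <= f i <= ext l i]%N)
      t ^+ (ext l n + \sum_(i < n) (ext l i - f i))%N * alt y' (ext f).
  by apply: eq_bigr => l /evcolsP[l_dec _]; exact: branching.
rewrite -mulr_sumr; congr (_ * _).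
rewrite (exchange_big_dep (@noninc n M)) /=; last first.
  move=> l f _ /forallP lf; apply/nonincP => i.
  have [lt_in|le_ni] := ltnP i.+1 n; last by rewrite ext_out.
  have := lf (Ordinal lt_in); have := lf (Ordinal (ltnW lt_in)).
  by rewrite -!extE /=; lia.
apply: eq_bigr => f /nonincP f_dec.
have lam_lt (i : 'I_n.+1) : (ext f (i - odd i) < M)%N.
  have [lt_in|le_ni] := ltnP (i - odd i) n; first exact: ext_ltn.
  by rewrite ext_out.
pose lam := @mkpart n.+1 M (fun i => ext f (i - odd i)) lam_lt.
have lamE i : (i <= n)%N -> ext lam i = ext f (i - odd i).
  by move=> le_in; rewrite ext_mkpart.
rewrite (big_pred1 lam) => [|l].
  congr (t ^+ _ * _); rewrite lamE // /odd_cols.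
  rewrite [RHS]big_mkcond big_ord_recr /= addnC; congr (_ + _)%N.
    apply: eq_bigr => i _; rewrite (lamE _ (ltnW (ltn_ord i))) -extE.
    by case: ifP => od; rewrite ?subn1 // subn0 subnn.
  case: ifP => od; first by rewrite subn1 [ext f n]ext_out ?subn0.
  by rewrite subn0 ext_out.
apply/andP/eqP => [[/evcolsP[_ l_ev] /forallP lf]|->]; last first.
  split.
    apply/evcolsP; split=> i.
      have [lt_in|le_ni] := ltnP i n.
        rewrite (lamE _ lt_in) (lamE _ (ltnW lt_in)) /=.
        case: (odd i); rewrite /= ?subn0 ?subn1 //=.
        by apply: leq_trans (f_dec i) _; case: (i) => // i'; exact: f_dec.
      by rewrite ext_out.
    move=> ev_i; have [lt_in|] := ltnP i n.
      by rewrite (lamE _ lt_in) (lamE _ (ltnW lt_in)) /= ev_i (negPf ev_i) subn0 subn1.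
    rewrite leq_eqVlt => /predU1P[Eni|lt_ni]; last by rewrite !ext_out // ltnW.
    by rewrite -Eni in ev_i *; rewrite [RHS]ext_out ?lamE // ext_out // (negPf ev_i) subn0.
  apply/forallP => i; rewrite (lamE _ (ltn_ord i)) (lamE _ (ltnW (ltn_ord i))) -extE /=.
  case od: (odd i) => /=; rewrite ?subn0 ?subn1 ?leqnn //=.
  by rewrite f_dec /=; case: (nat_of_ord i) od => // i' _; exact: f_dec.
apply: eq_ext => i lt_in; rewrite lamE //.
case od: (odd i); last first.
  rewrite subn0; have [lt_in'|le_ni] := ltnP i n.
    have := lf (Ordinal lt_in'); rewrite -l_ev /= ?od // -extE /=; lia.
  by rewrite l_ev ?od // !ext_out.
have i_gt0 : (0 < i)%N by case: (i) od.
have lt_in' : (i.-1 < n)%N by lia.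
have ev_i : ~~ odd i.-1 by move: od; rewrite -{1}(prednK i_gt0).
have := lf (Ordinal lt_in'); rewrite -l_ev //= -extE /= subn1.
have := l_ev _ ev_i; rewrite prednK //; lia.
Qed.

(** Dually, l_(2j+1) <= f_(2j+1) <= l_(2j) forces both rows to be f_(2j+1): l is f with one box
    removed from each odd column. *)
Lemma sum_cols_pieri n M (y : 'I_n -> R) (t : R) : (forall j, y j ^+ M = 0) ->
  sum_cols M y = (\prod_j (1 - t * y j)) *
    \sum_(f : {ffun 'I_n -> 'I_M} | noninc f) t ^+ odd_cols f * alt y (ext f).
Proof.
move=> yM.
pose I (l f : {ffun 'I_n -> 'I_M}) := [forall i : 'I_n,
  (ext l i <= f i) && ((i == 0 :> nat) || (f i <= ext l i.-1))]%N.
have -> : sum_cols M y = \sum_(l : {ffun 'I_n -> 'I_M} | evcols l)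
    (\prod_j (1 - t * y j)) * \sum_(f : {ffun 'I_n -> 'I_M} | I l f)
      t ^+ (\sum_(i < n) (f i - ext l i))%N * alt y (ext f).
  by apply: eq_bigr => l /evcolsP[l_dec _]; exact: pieri.
rewrite -mulr_sumr; congr (_ * _).
rewrite (exchange_big_dep (@noninc n M)) /=; last first.
  move=> l f _ /forallP lf; apply/nonincP => i.
  have [lt_in|le_ni] := ltnP i.+1 n; last by rewrite ext_out.
  have := lf (Ordinal lt_in); have := lf (Ordinal (ltnW lt_in)).
  by rewrite -!extE /=; lia.
apply: eq_bigr => f /nonincP f_dec.
have lam_lt (i : 'I_n) : (ext f (i + ~~ odd i) < M)%N.
  have M_gt0 : (0 < M)%N by case: (M) (f i) => // -[].
  have [lt_in|le_ni] := ltnP (i + ~~ odd i) n; first exact: ext_ltn.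
  by rewrite ext_out.
pose lam := @mkpart n M (fun i => ext f (i + ~~ odd i)) lam_lt.
have lamE i : ext lam i = ext f (i + ~~ odd i).
  have [lt_in|le_ni] := ltnP i n; first by rewrite ext_mkpart.
  by rewrite !ext_out // (leq_trans le_ni) ?leq_addr.
rewrite (big_pred1 lam) => [|l].
  congr (t ^+ _ * _); rewrite /odd_cols [RHS]big_mkcond big_ord_recl /= add0n.
  apply: eq_bigr => i _; rewrite lamE -extE /bump /= add1n.
  by case: (odd i); rewrite /= ?addn0 ?subnn ?addn1.
apply/andP/eqP => [[/evcolsP[_ l_ev] /forallP lf]|->]; last first.
  split.
    apply/evcolsP; split=> i; rewrite !lamE /=; last first.
      by move=> ev_i; rewrite ev_i /= addn1 addn0.
    by case: (odd i); rewrite /= ?addn0 ?addn1 //; apply: leq_trans (f_dec i.+1) _.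
  apply/forallP => i; rewrite !lamE -extE /=.
  case: (posnP i) => [->|i_gt0] /=; first by rewrite andbT addn1.
  have := f_dec i.-1; have := f_dec i; rewrite -{6}(prednK i_gt0) /=.
  rewrite -{1 3 6}(prednK i_gt0) /=.
  by case: (odd i.-1); rewrite /= ?addn0 ?addn1 ?prednK //; lia.
have lodd i : odd i -> (i < n)%N -> ext l i = ext f i.
  move=> od lt_in; have i_gt0 : (0 < i)%N by case: (i) od.
  have ev_i : ~~ odd i.-1 by move: od; rewrite -{1}(prednK i_gt0).
  have := lf (Ordinal lt_in); rewrite -extE /=.
  have := l_ev _ ev_i; rewrite prednK //; lia.
apply: eq_ext => i lt_in; rewrite lamE.
case od: (odd i); first by rewrite addn0 lodd.
rewrite addn1 l_ev ?od //; have [lt_in'|le_ni] := ltnP i.+1 n; last by rewrite !ext_out.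
by rewrite lodd //= od.
Qed.

Lemma alt0_recr n M (y : 'I_n.+1 -> R)
    (y' := fun j => y (widen_ord (leqnSn n) j)) (t := y ord_max) :
    (forall j, y j ^+ M = 0) ->
  alt y (fun _ => 0%N) = (\prod_j (y' j - t)) * alt y' (fun _ => 0%N).
Proof.
move=> yM; have M_gt0 := nilp_gt0 yM.
rewrite (branching (M := M)) //; congr (_ * _).
pose f0 : {ffun 'I_n -> 'I_M} := [ffun=> Ordinal M_gt0].
rewrite (big_pred1 f0) => [|f].
  rewrite big1 ?addn0 ?mul1r //; apply: eq_alt => i lt_in.
  by rewrite (extE _ (Ordinal lt_in)) ffunE.
apply/forallP/eqP => [h|-> i]; last by rewrite ffunE.
by apply/ffunP => i; apply/val_inj; have := h i; rewrite ffunE /=; lia.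
Qed.

(** Induction on n. Branching off the last variable t, and Pieri's rule with the same t in the other
    variables, lead to the same sum weighted by odd columns; so adding t costs exactly the factors 1
    - t y_j. *)
Lemma littlewood_cols n M (y : 'I_n -> R) : (forall j, y j ^+ M = 0) ->
  sum_cols M y * (\prod_(i < n) \prod_(j < n | (i < j)%N) (1 - y i * y j))
    = alt y (fun _ => 0%N).
Proof.
elim: n y => [|n IH] y yM.
  rewrite big_ord0 mulr1 /alt det_mx00.
  have f0 : {ffun 'I_0 -> 'I_M} by apply: finfun => -[].
  rewrite /sum_cols (big_pred1 f0); first by rewrite /alt det_mx00.
  move=> f; rewrite /= (_ : f == f0); last by apply/eqP/ffunP => -[].
  by apply/evcolsP; split=> i; rewrite ?ext_out.
have M_gt0 := nilp_gt0 yM.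
rewrite (alt0_recr yM) -IH // (sum_cols_branching yM).
rewrite (sum_cols_pieri (y ord_max)) // -!mulrA; congr (_ * _).
rewrite [RHS]mulrCA; congr (_ * _); rewrite big_ord_recr /=.
rewrite [X in _ * X]big_pred0 ?mulr1; last first.
  by move=> j; have := ltn_ord j; rewrite /=; lia.
rewrite -big_split /=; apply: eq_bigr => i _.
rewrite big_mkcond big_ord_recr /= ltn_ord [RHS]mulrC; congr (_ * _).
  by rewrite [RHS]big_mkcond.
by rewrite mulrC.
Qed.

(** The factor 1 + y_j raises the exponent of each row by 0 or 1, independently of the other rows.
    When l is a partition, the f that fail to be one have a zero alternant by [alt_eq_rows]. *)
Lemma pieri_vertical n M (y : 'I_n -> R) (l : nat -> nat) :
    (forall j, y j ^+ M = 0) ->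
  (\prod_j (1 + y j)) * alt y l =
    \sum_(f : {ffun 'I_n -> 'I_M} | [forall i : 'I_n, l i <= f i <= (l i).+1]%N)
      alt y (ext f).
Proof.
move=> yM; rewrite -det_scale_cols.
pose P (i : 'I_n) (m : 'I_M) := (l i <= m <= (l i).+1)%N.
transitivity (\det (\matrix_(i, j) \sum_(m < M | P i m) y j ^+ (m + (n - i.+1)))).
  congr (\det _); apply/matrixP => i j; rewrite !mxE.
  rewrite (sum_ord_range (F := fun m => y j ^+ (m + (n - i.+1))) (l i) (l i).+2).
    by rewrite big_ltn // big_nat1 mulrDl mul1r -exprS addSn.
  by move=> m /subnKC <-; rewrite -addnA exprD yM mul0r.
rewrite (det_sum_rows P (fun i m j => y j ^+ (m + (n - i.+1)))).
by apply: eq_bigr => f _; rewrite alt_det.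
Qed.

Lemma alt_eq_rows n (y : 'I_n -> R) (l : nat -> nat) i :
  (i.+1 < n)%N -> l i.+1 = (l i).+1 -> alt y l = 0.
Proof.
move=> lt_in lE.
apply: (determinant_alternate (i1 := Ordinal (ltnW lt_in)) (i2 := Ordinal lt_in)).
  by rewrite -val_eqE /=; lia.
by move=> j; rewrite !mxE /= lE; congr (_ ^+ _); lia.
Qed.

(** Each partition f arises from exactly one even-rowed l by adding a vertical strip: l lowers every
    odd row of f by one. *)
Lemma sum_all_rows n M (y : 'I_n -> R) : (forall j, y j ^+ M = 0) ->
  (\prod_j (1 + y j)) * sum_rows M y = sum_all M y.
Proof.
move=> yM; rewrite mulr_sumr.
rewrite (eq_bigr _ (fun l _ => pieri_vertical (ext l) yM)).
rewrite (exchange_big_dep xpredT) //= [RHS]big_mkcond; apply: eq_bigr => f _.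
case: ifPn => [/nonincP f_dec|]; last first.
  rewrite negb_forall => /existsP[i]; rewrite -ltnNge => lt_f.
  have lt_in : (i.+1 < n)%N by apply: contraTT lt_f; rewrite -leqNgt => /ext_out->.
  rewrite big1 // => l /andP[/andP[/nonincP l_dec _] /forallP lf].
  apply: (alt_eq_rows _ lt_in).
  have := l_dec i; have := lf (Ordinal lt_in); have := lf i.
  by rewrite -!extE /=; lia.
have lam_lt (i : 'I_n) : (ext f i - odd (ext f i) < M)%N.
  by apply: leq_ltn_trans (leq_subr _ _) _; exact: ext_ltn.
pose lam := mkpart (g := fun i => (ext f i - odd (ext f i))%N) lam_lt.
have lamE i : ext lam i = (ext f i - odd (ext f i))%N.
  have [lt_in|le_ni] := ltnP i n; first by rewrite ext_mkpart.
  by rewrite !ext_out.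
rewrite (big_pred1 lam) // => l.
apply/andP/eqP => [[/andP[_ /forallP l_ev] /forallP lf]|->].
  apply: eq_ext => i lt_in; rewrite lamE.
  have := l_ev (Ordinal lt_in); have := lf (Ordinal lt_in); rewrite -extE /=.
  by lia.
split.
  apply/andP; split; last by apply/forallP => i; rewrite lamE; lia.
  by apply/nonincP => i; rewrite !lamE; have := f_dec i; lia.
by apply/forallP => i; rewrite lamE -extE; lia.
Qed.

(** At t = 1 the weight by odd columns disappears, so the even-column sum is the product of the 1 -
    y_j times the sum over all partitions. The passage to even rows brings 1 + y_j, and (1 - y_j)(1
    + y_j) is the diagonal factor i = j. *)
Lemma littlewood_rows n M (y : 'I_n -> R) : (forall j, y j ^+ M = 0) ->
  sum_rows M y * (\prod_(i < n) \prod_(j < n | (i <= j)%N) (1 - y i * y j))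
    = alt y (fun _ => 0%N).
Proof.
move=> yM; rewrite -(littlewood_cols yM) (sum_cols_pieri 1 yM).
have -> : \sum_(f : {ffun 'I_n -> 'I_M} | noninc f) 1 ^+ odd_cols f * alt y (ext f)
    = sum_all M y by apply: eq_bigr => f _; rewrite expr1n mul1r.
rewrite -(sum_all_rows yM) mulrA -big_split /=.
rewrite [X in _ = X * _]mulrC -mulrA; congr (_ * _); rewrite -big_split /=.
apply: eq_bigr => i _; rewrite (bigD1 i) //=; congr (_ * _); first by ring.
by apply: eq_bigl => j; rewrite ltn_neqAle andbC eq_sym.
Qed.

End Littlewood.

(** * The Cauchy-Binet formula for alternants *)

Lemma incr_perm_id n (s : 'S_n) : (forall i j : 'I_n, (i < j)%N -> (s i < s j)%N) ->
  s = 1%g.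
Proof.
move=> s_incr.
have le_i m (i : 'I_n) : i = m :> nat -> (m <= s i)%N.
  elim: m i => // m IH i im.
  have lt_mn : (m < n)%N by have := ltn_ord i; lia.
  apply: leq_ltn_trans (IH (Ordinal lt_mn) erefl) (s_incr _ _ _).
  by rewrite /= im.
have sum_s : (\sum_(i < n) s i = \sum_(i < n) i)%N.
  by rewrite [RHS](reindex_inj (@perm_inj _ s)).
apply/permP => i; rewrite perm1; apply/val_inj => /=.
apply/eqP; rewrite eqn_leq le_i // andbT leqNgt; apply/negP => lt_i.
suff : (\sum_(i < n) i < \sum_(i < n) s i)%N by rewrite sum_s ltnn.
rewrite (bigD1 i) //= [ltnRHS](bigD1 i) //= -addSn leq_add //.
by apply: leq_sum => j _; exact: le_i.
Qed.

Lemma sort_perm n (h : 'I_n -> nat) : injective h ->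
  exists s : 'S_n, forall i j : 'I_n, (i < j)%N -> (h (s^-1 j)%g < h (s^-1 i)%g)%N.
Proof.
(* The rank of [h i], that is, the number of larger values, is its position in the decreasing
   order. *)
move=> h_inj; pose r i := #|[set k | (h i < h k)%N]|.
have r_lt i : (r i < n)%N.
  rewrite -[ltnRHS]card_ord; apply: proper_card; apply/properP; split.
    by apply/fintype.subsetP.
  by exists i; rewrite ?inE ?ltnn.
have r_mono i j : (h j < h i)%N -> (r i < r j)%N.
  move=> lt_ji; apply: proper_card; apply/properP; split.
    by apply/fintype.subsetP => k; rewrite !inE; apply: ltn_trans.
  by exists i; rewrite !inE ?ltnn.
have r_inj : injective (fun i => Ordinal (r_lt i)).
  move=> i j /(congr1 val)/= r_eq; apply: h_inj.
  by case: (ltngtP (h i) (h j)) => // /r_mono; rewrite r_eq ltnn.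
exists (perm r_inj) => i j lt_ij; have s_dec k l : (h l < h k)%N -> (perm r_inj k < perm r_inj l)%N.
  by move=> /r_mono; rewrite !permE.
case: ltngtP => // [/s_dec|/h_inj/perm_inj E]; last by rewrite E ltnn in lt_ij.
by rewrite !permKV; lia.
Qed.

Lemma decreasing_ge n (d : 'I_n -> nat) (i : 'I_n) :
  (forall j k : 'I_n, (j < k)%N -> (d k < d j)%N) -> (n - i.+1 <= d i)%N.
Proof.
move=> d_dec; move Em: (n - i.+1)%N => m; elim: m i Em => // m IH i im.
have lt_i : (i.+1 < n)%N by lia.
apply: leq_ltn_trans (IH (Ordinal lt_i) _) (d_dec i _ _) => //=; lia.
Qed.

(** Maximal minors are indexed by sets of n exponents, that is by partitions f through f_i + n - i -
    1. Expanding the right side by rows gives a sum over maps h: a noninjective h has two equal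
    rows, an injective one is a partition together with a permutation. *)
Lemma cauchy_binet (R : comNzRingType) n M (y : 'I_n -> R) (g : 'I_n -> nat -> R) :
    (forall j, y j ^+ M = 0) ->
  \sum_(f : {ffun 'I_n -> 'I_M} | noninc f)
     \det (\matrix_(i, k) g k (ext f i + (n - i.+1))%N) * alt y (ext f)
   = \det (\matrix_(k, j) \sum_(m < M) g k m * y j ^+ m).
Proof.
case: n y g => [|n'] y g yM.
  have f0 : {ffun 'I_0 -> 'I_M} by apply: finfun => -[].
  rewrite (big_pred1 f0) /alt ?det_mx00 ?mulr1 // => f.
  rewrite /= (_ : f == f0); last by apply/eqP/ffunP => -[].
  by apply/nonincP => i; rewrite ext_out.
have M_gt0 := nilp_gt0 yM; set n := n'.+1 in y g yM *.
rewrite (det_sum_rows (fun _ => predT) (fun k m j => g k m * y j ^+ m)).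
pose a (h : 'I_n -> nat) := \det (\matrix_(k, j) y j ^+ h k).
rewrite [RHS](eq_bigl xpredT); last by move=> h; rewrite /=; apply/forallP.
have -> : \sum_(h : {ffun 'I_n -> 'I_M}) \det (\matrix_(k, j) (g k (h k) * y j ^+ h k))
   = \sum_(h : {ffun 'I_n -> 'I_M}) (\prod_k g k (h k)) * a (fun k => h k).
  apply: eq_bigr => h _; rewrite -det_scale_rows; congr (\det _).
  by apply/matrixP => i j; rewrite !mxE.
pose e (f : {ffun 'I_n -> 'I_M}) i := (ext f i + (n - i.+1))%N.
have altE f : alt y (ext f) = a (e f) by [].
(* A partition with an exponent at or above M has a zero row in its alternant. *)
rewrite (bigID (fun f => [forall i : 'I_n, e f i < M]%N)) /= addrC big1 ?add0r; last first.
  move=> f /andP[_]; rewrite negb_forall => /existsP[i]; rewrite -leqNgt => le_M.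
  rewrite altE /a [X in _ * X](expand_det_row _ i) big1 ?mulr0 // => j _.
  by rewrite mxE -(subnKC le_M) exprD yM !mul0r.
pose D := [set fs : {ffun 'I_n -> 'I_M} * 'S_n |
            noninc fs.1 && [forall i : 'I_n, e fs.1 i < M]%N].
(* The default value is not taken on [D], where all exponents are below M. *)
pose H (fs : {ffun 'I_n -> 'I_M} * 'S_n) : {ffun 'I_n -> 'I_M} :=
  [ffun k => insubd (Ordinal M_gt0) (e fs.1 (fs.2 k))].
have HE fs k : fs \in D -> H fs k = e fs.1 (fs.2 k) :> nat.
  by rewrite inE => /andP[_ /forallP eM]; rewrite ffunE val_insubd eM.
have e_dec f i j : noninc f -> (i < j)%N -> (j < n)%N -> (e f j < e f i)%N.
  move=> /nonincP f_dec; elim: j => // j IH; rewrite ltnS leq_eqVlt => /predU1P[->|lt_ij] lt_jn.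
    by have := f_dec j; rewrite /e; lia.
  by apply: ltn_trans (IH lt_ij (ltnW lt_jn)); have := f_dec j; rewrite /e; lia.
have H_inj : {in D &, injective H}.
  move=> [f s] [f' s'] fsD fs'D HH.
  have ee k : e f (s k) = e f' (s' k) by rewrite -(HE _ _ fsD) -(HE _ _ fs'D) HH.
  move: fsD fs'D; rewrite !inE /= => /andP[f_dec _] /andP[f'_dec _].
  have : (s^-1 * s')%g = 1%g.
    apply: incr_perm_id => i j lt_ij; rewrite !permM.
    have := ee (s^-1 i)%g; have := ee (s^-1 j)%g; rewrite !permKV => ej ei.
    have := e_dec _ _ _ f_dec lt_ij (ltn_ord j); rewrite ei ej => lt_e.
    case: ltngtP => // [lt_s|eq_s].
      by have := e_dec _ _ _ f'_dec lt_s (ltn_ord _); lia.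
    by move: lt_e; rewrite eq_s ltnn.
  move/(canRL (mulKg _)); rewrite invgK mulg1 => s's; congr (_, _) => //.
  apply: eq_ext => i lt_in; have := ee (s^-1 (Ordinal lt_in))%g.
  by rewrite s's !permKV /e /=; lia.
have H_im h : h \in H @: D = injectiveb h.
  apply/imsetP/injectiveP => [[[f s] fsD ->]|h_inj].
    move=> i j /(congr1 val) /=; rewrite !HE //= => eij.
    move: fsD; rewrite inE /= => /andP[f_dec _].
    apply: (@perm_inj _ s); apply/val_inj => /=.
    by case: (ltngtP (s i) (s j)) => // /(e_dec _ _ _ f_dec) lt_e; have := lt_e (ltn_ord _); rewrite eij ltnn.
  have [s d_dec] := sort_perm (h := fun i => h i : nat) (fun i j hij => h_inj i j (val_inj hij)).
  pose d (i : 'I_n) : nat := h (s^-1 i)%g.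
  have {}d_dec (i j : 'I_n) : (i < j)%N -> (d j < d i)%N by exact: d_dec.
  have d_ge (i : 'I_n) : (n - i.+1 <= d i)%N by exact: decreasing_ge.
  pose f : {ffun 'I_n -> 'I_M} := [ffun i => insubd (Ordinal M_gt0) (d i - (n - i.+1))%N].
  have fE (i : 'I_n) : ext f i = (d i - (n - i.+1))%N.
    by rewrite extE ffunE val_insubd (leq_ltn_trans (leq_subr _ _) (ltn_ord _)).
  have efE (i : 'I_n) : e f i = d i by rewrite /e fE subnK ?d_ge.
  have fsD : (f, s) \in D.
    rewrite inE; apply/andP; split=> /=; last by apply/forallP => i; rewrite efE; exact: ltn_ord.
    apply/nonincP => i; have [lt_in|le_ni] := ltnP i.+1 n; last by rewrite ext_out.
    rewrite (fE (Ordinal lt_in)) (fE (Ordinal (ltnW lt_in))) /=.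
    by have := d_dec (Ordinal (ltnW lt_in)) (Ordinal lt_in) (ltnSn _); lia.
  exists (f, s) => //; apply/ffunP => k; apply/val_inj => /=.
  by rewrite HE //= efE /d permK.
rewrite [RHS](bigID (fun h : {ffun _ -> _} => injectiveb h)) /= [X in _ = _ + X]big1 ?addr0; last first.
  move=> h /injectivePn[i [j neq_ij hij]]; rewrite /a (determinant_alternate neq_ij) ?mulr0 //.
  by move=> k; rewrite !mxE hij.
rewrite -(eq_bigl _ _ H_im) (big_imset _ H_inj) /=.
rewrite (eq_bigl (fun fs => (noninc fs.1 && [forall i : 'I_n, e fs.1 i < M]%N) && true)); last first.
  by move=> fs; rewrite inE andbT.
rewrite -(pair_big_dep (fun f => noninc f && [forall i : 'I_n, e f i < M]%N) (fun _ _ => true)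
  (fun f s => (\prod_k g k (H (f, s) k)) * a (fun k => H (f, s) k))) /=.
apply: eq_bigr => f f_ok; rewrite altE -det_tr /determinant mulr_suml.
apply: eq_bigr => s _; have fsD : (f, s) \in D by rewrite inE.
have -> : a (fun k => H (f, s) k) = (-1) ^+ s * a (e f).
  rewrite -[X in X * _]det_perm -det_mulmx; congr (\det _).
  apply/matrixP => k j; rewrite !mxE HE //= (bigD1 (s k)) //= big1 => [|i /negPf ne]; last first.
    by rewrite !mxE eq_sym ne mul0r.
  by rewrite !mxE eqxx mul1r addr0.
rewrite mulrCA mulrA; congr (_ * _ * _).
by apply: eq_bigr => k _; rewrite !mxE HE.
Qed.

(** * Power series *)

(** A separate name for sequences, whose product is [serM] and not the pointwise one. *)
Definition ser (A : comNzRingType) : Type := nat -> A.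

HB.instance Definition _ (A : comNzRingType) := Choice.on (ser A).

Section SerRing.
Variable A : comNzRingType.
Implicit Types f g h : ser A.

Definition trunc m f : {poly A} := \poly_(i < m) f i.

(** The coefficient of q^k only sees the terms up to k; commutativity and associativity of [serM]
    are thus inherited from polynomials. *)
Lemma serM_coef m f g k : (k < m)%N -> serM f g k = (trunc m f * trunc m g)`_k.
Proof.
move=> lt_km; rewrite coefM; apply: eq_bigr => i _.
by rewrite !coef_poly !ifT //; have := ltn_ord i; lia.
Qed.

Lemma coef_mul_low m (p q r : {poly A}) :
  (forall i, (i < m)%N -> p`_i = q`_i) -> forall i, (i < m)%N -> (p * r)`_i = (q * r)`_i.
Proof.
move=> pq i lt_im; rewrite !coefM; apply: eq_bigr => j _.
by rewrite pq //; have := ltn_ord j; lia.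
Qed.

Definition ser0 : ser A := fun _ => 0.
Definition serD f g : ser A := fun k => f k + g k.
Definition serN f : ser A := fun k => - f k.

Fact serDA : associative serD.
Proof. by move=> f g h; apply: funext => k; apply: addrA. Qed.
Fact serDC : commutative serD.
Proof. by move=> f g; apply: funext => k; apply: addrC. Qed.
Fact ser0D : left_id ser0 serD.
Proof. by move=> f; apply: funext => k; apply: add0r. Qed.
Fact serND : left_inverse ser0 serN serD.
Proof. by move=> f; apply: funext => k; apply: addNr. Qed.

HB.instance Definition _ := GRing.isZmodule.Build (ser A) serDA serDC ser0D serND.

Fact serMC : commutative (@serM A).
Proof.
by move=> f g; apply: funext => k; rewrite !(serM_coef _ _ (ltnSn k)) mulrC.
Qed.
Fact serMA : associative (@serM A).
Proof.
move=> f g h; apply: funext => k; rewrite !(serM_coef _ _ (ltnSn k)).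
rewrite mulrC (coef_mul_low (m := k.+1) (p := trunc k.+1 (serM g h)) (q := trunc k.+1 g * trunc k.+1 h)) // => [|i lt_ik]; last first.
  by rewrite coef_poly lt_ik (serM_coef _ _ lt_ik).
rewrite mulrC mulrA; apply: coef_mul_low (ltnSn k) => i lt_ik.
by rewrite coef_poly lt_ik (serM_coef _ _ lt_ik).
Qed.
Fact ser1M : left_id (@ser1 A) (@serM A).
Proof.
move=> f; apply: funext => k; rewrite /serM big_ord_recl /ser1 mul1r subn0.
by rewrite big1 ?addr0 // => i _; rewrite mul0r.
Qed.
Fact serMDl : left_distributive (@serM A) serD.
Proof.
move=> f g h; apply: funext => k; rewrite /serD /serM -big_split /=.
by apply: eq_bigr => i _; rewrite mulrDl.
Qed.
Fact ser1_neq0 : (@ser1 A : ser A) != 0.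
Proof.
by apply/eqP => /(congr1 (fun f : ser A => f 0%N))/eqP; rewrite oner_eq0.
Qed.

HB.instance Definition _ :=
  GRing.Zmodule_isComNzRing.Build (ser A) serMA serMC ser1M serMDl ser1_neq0.

Lemma serE (f g : ser A) k : (f * g) k = \sum_(i < k.+1) f i * g (k - i)%N.
Proof. by []. Qed.

Lemma ser_sum I (r : seq I) (P : pred I) (F : I -> ser A) k :
  (\sum_(i <- r | P i) F i) k = \sum_(i <- r | P i) F i k.
Proof. by elim/big_rec2: _ => // i x y _ <-. Qed.

Definition pser (p : {poly A}) : ser A := fun k => p`_k.

Fact pser_is_zmod_morphism : zmod_morphism pser.
Proof. by move=> p q; apply: funext => k; rewrite /pser coefB. Qed.
Fact pser_is_monoid_morphism : monoid_morphism pser.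
Proof.
split; first by apply: funext => k; rewrite /pser coef1.
by move=> p q; apply: funext => k; rewrite /pser coefM.
Qed.
HB.instance Definition _ := GRing.isZmodMorphism.Build {poly A} (ser A) pser
  pser_is_zmod_morphism.
HB.instance Definition _ := GRing.isMonoidMorphism.Build {poly A} (ser A) pser
  pser_is_monoid_morphism.

Lemma coef_pserC c (f : ser A) k : (pser c%:P * f) k = c * f k.
Proof.
rewrite serE big_ord_recl /pser coefC subn0 big1 ?addr0 // => i _.
by rewrite coefC mul0r.
Qed.

Lemma coef_pserXn d (f : ser A) k :
  (f * pser 'X^d) k = if (k < d)%N then 0 else f (k - d)%N.
Proof.
rewrite mulrC serE /pser; case: ltnP => [lt_kd|le_dk].
  by rewrite big1 // => i _; rewrite coefXn (_ : _ == _ = false) ?mul0r //; have := ltn_ord i; lia.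
have lt_d : (d < k.+1)%N by [].
rewrite (bigD1 (Ordinal lt_d)) //= coefXn eqxx mul1r big1 ?addr0 // => i.
by rewrite -val_eqE /= coefXn => /negPf ->; rewrite mul0r.
Qed.

Lemma geometricK (a : A) : (geometric a : ser A) * pser (1 - a *: 'X) = 1.
Proof.
apply: funext => k; rewrite rmorphB rmorph1 mulrBr mulr1.
rewrite -mul_polyC rmorphM /= mulrCA.
change (geometric a k - (pser a%:P * ((geometric a : ser A) * pser 'X)) k = ser1 k).
rewrite coef_pserC -['X]expr1 coef_pserXn /geometric /ser1.
by case: k => [|k]; rewrite /= ?mulr0 ?subr0 // subn1 -exprS subrr.
Qed.

End SerRing.

Section Evaluation.
Variables (A R : comNzRingType) (phi : {rmorphism A -> R}) (M : nat) (y : R).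
Hypothesis yM : y ^+ M = 0.

(** Substitution of the nilpotent [y] for the variable: a finite sum, yet multiplicative on all
    series. *)
Definition ev (f : ser A) : R := \sum_(m < M) phi (f m) * y ^+ m.

Lemma horner_nilp (P : {poly R}) : P.[y] = \sum_(m < M) P`_m * y ^+ m.
Proof.
rewrite (horner_coef_wide _ (leq_maxl (size P) M)).
rewrite (big_ord_widen _ (fun m => P`_m * y ^+ m) (leq_maxr (size P) M)).
rewrite [RHS]big_mkcond; apply: eq_bigr => m _; case: ltnP => // le_Mm.
by rewrite -(subnKC le_Mm) exprD yM mul0r mulr0.
Qed.

Lemma ev_trunc (f : ser A) : ev f = (map_poly phi (trunc M f)).[y].
Proof.
rewrite horner_nilp; apply: eq_bigr => m _.
by rewrite coef_map coef_poly ltn_ord.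
Qed.

Lemma ev_pser (p : {poly A}) : ev (pser p) = (map_poly phi p).[y].
Proof. by rewrite horner_nilp; apply: eq_bigr => m _; rewrite coef_map. Qed.

Lemma evM (f g : ser A) : ev (f * g) = ev f * ev g.
Proof.
rewrite !ev_trunc -hornerM -rmorphM /= !horner_nilp.
apply: eq_bigr => m _; rewrite !coef_map coef_poly ltn_ord.
by rewrite -(serM_coef f g (ltn_ord m)).
Qed.

End Evaluation.

Section MapSeries.
Variables (A B : comNzRingType) (phi : {rmorphism A -> B}).
Definition mapser (f : ser A) : ser B := fun k => phi (f k).

Fact mapser_is_zmod_morphism : zmod_morphism mapser.
Proof. by move=> f g; apply: funext => k; exact: (rmorphB phi (f k) (g k)). Qed.
Fact mapser_is_monoid_morphism : monoid_morphism mapser.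
Proof.
split=> [|f g]; apply: funext => k; first exact: (rmorph_nat phi (k == 0%N)).
by rewrite /mapser serE rmorph_sum; apply: eq_bigr => i _; rewrite rmorphM.
Qed.
HB.instance Definition _ := GRing.isZmodMorphism.Build (ser A) (ser B) mapser
  mapser_is_zmod_morphism.
HB.instance Definition _ := GRing.isMonoidMorphism.Build (ser A) (ser B) mapser
  mapser_is_monoid_morphism.

Lemma mapser_pser p : mapser (pser p) = pser (map_poly phi p).
Proof. by apply: funext => k; rewrite /pser coef_map. Qed.

Lemma mapser_geometric a : mapser (geometric a) = geometric (phi a).
Proof. by apply: funext => k; rewrite /mapser /geometric rmorphXn. Qed.
End MapSeries.

(** * Jacobi-Trudi determinants *)

(** The coefficients are found once for all rings S and all pairs (a, z). With z = 'X they expand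
    the products over k != j below in the columns of [jt]. *)
Lemma homogenized_prod (A : comNzRingType) (r : seq A) :
  exists c : nat -> A, forall S : comNzRingType, forall (phi : {rmorphism A -> S}) (a z : S),
    \prod_(x <- r) (a - phi x * z)
      = \sum_(l < (size r).+1) phi (c l) * (a ^+ l * z ^+ (size r - l)).
Proof.
elim: r => [|x r [c IH]].
  exists (fun _ => 1) => S phi a z.
  by rewrite big_nil big_ord1 rmorph1 !expr0 !mulr1.
exists (fun l => (if l is l'.+1 then c l' else 0) - x * (if (l <= size r)%N then c l else 0)).
move=> S phi a z; rewrite big_cons IH /= mulrBl.
under [RHS]eq_bigr do rewrite rmorphB mulrBl.
rewrite sumrB; congr (_ - _).
  rewrite [RHS]big_ord_recl /= rmorph0 mul0r add0r mulr_sumr; apply: eq_bigr => l _ /=.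
  by rewrite /bump /= add1n subSS exprS; ring.
rewrite [RHS]big_ord_recr /= ltnn mulr0 rmorph0 mul0r addr0 mulr_sumr.
apply: eq_bigr => l _; rewrite -ltnS ltn_ord rmorphM subSn; last by rewrite -ltnS ltn_ord.
by rewrite exprS; ring.
Qed.

Section JacobiTrudi.
Variables (B : comNzRingType) (n : nat) (H : ser B) (D A : {poly B}).

(* With [D = A = 1] this is the determinant of the [h_(l_i - i + j)], where [h]
   is the sequence of coefficients of [H]. *)
Definition jt (l : nat -> nat) : B :=
  \det (\matrix_(i < n, k < n)
    (H * pser (D * A ^+ k * 'X^(n - k.+1))) (l i + (n - i.+1))%N).

Hypotheses (H0 : H 0%N = 1) (D0 : D`_0 = 1) (A0 : A`_0 = 1).

Lemma jt_nil : jt (fun=> 0%N) = 1.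
Proof.
rewrite /jt -det_tr det_trig.
  rewrite big1 // => i _; rewrite !mxE add0n rmorphM mulrA coef_pserXn ltnn subnn.
  by rewrite serE big_ord1 /= H0 mul1r /pser subn0 coef0M D0 mul1r -!horner_coef0 horner_exp horner_coef0 A0 expr1n.
apply/is_trig_mxP => k i lt_ki; rewrite !mxE rmorphM mulrA coef_pserXn add0n ifT //.
by have := ltn_ord i; lia.
Qed.

(** Each [b j] is a constant times H D times a product homogeneous of degree n - 1 in A and X.
    Expanding it in the A^k X^(n-1-k) factors the matrix into that of [jt] and a matrix [c]
    independent of [l]. As [jt] is 1 at l = 0, the determinant of [c] is the one obtained for l =
    0. *)
Lemma jacobi_trudi (x kappa : 'I_n -> B) (b : 'I_n -> ser B) (l : nat -> nat) :
    (forall j, b j = pser (kappa j)%:P * (H *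
       pser (D * \prod_(k < n | k != j) (A - (x k)%:P * 'X)))) ->
  \det (\matrix_(i < n, j < n) b j (l i + (n - i.+1))%N) =
    \det (\matrix_(i < n, j < n) b j (n - i.+1)%N) * jt l.
Proof.
move=> bE.
have [c cE] : exists c : 'I_n -> nat -> B, forall j,
    b j = \sum_(k < n) pser (c j k)%:P * (H * pser (D * A ^+ k * 'X^(n - k.+1))).
  have /choice[c cE] j : exists c : nat -> B,
      b j = \sum_(k < n) pser (c k)%:P * (H * pser (D * A ^+ k * 'X^(n - k.+1))).
    pose r := [seq x k | k <- enum (predC1 j)].
    have size_r : (size r).+1 = n.
      by rewrite size_map -cardE cardC1 card_ord prednK //; have := ltn_ord j; lia.
    have [c cE] := homogenized_prod r.
    exists (fun k => kappa j * c k); rewrite bE.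
    have -> : \prod_(k < n | k != j) (A - (x k)%:P * 'X)
        = \sum_(k < n) (c k)%:P * (A ^+ k * 'X^(n - k.+1)).
      have := cE _ (@polyC B : {rmorphism _ -> _}) A 'X; rewrite big_map big_enum /=.
      rewrite size_r => cEr; transitivity (\prod_(k in predC1 j) (A - (x k)%:P * 'X)) => //.
      by rewrite cEr; apply: eq_bigr => k _; congr (_ * (_ * 'X^_)); lia.
    rewrite mulr_sumr rmorph_sum !mulr_sumr; apply: eq_bigr => k _ /=.
    by rewrite !rmorphM /=; ring.
  by exists c.
have detE (m : 'I_n -> nat) : \det (\matrix_(i < n, j < n) b j (m i)) =
    \det (\matrix_(i < n, k < n) (H * pser (D * A ^+ k * 'X^(n - k.+1))) (m i)) *
    \det (\matrix_(k < n, j < n) c j k).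
  rewrite -det_mulmx; congr (\det _); apply/matrixP => i j; rewrite !mxE cE ser_sum.
  by apply: eq_bigr => k _; rewrite !mxE coef_pserC mulrC.
have := jt_nil; rewrite /jt => jt0.
by rewrite !detE -[X in _ = X * _ * _]/(jt (fun=> 0%N)) jt_nil mul1r mulrC.
Qed.
End JacobiTrudi.

Lemma jtGE (B : comNzRingType) (H : ser B) n (l : nat -> nat) :
  jt n H 1 1 l = \det (\matrix_(i < n, k < n)
    (if (l i + k < i)%N then 0 else H (l i + k - i)%N)).
Proof.
congr (\det _); apply/matrixP => i k; rewrite !mxE expr1n !mul1r coef_pserXn.
have lt_i := ltn_ord i; have lt_k := ltn_ord k.
by case: ltnP => ?; case: ltnP => ? //; first [lia | congr (H _); lia].
Qed.

(** The rows with l_i = 0 end in a unitriangular block. This cuts a determinant whose size is the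
    number of variables down to one whose size is the rank. *)
Lemma jtG_widen (B : comNzRingType) (H : ser B) n r (l : nat -> nat) :
    H 0%N = 1 -> (forall i, (n <= i)%N -> l i = 0%N) ->
  jt (n + r) H 1 1 l = jt n H 1 1 l.
Proof.
move=> H0 l0; rewrite !jtGE; set E := (X in \det X = _).
rewrite -[E]submxK (_ : dlsubmx E = 0).
  rewrite det_ublock (_ : \det (drsubmx E) = 1) ?mulr1.
    by congr (\det _); apply/matrixP => i j; rewrite !mxE.
  rewrite -det_tr det_trig.
    by rewrite big1 // => i _; rewrite !mxE /= l0 ?leq_addr // add0n ltnn subnn.
  by apply/is_trig_mxP => i j lt_ij; rewrite !mxE /= l0 ?leq_addr // add0n ltn_add2l lt_ij.
apply/matrixP => i j; rewrite !mxE /= l0 ?leq_addr // add0n ifT //.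
by have := ltn_ord j; lia.
Qed.

(** * Truncated polynomial rings *)

(** Makes 'X nilpotent without losing the coefficients up to M, so that statements on nilpotent
    variables yield identities between homogeneous components. *)
Lemma truncated_poly_ring (A : comNzRingType) (M : nat) :
  exists (R : comNzRingType) (phi : {rmorphism {poly A} -> R}),
    phi 'X ^+ M.+1 = 0 /\
    forall p, phi p = 0 -> forall i, (i <= M)%N -> p`_i = 0.
Proof.
exists {poly %/ ('X^(M.+1) : {poly A})}, (in_qpoly ('X^(M.+1) : {poly A})).
have E : mk_monic ('X^(M.+1) : {poly A}) = 'X^(M.+1) by rewrite mk_monic_Xn.
split.
  rewrite -rmorphXn /=; apply/val_inj => /=.
  by rewrite E; apply: Pdiv.RingMonic.rmodpp; exact: monicXn.
move=> p /(congr1 val) /=; rewrite E => p0 i le_iM.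
rewrite (Pdiv.RingMonic.rdivp_eq (monicXn A M.+1) p) p0 addr0 coefMXn ifT //.
Qed.

(** * Specialization of integral polynomials *)

Section Spec.
Variables (N : nat) (B : comNzRingType) (p : 'I_N -> B).

Definition spec : {mpoly int[N]} -> B := mmap (intmul 1) p.
HB.instance Definition _ := GRing.RMorphism.on spec.

Lemma specX i : spec 'X_i = p i.
Proof. by rewrite /spec mmapX mmap1U. Qed.

Lemma spec_unique (f : {rmorphism {mpoly int[N]} -> B}) :
  (forall i, f 'X_i = p i) -> forall q, f q = spec q.
Proof.
have gC (g : {rmorphism {mpoly int[N]} -> B}) c : g c%:MP = c%:~R.
  by rewrite -{1}[c]intz !rmorph_int.
move=> fX q; rewrite (mpolyE q) !rmorph_sum; apply: eq_bigr => m _ /=.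
rewrite -!mul_mpolyC !rmorphM /= gC (gC spec); congr (_ * _).
rewrite mpolyXE_id !rmorph_prod; apply: eq_bigr => i _ /=.
by rewrite !rmorphXn /= fX specX.
Qed.

End Spec.

Lemma spec_comp N (A B : comNzRingType) (f : {rmorphism A -> B}) (p : 'I_N -> A) q :
  f (spec p q) = spec (f \o p) q.
Proof.
apply: (@spec_unique N B (f \o p) (f \o spec p)) => i.
by congr (f _); exact: specX.
Qed.

Lemma eq_spec N (B : comNzRingType) (p p' : 'I_N -> B) q : p =1 p' -> spec p q = spec p' q.
Proof.
move=> pp; apply: (@spec_unique N B p' (spec p)) => i.
exact: etrans (specX p i) (pp i).
Qed.

(* [q] is homogeneous of degree [d]. *)
Definition graded N d (q : {mpoly int[N]}) : Prop :=
  spec (fun i => ('X_i)%:P * 'X) q = q%:P * 'X^d.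

Lemma spec_graded N (B : comNzRingType) (p : 'I_N -> B) t d q :
  graded d q -> spec (fun i => t * p i) q = t ^+ d * spec p q.
Proof.
move=> hq; pose f := fun r : {poly {mpoly int[N]}} => (map_poly (spec p) r).[t].
have := congr1 f hq; rewrite /f.
have -> : (map_poly (spec p) (spec (fun i => ('X_i)%:P * 'X) q)).[t] = spec (fun i => t * p i) q.
  rewrite spec_comp.
  rewrite -[LHS]/(horner_eval t _) spec_comp; apply: eq_spec => i /=.
  by rewrite /horner_eval rmorphM /= map_polyC map_polyX /= specX hornerM hornerC hornerX mulrC.
move=> ->; rewrite rmorphM /= map_polyC rmorphXn /= map_polyX.
by rewrite hornerM hornerC hornerXn mulrC.
Qed.

Lemma gradedM N d e (q r : {mpoly int[N]}) : graded d q -> graded e r -> graded (d + e) (q * r).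
Proof. by move=> hq hr; rewrite /graded rmorphM /= hq hr rmorphM /= exprD; ring. Qed.

Lemma graded_cancel N d e (q r : {mpoly int[N]}) :
  r != 0 -> graded e r -> graded (d + e) (q * r) -> graded d q.
Proof.
move=> r0 hr; rewrite /graded rmorphM /= hr rmorphM /= exprD => E.
have rX0 : r%:P * 'X^e != 0 :> {poly {mpoly int[N]}}.
  by rewrite mulf_neq0 ?polyC_eq0 // monic_neq0 ?monicXn.
by apply: (mulIf rX0); rewrite E; ring.
Qed.

(** * Alternants *)

(** The degree of the alternant of [l]. *)
Definition wt n (l : nat -> nat) : nat := \sum_(i < n) (l i + (n - i.+1)).

Lemma alt_scale (R : comNzRingType) n (t : R) (y : 'I_n -> R) l :
  alt (fun j => t * y j) l = t ^+ wt n l * alt y l.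
Proof.
rewrite -prodrXr -det_scale_rows; congr (\det _); apply/matrixP => i j.
by rewrite !mxE exprMn.
Qed.

Lemma rmorph_alt (R S : comNzRingType) (f : {rmorphism R -> S}) n (y : 'I_n -> R) l :
  f (alt y l) = alt (f \o y) l.
Proof.
by rewrite -det_map_mx; congr (\det _); apply/matrixP => i j; rewrite !mxE rmorphXn.
Qed.

Lemma graded_alt N l : graded (wt N l) (alt (fun j => 'X_j : {mpoly int[N]}) l).
Proof.
have := rmorph_alt (spec (fun i => ('X_i)%:P * 'X : {poly {mpoly int[N]}})) (fun j : 'I_N => 'X_j) l.
rewrite /graded => ->; have := rmorph_alt (@polyC {mpoly int[N]}) (fun j : 'I_N => 'X_j) l.
move=> /= ->; rewrite mulrC -alt_scale.
congr (\det _); apply/matrixP => i j; rewrite !mxE /= specX; congr (_ ^+ _).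
exact: mulrC.
Qed.

(** Both l + delta and l' + delta strictly decrease, and only the identity permutation preserves
    this order. *)
Lemma mcoeff_alt (A : comNzRingType) n (l l' : nat -> nat) :
    (forall i, (l i.+1 <= l i)%N) -> (forall i, (l' i.+1 <= l' i)%N) ->
  (alt (fun j => 'X_j : {mpoly A[n]}) l)@_[multinom (l' i + (n - i.+1))%N | i < n]
    = [forall i : 'I_n, l i == l' i]%:R.
Proof.
move=> l_dec l'_dec.
have dec (k : nat -> nat) i j : (forall i, (k i.+1 <= k i)%N) -> (i < j < n)%N ->
    (k j + (n - j.+1) < k i + (n - i.+1))%N.
  move=> k_dec /andP[lt_ij lt_jn]; have : (k j <= k i)%N; last by lia.
  by elim: j lt_ij {lt_jn} => // j IH; rewrite ltnS leq_eqVlt => /predU1P[->|/IH] //; apply: leq_trans.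
have mono (s : 'S_n) : \prod_(i < n) (\matrix_(i < n, j < n) ('X_j : {mpoly A[n]}) ^+ (l i + (n - i.+1))) i (s i)
    = 'X_[[multinom (l (s^-1 i)%g + (n - (s^-1 i)%g.+1))%N | i < n]].
  rewrite [RHS]mpolyXE_id [RHS](reindex_inj (@perm_inj _ s)) /=; apply: eq_bigr => i _.
  by rewrite mxE mnmE permK.
rewrite /alt /determinant raddf_sum /=.
have coefE (s : 'S_n) : ((-1) ^+ s * 'X_[[multinom (l (s^-1 i)%g + (n - (s^-1 i)%g.+1))%N | i < n]] : {mpoly A[n]})@_[multinom (l' i + (n - i.+1))%N | i < n]
   = ((s == 1%g) && [forall i : 'I_n, l i == l' i])%:R.
  rewrite -(rmorph_sign (@mpolyC n A)) mcoeffCM mcoeffX.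
  case: (s =P 1%g) => [->|s1] /=.
    rewrite odd_perm1 expr0 mul1r; congr (nat_of_bool _)%:R.
    apply/eqP/forallP => [/mnmP h i|h].
      by have := h i; rewrite !mnmE invg1 !perm1 => /eqP; rewrite eqn_add2r.
    by apply/mnmP => i; rewrite !mnmE invg1 perm1 (eqP (h i)).
  case: eqP => [/mnmP h|_]; last by rewrite mulr0.
  case: s1; apply: invg_inj; rewrite invg1; apply: incr_perm_id => i j lt_ij.
  have := h i; have := h j; rewrite !mnmE => ej ei.
  have := dec _ _ _ l'_dec (_ : i < j < n)%N; rewrite -ej -ei lt_ij ltn_ord => /(_ isT).
  case: (ltngtP (s^-1 i)%g (s^-1 j)%g) => // [lt_s|/val_inj ->]; last by rewrite ltnn.
  by have := dec _ _ _ l_dec (_ : (s^-1 j)%g < (s^-1 i)%g < n)%N; rewrite lt_s ltn_ord => /(_ isT); lia.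
under eq_bigr do rewrite mono coefE.
by rewrite (bigD1 1%g) //= eqxx big1 ?addr0 // => s /negPf->.
Qed.

(** * Partitions *)

Lemma nth_part_noninc (la : part) i : (nth 0 la i.+1 <= nth 0 la i)%N.
Proof.
case: la => s /= /andP[s_sorted _].
have [lt_is|le_si] := ltnP i.+1 (size s); last by rewrite (nth_default _ le_si).
have geq_trans : transitive geq by move=> x y z /=; lia.
by apply: (sorted_ltn_nth geq_trans 0%N s_sorted); rewrite ?inE // ltnW.
Qed.

Lemma nth_part_le (la : part) i j : (i <= j)%N -> (nth 0 la j <= nth 0 la i)%N.
Proof.
move=> /subnKC <-; elim: (j - i)%N => [|d IH]; first by rewrite addn0.
by rewrite addnS; apply: leq_trans (nth_part_noninc _ _) IH.
Qed.

Lemma nth_part_gt0 (la : part) i : (0 < nth 0 la i)%N = (i < size la)%N.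
Proof.
have [lt_i|le_i] := ltnP i (size la); last by rewrite nth_default.
rewrite lt0n; case: la lt_i => s /= /andP[_ s0] lt_i.
by apply: contraNneq s0 => <-; exact: mem_nth.
Qed.

Lemma part_eq (la mu : part) : (forall i, nth 0 la i = nth 0 mu i)%N -> la = mu.
Proof.
move=> E; apply/val_inj => /=; have sE : size la = size mu.
  apply/eqP; rewrite eqn_leq; apply/andP; split; rewrite leqNgt -nth_part_gt0.
    by rewrite E nth_default.
  by rewrite -E nth_default.
by apply: (eq_from_nth (x0 := 0%N)) => // i _; exact: E.
Qed.

Lemma part_of_fun n (g : nat -> nat) :
    (forall i, g i.+1 <= g i)%N -> (forall i, (n <= i)%N -> g i = 0%N) ->
  exists la : part, (size la <= n)%N /\ forall i, nth 0%N la i = g i.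
Proof.
elim: n g => [|n IH] g g_dec g0.
  by exists empty_part; split=> // i; rewrite nth_nil g0.
have [la [la_n laE]] := IH (g \o S) (fun i => g_dec i.+1) (fun i le_ni => g0 i.+1 le_ni).
have [g00|g0_gt0] := posnP (g 0%N).
  exists empty_part; split=> // i; rewrite nth_nil.
  by elim: i => // i gi; apply/eqP; have := g_dec i; rewrite -gi leqn0 eq_sym.
have la'P : is_part (g 0%N :: la).
  case: la la_n laE => s /= /andP[s_sorted s0] _ laE; apply/andP; split=> /=.
    case: s s_sorted laE {s0} => //= a s -> laE; rewrite andbT.
    by have := laE 0%N => /= ->.
  by rewrite inE negb_or s0 andbT; lia.
by exists (Part la'P); split=> // -[|i] //=.
Qed.

Definition psize (la : part) : nat := sumn la.

Lemma psizeE (la : part) n : (size la <= n)%N -> psize la = (\sum_(i < n) nth 0 la i)%N.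
Proof.
move=> le_n; rewrite /psize sumnE (big_nth 0%N) big_mkord.
rewrite (big_ord_widen _ (fun i => nth 0%N la i) le_n) big_mkcond.
by apply: eq_bigr => i _; case: ltnP => // /(nth_default _) ->.
Qed.

Lemma size_le_psize (la : part) : (size la <= psize la)%N.
Proof.
rewrite (psizeE (leqnn _)) -[leqLHS]card_ord -sum1_card; apply: leq_sum => i _.
by rewrite nth_part_gt0 ltn_ord.
Qed.

Lemma nth_le_psize (la : part) i : (nth 0 la i <= psize la)%N.
Proof.
have [lt_i|le_i] := ltnP i (size la); last by rewrite nth_default.
by rewrite (psizeE (leqnn _)) (bigD1 (Ordinal lt_i)) //= leq_addr.
Qed.

Lemma psize_eq0 (la : part) : (psize la == 0)%N = (la == empty_part).
Proof.
apply/eqP/eqP => [la0|->] //; apply: part_eq => i; rewrite nth_nil.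
by apply/eqP; rewrite -leqn0; have := nth_le_psize la i; rewrite la0.
Qed.

Lemma wt_part n (la : part) : (size la <= n)%N ->
  wt n (nth 0%N la) = (psize la + wt n (fun=> 0%N))%N.
Proof. by move=> le_n; rewrite /wt big_split /= (psizeE le_n). Qed.


(** Conjugation: the box in row i and column j can be detected along its row or along its column. *)
Lemma count_ltn_sorted (la : part) j i : (j < nth 0 la i)%N = (i < count (ltn j) la)%N.
Proof.
case: la => s /= /andP[s_sorted _]; elim: s s_sorted i => [|a s IH] /= s_sorted i.
  by rewrite nth_nil ltn0.
have s_sorted' := path_sorted s_sorted.
have [lt_ja|le_aj] := ltnP j a; first by case: i => [|i] //=; rewrite add1n ltnS IH.
have geq_trans : transitive geq by move=> x y z /=; lia.
have /allP s_le := order_path_min geq_trans s_sorted.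
rewrite add0n (_ : count _ s = 0%N).
  case: i => [|i] /=; first by apply/negbTE; rewrite -leqNgt.
  by rewrite IH // (_ : count _ s = 0%N) //; apply/eqP; rewrite -leqn0 leqNgt -has_count; apply/hasPn => x /s_le; rewrite /= -leqNgt; lia.
by apply/eqP; rewrite -leqn0 leqNgt -has_count; apply/hasPn => x /s_le; rewrite /= -leqNgt; lia.
Qed.

Lemma even_columnsP (la : part) :
  reflect (forall i, ~~ odd i -> nth 0%N la i = nth 0%N la i.+1) (even_columns la).
Proof.
apply: (iffP allP) => [h i ev_i|h x /mapP[j _ ->]].
  apply/eqP; rewrite eqn_leq nth_part_noninc andbT leqNgt; apply/negP.
  set j := nth 0%N la i.+1 => lt_j.
  have : count (ltn j) la \in columns la.
    apply/mapP; exists j => //; rewrite mem_iota /= add0n.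
    by apply: leq_trans lt_j _; rewrite -nth0; exact: nth_part_le.
  move/h; have -> : count (ltn j) la = i.+1; last by rewrite /= ev_i.
  apply/eqP; rewrite eqn_leq -count_ltn_sorted lt_j andbT leqNgt.
  by rewrite -count_ltn_sorted ltnn.
set m := count _ _; apply/negP => odd_m; have m_gt0 : (0 < m)%N by case: (m) odd_m.
have ev_m : ~~ odd m.-1 by move: odd_m; rewrite -{1}(prednK m_gt0).
have := h _ ev_m; rewrite prednK // => E.
by have := count_ltn_sorted la j m; rewrite -E count_ltn_sorted -/m prednK // leqnn ltnn.
Qed.

Lemma even_rowsP (la : part) :
  reflect (forall i, ~~ odd (nth 0%N la i)) (even_rows la).
Proof.
apply: (iffP allP) => [h i|h x /(nthP 0%N)[i _ <-]]; last exact: h.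
have [lt_i|le_i] := ltnP i (size la); last by rewrite nth_default.
by apply: h; exact: mem_nth.
Qed.

(** The default is not reached for nonincreasing f, by [toPE]. *)
Definition toP n M (f : {ffun 'I_n -> 'I_M}) : part :=
  xget empty_part [set la : part | forall i, nth 0%N la i = ext f i]%classic.

Lemma toPE n M (f : {ffun 'I_n -> 'I_M}) i : noninc f -> nth 0%N (toP f) i = ext f i.
Proof.
move=> /nonincP f_dec; rewrite /toP; case: xgetP => [la _ /(_ i) //|no].
have [la [_ laE]] := part_of_fun f_dec (ext_out f).
by case: (no la).
Qed.

(** For M > 0, the partitions that fit in n rows and M - 1 columns. *)
Definition pl n M : seq part :=
  [seq toP f | f <- enum [pred f : {ffun 'I_n -> 'I_M} | noninc f]].

Lemma big_pl (V : nmodType) n M (P : pred part) (F : part -> V) :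
  \sum_(la <- pl n M | P la) F la
    = \sum_(f : {ffun 'I_n -> 'I_M} | noninc f && P (toP f)) F (toP f).
Proof. by rewrite big_map big_enum_cond. Qed.

Lemma pl_uniq n M : uniq (pl n M).
Proof.
rewrite map_inj_in_uniq ?enum_uniq // => f g.
rewrite !mem_enum !inE => f_dec g_dec E; apply: eq_ext => i _.
by rewrite -!toPE // E.
Qed.

Lemma mem_pl n M (la : part) : (la \in pl n M.+1) = (size la <= n)%N && (nth 0 la 0 <= M)%N.
Proof.
apply/mapP/andP => [[f]|[le_n le_M]].
  rewrite mem_enum inE => f_dec ->; split.
    by rewrite leqNgt -nth_part_gt0 toPE // ext_out.
  rewrite toPE //; case: n f {f_dec} => [|n] f; first by rewrite ext_out.
  by rewrite -ltnS ext_ltn.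
have lt_M (i : 'I_n) : (nth 0 la i < M.+1)%N.
  by rewrite ltnS (leq_trans _ le_M) // nth_part_le.
have fE i : ext (mkpart lt_M) i = nth 0%N la i.
  have [lt_i|le_i] := ltnP i n; first by rewrite ext_mkpart.
  by rewrite ext_out // nth_default // (leq_trans le_n).
have f_dec : noninc (mkpart lt_M) by apply/nonincP => i; rewrite !fE nth_part_noninc.
exists (mkpart lt_M); first by rewrite mem_enum.
by apply: part_eq => i; rewrite toPE // fE.
Qed.

Lemma sum_cols_pl (R : comNzRingType) n M (y : 'I_n -> R) :
  sum_cols M y = \sum_(la <- pl n M | even_columns la) alt y (nth 0%N la).
Proof.
rewrite big_pl; apply: eq_big => [f|f /evcolsP[f_dec _]].
  rewrite /evcols; apply: andb_id2l => f_dec; apply/forallP/even_columnsP => [h i|h i].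
    move=> ev_i; rewrite !toPE //; have [lt_i|le_i] := ltnP i n.
      by have /implyP/(_ ev_i)/eqP := h (Ordinal lt_i).
    by rewrite !ext_out // (leq_trans le_i).
  by apply/implyP => /h; rewrite !toPE // => ->.
by apply: eq_alt => i _; rewrite toPE //; apply/nonincP.
Qed.

Lemma sum_rows_pl (R : comNzRingType) n M (y : 'I_n -> R) :
  sum_rows M y = \sum_(la <- pl n M | even_rows la) alt y (nth 0%N la).
Proof.
rewrite big_pl; apply: eq_big => [f|f /andP[f_dec _]].
  rewrite /evrows; apply: andb_id2l => f_dec; apply/forallP/even_rowsP => [h i|h i].
    rewrite toPE //; have [lt_i|le_i] := ltnP i n; first exact: (h (Ordinal lt_i)).
    by rewrite !ext_out.
  by have := h i; rewrite toPE.
by apply: eq_alt => i _; rewrite toPE.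
Qed.

(** * Schur functions *)

Definition inN N (f : symfun) : {mpoly int[N]} := in_vars f N.

Fact inN_is_zmod_morphism N : zmod_morphism (@inN N).
Proof. by move=> f g; exact: (congr1 (@^~ N) (raddfB (\val : symfun -> poly_family) f g)). Qed.
Fact inN_is_monoid_morphism N : monoid_morphism (@inN N).
Proof.
split; first exact: (congr1 (@^~ N) (rmorph1 (\val : symfun -> poly_family))).
by move=> f g; exact: (congr1 (@^~ N) (rmorphM (\val : symfun -> poly_family) f g)).
Qed.
HB.instance Definition _ N := GRing.isZmodMorphism.Build symfun {mpoly int[N]} (@inN N)
  (@inN_is_zmod_morphism N).
HB.instance Definition _ N := GRing.isMonoidMorphism.Build symfun {mpoly int[N]} (@inN N)
  (@inN_is_monoid_morphism N).

Lemma alternantE N la : alternant N la = alt (fun j => 'X_j) (nth 0%N la).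
Proof. by []. Qed.

Lemma alternant0E N : alternant N empty_part = alt (fun j => 'X_j) (fun=> 0%N).
Proof. by rewrite alternantE; apply: eq_alt => i _; rewrite nth_nil. Qed.

Lemma mcoeff_alt_part (A : comNzRingType) n (la mu : part) :
    (size la <= n)%N -> (size mu <= n)%N ->
  (alt (fun j => 'X_j : {mpoly A[n]}) (nth 0%N la))
    @_[multinom (nth 0%N mu i + (n - i.+1))%N | i < n] = (la == mu)%:R.
Proof.
move=> la_n mu_n; rewrite mcoeff_alt; try exact: nth_part_noninc.
congr (nat_of_bool _)%:R; apply/forallP/eqP => [h|-> //].
apply: part_eq => i; have [lt_i|le_i] := ltnP i n; first exact/eqP/(h (Ordinal lt_i)).
by rewrite !nth_default // (leq_trans _ le_i).
Qed.

Lemma alt0_neq0 N : alt (fun j => 'X_j : {mpoly int[N]}) (fun=> 0%N) != 0.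
Proof.
apply/eqP => E; have := @mcoeff_alt_part int N empty_part empty_part isT isT.
rewrite -alternantE alternant0E E mcoeff0 eqxx => /eqP.
by rewrite eq_sym oner_eq0.
Qed.

Section Schur.
Variables (s_gl : part -> symfun) (c : part -> part -> part -> int).
Hypotheses (hs : schur_functions s_gl) (hc : littlewood_richardson s_gl c).

Lemma spec_schur (B : comNzRingType) N (p : 'I_N -> B) (la : part) : (size la <= N)%N ->
  spec p (inN N (s_gl la)) * alt p (fun=> 0%N) = alt p (nth 0%N la).
Proof.
move=> la_N; have altE l : spec p (alt (fun j => 'X_j) l) = alt p l.
  rewrite (rmorph_alt (spec p)); congr (\det _); apply/matrixP => i j.
  by rewrite !mxE /= specX.
by rewrite -!altE -rmorphM -alternant0E; congr (spec p _); exact: hs.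
Qed.

Lemma graded_schur N (la : part) : (size la <= N)%N -> graded (psize la) (inN N (s_gl la)).
Proof.
move=> la_N; apply: (graded_cancel (alt0_neq0 N) (graded_alt N _)).
by rewrite -wt_part // -alternant0E (hs la_N); exact: graded_alt.
Qed.

(** After multiplication by the Vandermonde alternant, the monomial with exponents mu + delta occurs
    only in the term of mu. *)
Lemma schur_free N (L : seq part) (z : part -> int) : uniq L ->
    (forall la : part, la \in L -> (size la <= N)%N) ->
    \sum_(la <- L) inN N (s_gl la) *~ z la = 0 ->
  forall la, la \in L -> z la = 0.
Proof.
move=> L_uniq L_N E mu mu_L; pose m := [multinom (nth 0%N mu i + (N - i.+1))%N | i < N].
have := congr1 (fun q => (q * alternant N empty_part)@_m) E.
rewrite mul0r mcoeff0 mulr_suml raddf_sum /= (bigD1_seq mu) //= big_seq_cond big1 => [|la].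
  by rewrite addr0 mulrzAl (hs (L_N _ mu_L)) raddfMz /= mcoeff_alt_part ?L_N // eqxx intz.
case/andP => la_L /negPf la_mu; rewrite mulrzAl (hs (L_N _ la_L)) raddfMz /=.
by rewrite mcoeff_alt_part ?L_N // la_mu mul0rz.
Qed.

(** One list [L] serves all numbers of variables, and it may be made to contain any prescribed
    [X]. *)
Lemma LR_expansion la ga (X : seq part) : exists L : seq part, [/\ uniq L,
    {subset X <= L}, forall nu, c la ga nu != 0 -> nu \in L
  & forall N, inN N (s_gl la) * inN N (s_gl ga)
      = \sum_(nu <- L) inN N (s_gl nu) *~ c la ga nu].
Proof.
have [fin E] := hc la ga.
pose A := (fset_set [set nu | c la ga nu != 0]%classic `|` [fset nu in X])%fset.
have A_c nu : c la ga nu != 0 -> nu \in A.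
  by move=> c0; rewrite in_fsetU in_fset_set //; apply/orP; left; exact/mem_set.
exists (A : seq part); split=> [|nu nuX|//|N]; first exact: fset_uniq.
  by rewrite in_fsetU in_fset_set // in_fset /= nuX orbT.
have -> : inN N (s_gl la) * inN N (s_gl ga) = inN N (s_gl la * s_gl ga) by rewrite rmorphM.
rewrite E (fsbigTE A) => [|nu nuA]; last first.
  by have [->//|/A_c] := eqVneq (c la ga nu) 0; rewrite (negPf nuA).
by rewrite rmorph_sum; apply: eq_bigr => nu _; rewrite raddfMz.
Qed.

(** Restricting z to the partitions of the size of la amounts to taking a homogeneous component,
    which is 0 in any degree other than d. *)
Lemma schur_free_graded N (L : seq part) (z : part -> int) d (q : {mpoly int[N]}) :
    uniq L -> (forall la : part, la \in L -> (size la <= N)%N) ->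
    graded d q -> q = \sum_(la <- L) inN N (s_gl la) *~ z la ->
  forall la, la \in L -> z la != 0 -> psize la = d.
Proof.
move=> L_uniq L_N q_d E la la_L; apply: contraNeq => la_d.
pose z' mu := if psize mu == psize la then z mu else 0.
suff /(schur_free L_uniq L_N)/(_ la la_L) : \sum_(mu <- L) inN N (s_gl mu) *~ z' mu = 0.
  by rewrite /z' eqxx => ->.
have /(congr1 (fun P : {poly {mpoly int[N]}} => P`_(psize la))) := q_d.
rewrite coefMXn coefC {1}E rmorph_sum coef_sum /= => H.
transitivity (\sum_(mu <- L) (spec (fun i => ('X_i)%:P * 'X) (inN N (s_gl mu) *~ z mu) : {poly {mpoly int[N]}})`_(psize la)).
  rewrite big_seq [RHS]big_seq; apply: eq_bigr => mu mu_L.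
  rewrite raddfMz /= (graded_schur (L_N _ mu_L)) /z' coefMrz coefMXn coefC.
  case: ltngtP => [lt_la|lt_mu|->]; last by rewrite subnn.
    by rewrite mul0rz mulr0z.
  by rewrite mulr0z subn_eq0 leqNgt lt_mu mul0rz.
by rewrite H; case: ltnP => // le_d; rewrite subn_eq0 leqNgt ltn_neqAle eq_sym la_d le_d.
Qed.

(** The coefficients are only characterized by the expansion of products. Their homogeneity is
    deduced from that of Schur polynomials, in enough variables for those involved to be
    independent. *)
Lemma LR_degree la ga nu : c la ga nu != 0 -> psize nu = (psize la + psize ga)%N.
Proof.
have [L [L_uniq _ L_c LE]] := LR_expansion la ga [::].
pose N := (size la + size ga + \max_(mu <- L) size mu)%N.
have L_N (mu : part) : mu \in L -> (size mu <= N)%N.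
  by move=> mu_L; apply: leq_trans (leq_addl _ _); exact: (@leq_bigmax_seq _ _ predT (fun mu : part => size mu)).
have la_N : (size la <= N)%N by rewrite /N; lia.
have ga_N : (size ga <= N)%N by rewrite /N; lia.
move=> c0; apply: (schur_free_graded L_uniq L_N _ (LE N)) (L_c _ c0) c0.
by apply: gradedM; exact: graded_schur.
Qed.

Lemma schur_nil N : inN N (s_gl empty_part) = 1.
Proof.
apply: (mulIf (alt0_neq0 N)); rewrite mul1r -alternant0E.
exact: (hs (la := empty_part)).
Qed.

Lemma LR_nil ga nu : c empty_part ga nu = (ga == nu)%:R /\ c ga empty_part nu = (ga == nu)%:R.
Proof.
suff H (f : part -> int) L : uniq L -> {subset [:: ga] <= L} ->
    (forall nu, f nu != 0 -> nu \in L) ->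
    (forall N, inN N (s_gl ga) = \sum_(nu <- L) inN N (s_gl nu) *~ f nu) ->
    f nu = (ga == nu)%:R.
  split.
    have [L [L_uniq L_ga L_c LE]] := LR_expansion empty_part ga [:: ga].
    by apply: (H _ L) => // N; rewrite -LE schur_nil mul1r.
  have [L [L_uniq L_ga L_c LE]] := LR_expansion ga empty_part [:: ga].
  by apply: (H _ L) => // N; rewrite -LE schur_nil mulr1.
move=> L_uniq ga_L L_f LE; pose N := \max_(mu <- L) size mu.
have L_N (mu : part) : mu \in L -> (size mu <= N)%N.
  by move=> mu_L; exact: (@leq_bigmax_seq _ _ predT (fun mu : part => size mu)).
have [nu_L|nu_L] := boolP (nu \in L); last first.
  have [f0|/L_f] := eqVneq (f nu) 0; last by rewrite (negPf nu_L).
  by case: eqP nu_L => [<-|//]; rewrite ga_L // inE.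
suff /(schur_free L_uniq L_N)/(_ nu nu_L) /eqP :
    \sum_(mu <- L) inN N (s_gl mu) *~ (f mu - (ga == mu)%:R) = 0.
  by rewrite subr_eq0 => /eqP.
under eq_bigr do rewrite mulrzBr.
rewrite sumrB -LE (bigD1_seq ga) ?ga_L ?inE //= eqxx big1 ?addr0 ?subrr //.
by move=> mu /negPf; rewrite eq_sym => ->.
Qed.

End Schur.

Lemma big_eq_supp (V : nmodType) (I : eqType) (r r' : seq I) (F : I -> V) :
    uniq r -> uniq r' ->
    (forall i, i \in r -> i \notin r' -> F i = 0) ->
    (forall i, i \in r' -> i \notin r -> F i = 0) ->
  \sum_(i <- r) F i = \sum_(i <- r') F i.
Proof.
move=> r_uniq r'_uniq rF r'F.
have restrict (s s' : seq I) : (forall i, i \in s -> i \notin s' -> F i = 0) ->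
    \sum_(i <- s) F i = \sum_(i <- [seq i <- s | i \in s']) F i.
  move=> sF; rewrite big_filter [RHS]big_mkcond !big_seq; apply: eq_bigr => i /sF F0.
  by case: ifPn.
rewrite (restrict r r') // (restrict r' r) //; apply: perm_big.
apply: uniq_perm; rewrite ?filter_uniq // => i.
by rewrite !mem_filter andbC.
Qed.

Definition parts_le n : seq part := [seq la <- pl n n.+1 | (psize la <= n)%N].

Lemma parts_le_uniq n : uniq (parts_le n).
Proof. by rewrite filter_uniq ?pl_uniq. Qed.

Lemma mem_parts_le n la : (la \in parts_le n) = (psize la <= n)%N.
Proof.
rewrite mem_filter mem_pl; apply: andb_idr => le_n.
by rewrite (leq_trans (size_le_psize _)) // (leq_trans (nth_le_psize _ _)).
Qed.

(** * The two families of even partitions *)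

(* [true] stands for even rows and the orthogonal case, [false] for even
   columns and the symplectic case. *)
Definition even_part (b : bool) : pred part := if b then even_rows else even_columns.
(** The factor 1 - q^2 turns the h_a into the differences h_a - h_(a-2) of the orthogonal
    Jacobi-Trudi determinant. *)
Definition twist (A : comNzRingType) (b : bool) : {poly A} := if b then 1 - 'X^2 else 1.

Definition pair_prod (R : comNzRingType) (b : bool) n (y : 'I_n -> R) : R :=
  \prod_(i < n) \prod_(j < n | (if b then i <= j else i < j)%N) (1 - y i * y j).

Lemma littlewood (R : comNzRingType) b n M (y : 'I_n -> R) : (forall j, y j ^+ M = 0) ->
  (\sum_(la <- pl n M | even_part b la) alt y (nth 0%N la)) * pair_prod b y
    = alt y (fun=> 0%N).
Proof.
move=> yM; rewrite /pair_prod; case: b => /=.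
  by rewrite -sum_rows_pl littlewood_rows.
by rewrite -sum_cols_pl littlewood_cols.
Qed.

(** Dividing column j by y_j^(n-1) leaves the Vandermonde matrix of the a_j / y_j. *)
Lemma homogeneous_vandermonde (F : comUnitRingType) n (a y : 'I_n -> F) :
    (forall j, y j \is a GRing.unit) ->
  \det (\matrix_(k < n, j < n) (a j ^+ k * y j ^+ (n - k.+1))) =
    (\prod_j y j ^+ n.-1) * \prod_(i < n) \prod_(j < n | (i < j)%N) (a j / y j - a i / y i).
Proof.
move=> y_unit; rewrite -[X in _ = _ * X](_ : \det (Vandermonde n (\row_j (a j / y j))) = _); last first.
  rewrite det_Vandermonde; apply: eq_bigr => i _; apply: eq_bigr => j _.
  by rewrite !mxE.
rewrite -det_scale_cols; congr (\det _); apply/matrixP => k j; rewrite !mxE.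
have -> : n.-1 = (k + (n - k.+1))%N by have := ltn_ord k; lia.
have := divrr (unitrX k (y_unit j)); rewrite exprMn exprVn exprD.
by set u := _^-1 => yu; rewrite -[LHS]mul1r -yu; ring.
Qed.

(** Compares the Vandermonde factors of y + 1/y and of 1/y; their quotient 1 - xy is a factor of
    [pair_prod]. *)
Lemma joukowski_diff (F : fieldType) (x y : F) : x != 0 -> y != 0 ->
  (1 + y ^+ 2) / y - (1 + x ^+ 2) / x = (1 / y - 1 / x) * (1 - x * y).
Proof. by move=> x0 y0; field; rewrite x0 y0. Qed.

Lemma det_symplectic_field (F : fieldType) n (y : 'I_n -> F) : (forall j, y j != 0) ->
  \det (\matrix_(k < n, j < n) ((1 + y j ^+ 2) ^+ k * y j ^+ (n - k.+1)))
    = alt y (fun=> 0%N) * pair_prod false y.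
Proof.
move=> y0; have y_unit j : y j \is a GRing.unit by rewrite unitfE.
have -> : alt y (fun=> 0%N) = \det (\matrix_(k < n, j < n) (1 ^+ k * y j ^+ (n - k.+1))).
  by congr (\det _); apply/matrixP => k j; rewrite !mxE expr1n mul1r.
rewrite (homogeneous_vandermonde (fun j => 1 + y j ^+ 2) y_unit).
rewrite (homogeneous_vandermonde (fun=> 1) y_unit) -mulrA; congr (_ * _).
rewrite /pair_prod -big_split /=; apply: eq_bigr => i _.
by rewrite -big_split /=; apply: eq_bigr => j _; exact: joukowski_diff.
Qed.

Lemma det_twist (R : comNzRingType) b n (y : 'I_n -> R) :
  \det (\matrix_(k < n, j < n)
     (twist R b * (1 + 'X^2) ^+ k * 'X^(n - k.+1)).[y j])
   = alt y (fun=> 0%N) * pair_prod b y.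
Proof.
have -> : \det (\matrix_(k < n, j < n) (twist R b * (1 + 'X^2) ^+ k * 'X^(n - k.+1)).[y j])
    = (\prod_j (twist R b).[y j]) * \det (\matrix_(k < n, j < n) ((1 + y j ^+ 2) ^+ k * y j ^+ (n - k.+1))).
  rewrite -det_scale_cols; congr (\det _); apply/matrixP => k j; rewrite !mxE.
  by rewrite !hornerM horner_exp hornerD hornerC !hornerXn mulrA.
have -> : \det (\matrix_(k < n, j < n) ((1 + y j ^+ 2) ^+ k * y j ^+ (n - k.+1)))
    = alt y (fun=> 0%N) * pair_prod false y.
  (* The identity has integer coefficients, so it may be checked on independent variables, which are
     invertible in the field of fractions. *)
  pose Y j : {mpoly int[n]} := 'X_j.
  suff E : \det (\matrix_(k < n, j < n) ((1 + Y j ^+ 2) ^+ k * Y j ^+ (n - k.+1)))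
      = alt Y (fun=> 0%N) * pair_prod false Y.
    have := congr1 (spec y) E; rewrite rmorphM /= rmorph_alt -det_map_mx /pair_prod rmorph_prod /=.
    move=> E'; transitivity (\det (map_mx (spec y) (\matrix_(k < n, j < n) ((1 + Y j ^+ 2) ^+ k * Y j ^+ (n - k.+1))))).
      congr (\det _); apply/matrixP => k j; rewrite !mxE rmorphM !rmorphXn rmorphD rmorph1 rmorphXn /=.
      by rewrite !specX.
    rewrite E'; congr (_ * _).
      by congr (\det _); apply/matrixP => k j; rewrite !mxE /= specX.
    apply: eq_bigr => i _; rewrite rmorph_prod; apply: eq_bigr => j _.
    by rewrite rmorphB rmorph1 rmorphM /= !specX.
  pose f : {rmorphism {mpoly int[n]} -> {fraction {mpoly int[n]}}} := @tofrac _.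
  have f_inj : injective f by move=> u v /eqP; rewrite tofrac_eq => /eqP.
  have fY0 j : f (Y j) != 0.
    rewrite tofrac_eq0; apply/eqP => /(congr1 (mcoeff U_(j)%MM)).
    by rewrite mcoeffX eqxx mcoeff0 => /eqP; rewrite oner_eq0.
  apply: f_inj; rewrite rmorphM /= rmorph_alt -det_map_mx /pair_prod rmorph_prod.
  transitivity (\det (\matrix_(k < n, j < n) ((1 + f (Y j) ^+ 2) ^+ k * f (Y j) ^+ (n - k.+1)))).
    congr (\det _); apply/matrixP => k j.
    by rewrite !mxE rmorphM !rmorphXn rmorphD rmorph1 rmorphXn.
  rewrite (det_symplectic_field fY0); congr (_ * _); apply: eq_bigr => i _.
  by rewrite rmorph_prod; apply: eq_bigr => j _; rewrite rmorphB rmorph1 rmorphM.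
(* For even rows the values 1 - y_j^2 of [twist] supply the factors with i = j. *)
rewrite mulrCA; congr (_ * _); rewrite /pair_prod -big_split /=.
case: b => /=; last first.
  by apply: eq_bigr => i _; rewrite hornerC mul1r.
apply: eq_bigr => i _; rewrite [RHS](bigD1 i) //=; congr (_ * _).
  by rewrite hornerD hornerN hornerC hornerXn expr2.
by apply: eq_bigl => j; rewrite ltn_neqAle andbC eq_sym.
Qed.

(** * Branching to the orthogonal and symplectic groups *)

(** A Cauchy identity. Cauchy-Binet produces the column series evaluated at the y_j, and each
    evaluation splits off the factor H(y_j). *)
Lemma sum_alt_jt (B R : comNzRingType) (phi : {rmorphism B -> R}) n M (y : 'I_n -> R)
    (H : ser B) (D A : {poly B}) : (forall j, y j ^+ M = 0) ->
  \sum_(la <- pl n M) alt y (nth 0%N la) * phi (jt n H D A (nth 0%N la))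
    = (\prod_j ev phi M (y j) H) * \det (\matrix_(k < n, j < n)
        (map_poly phi D * map_poly phi A ^+ k * 'X^(n - k.+1)).[y j]).
Proof.
move=> yM; pose g (k : 'I_n) (m : nat) := phi ((H * pser (D * A ^+ k * 'X^(n - k.+1))) m).
rewrite big_pl; have := cauchy_binet g yM.
rewrite (_ : \det (\matrix_(k, j) \sum_(m < M) g k m * y j ^+ m) = \det (\matrix_(k, j)
    (ev phi M (y j) H * (\matrix_(k < n, j < n) (map_poly phi D * map_poly phi A ^+ k * 'X^(n - k.+1)).[y j]) k j))); last first.
  congr (\det _); apply/matrixP => k j; rewrite !mxE -[LHS]/(ev phi M (y j) _).
  rewrite evM // ev_pser //; congr (_ * _); rewrite !rmorphM rmorphXn /= map_polyXn //.
rewrite det_scale_cols => <-; apply: eq_big => [f|f /andP[f_dec _]]; first by rewrite andbT.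
rewrite mulrC; congr (_ * _); last by apply: eq_alt => i _; rewrite toPE.
rewrite /jt -det_map_mx; congr (\det _); apply/matrixP => i k.
by rewrite !mxE toPE.
Qed.

Lemma coef_alt_comb (B : comNzRingType) n (L : seq part) (d : part -> B) (w : nat) (nu : part) :
    uniq L -> nu \in L -> (forall mu : part, mu \in L -> (size mu <= n)%N) ->
  ((\sum_(mu <- L) 'X^(psize mu + w) *
      (alt (fun j => 'X_j : {mpoly B[n]}) (nth 0%N mu) * (d mu)%:MP)%:P)`_(psize nu + w))
    @_[multinom (nth 0%N nu i + (n - i.+1))%N | i < n] = d nu.
Proof.
move=> L_uniq nu_L L_n; rewrite coef_sum raddf_sum /= (bigD1_seq nu) //=.
rewrite big_seq_cond big1 ?addr0 => [|mu /andP[mu_L neq_mu]]; last first.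
  rewrite coefXnM coefC; case: ltnP => [_|le_mu]; first by rewrite mcoeff0.
  case: eqP => [_|_]; last by rewrite mcoeff0.
  by rewrite mulrC mcoeffCM mcoeff_alt_part ?L_n // (negPf neq_mu) mulr0.
by rewrite coefXnM ltnn subnn coefC eqxx mulrC mcoeffCM mcoeff_alt_part ?L_n // eqxx mulr1.
Qed.

Lemma map_twist (A B : comNzRingType) (phi : {rmorphism A -> B}) b :
  map_poly phi (twist A b) = twist B b.
Proof. by case: b; rewrite /= ?rmorph1 // rmorphB rmorph1 /= map_polyXn. Qed.

Section Branching.
Variables (s_gl : part -> symfun) (c : part -> part -> part -> int).
Hypotheses (hs : schur_functions s_gl) (hc : littlewood_richardson s_gl c).

(** Two Cauchy sums are compared. The plain one is the product of the H(y_j) times the Vandermonde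
    alternant; the twisted one has the extra factor [pair_prod], which Littlewood's identity cancels
    against the sum of the even Schur functions. Expanding the product with that sum and comparing
    alternants gives the rule. *)
Theorem branching_rule b n (B : comNzRingType) (H : ser B) (nu : part) : (psize nu <= n)%N ->
  jt n H 1 1 (nth 0%N nu) = \sum_(la <- parts_le n) \sum_(ga <- parts_le n | even_part b ga)
     jt n H (twist B b) (1 + 'X^2) (nth 0%N la) *~ c la ga nu.
Proof.
move=> nu_n; pose w0 := wt n (fun=> 0%N).
(* The Vandermonde alternant has degree w0, so the degrees up to n + w0 are those of the alternants
   of partitions of size at most n. *)
have [R [ka [kaX ka0]]] := truncated_poly_ring {mpoly B[n]} (n + w0).
set M := (n + w0).+1 in kaX.
pose y (j : 'I_n) : R := ka ('X * ('X_j)%:P).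
have yM j : y j ^+ M = 0 by rewrite /y rmorphM exprMn kaX mul0r.
pose phi : {rmorphism B -> R} := ka \o (@polyC {mpoly B[n]}) \o (@mpolyC n B).
have [v vE] : {v : part -> B | forall la : part, jt n H (twist B b) (1 + 'X^2) (nth 0%N la) = v la}.
  by exists (fun la : part => jt n H (twist B b) (1 + 'X^2) (nth 0%N la)).
have [h hE] : {h : part -> B | forall la : part, jt n H 1 1 (nth 0%N la) = h la}.
  by exists (fun la : part => jt n H 1 1 (nth 0%N la)).
under [RHS]eq_bigr do under eq_bigr do rewrite vE.
rewrite hE.
pose sy (la : part) := spec y (inN n (s_gl la)).
have altE (la : part) : (size la <= n)%N -> alt y (nth 0%N la)
    = ka ('X^(psize la + w0) * (alt (fun j => 'X_j) (nth 0%N la))%:P).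
  move=> la_n; rewrite -(wt_part la_n) (rmorph_alt (@polyC {mpoly B[n]})) -alt_scale.
  by rewrite rmorph_alt.
have alt_big (la : part) : (size la <= n)%N -> (n < psize la)%N -> alt y (nth 0%N la) = 0.
  move=> la_n lt_n; rewrite altE // rmorphM rmorphXn /=.
  rewrite (_ : psize la + w0 = M + (psize la - n.+1))%N; last by rewrite /M; lia.
  by rewrite exprD kaX !mul0r.
pose E := \sum_(ga <- pl n M | even_part b ga) sy ga.
have EdetP : E * \det (\matrix_(k < n, j < n)
    (map_poly phi (twist B b) * map_poly phi (1 + 'X^2) ^+ k * 'X^(n - k.+1)).[y j])
    = alt y (fun=> 0%N).
  rewrite map_twist rmorphD rmorph1 /= map_polyXn det_twist mulrA -[RHS](littlewood b yM).
  congr (_ * _); rewrite mulr_suml big_seq_cond [RHS]big_seq_cond.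
  apply: eq_bigr => ga /andP[+ _]; rewrite mem_pl => /andP[ga_n _].
  exact: (spec_schur hs y ga_n).
(* If the sizes add up to more than n, the left side vanishes by nilpotency and the right side
   because Littlewood-Richardson coefficients respect degrees. *)
have mulE (la ga : part) : la \in pl n M -> ga \in pl n M ->
    alt y (nth 0%N la) * sy ga = \sum_(mu <- parts_le n) alt y (nth 0%N mu) *~ c la ga mu.
  rewrite !mem_pl => /andP[la_n _] /andP[ga_n _].
  have -> : alt y (nth 0%N la) * sy ga = sy la * sy ga * alt y (fun=> 0%N).
    by rewrite -(spec_schur hs y la_n) /sy; ring.
  have [le_n|lt_n] := leqP (psize la + psize ga) n; last first.
    rewrite big_seq big1 => [|mu]; last first.
      rewrite mem_parts_le => mu_n; have [->//|/(LR_degree hs hc)] := eqVneq (c la ga mu) 0.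
      by move: mu_n lt_n => + + E1; rewrite E1; lia.
    rewrite -mulrA [sy ga * _]mulrC mulrA (spec_schur hs y la_n) altE //.
    have -> : sy ga = ka 'X ^+ psize ga * spec (fun j => ka ('X_j)%:P) (inN n (s_gl ga)).
      rewrite -(spec_graded _ _ (graded_schur hs ga_n)) /sy; apply: eq_spec => j.
      by rewrite /y rmorphM.
    rewrite rmorphM rmorphXn /= mulrAC mulrA -exprD.
    rewrite (_ : _ + _ = M + (psize la + psize ga - n.+1))%N; last by rewrite /M; lia.
    by rewrite exprD kaX !mul0r.
  have [L [L_uniq L_P L_c LE]] := LR_expansion hc la ga (parts_le n).
  rewrite /sy -rmorphM /= LE rmorph_sum mulr_suml /=.
  rewrite (big_eq_supp (r' := parts_le n)) ?parts_le_uniq //; first last.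
  - by move=> mu /L_P ->.
  - move=> mu _; rewrite mem_parts_le; have [-> _|/(LR_degree hs hc) ->] := eqVneq (c la ga mu) 0.
      by rewrite mulr0z rmorph0 mul0r.
    by rewrite le_n.
  rewrite big_seq [RHS]big_seq; apply: eq_bigr => mu; rewrite mem_parts_le => mu_n.
  rewrite raddfMz mulrzAl /=; congr (_ *~ _).
  by apply: (spec_schur hs y); apply: leq_trans (size_le_psize _) _.
have parts_pl (la : part) : la \in parts_le n -> la \in pl n M.
  rewrite mem_parts_le mem_pl => la_n; rewrite (leq_trans (size_le_psize _) la_n).
  by rewrite (leq_trans (nth_le_psize _ _)) // (leq_trans la_n) ?leq_addr.
have sum_parts (F : part -> R) :
    (forall la, la \in pl n M -> (n < psize la)%N -> F la = 0) ->
    \sum_(la <- pl n M) F la = \sum_(la <- parts_le n) F la.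
  move=> F0; apply: big_eq_supp; rewrite ?pl_uniq ?parts_le_uniq //.
    by move=> la la_pl; rewrite mem_parts_le -ltnNge; exact: F0.
  by move=> la /parts_pl ->.
have c_big la ga mu : mu \in parts_le n -> (n < psize la)%N || (n < psize ga)%N -> c la ga mu = 0.
  rewrite mem_parts_le => mu_n lt_n; have [//|/(LR_degree hs hc) E1] := eqVneq (c la ga mu) 0.
  by move: mu_n lt_n; rewrite E1; lia.
have key : \sum_(mu <- parts_le n) alt y (nth 0%N mu) * phi (h mu)
   = \sum_(mu <- parts_le n) alt y (nth 0%N mu) * phi (\sum_(la <- parts_le n)
      \sum_(ga <- parts_le n | even_part b ga) v la *~ c la ga mu).
  transitivity (\sum_(mu <- pl n M) alt y (nth 0%N mu) * phi (h mu)).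
    symmetry; apply: sum_parts => mu; rewrite mem_pl => /andP[mu_le _] mu_n.
    by rewrite alt_big ?mul0r.
  under eq_bigr do rewrite -hE.
  rewrite (sum_alt_jt phi H 1 1 yM).
  have -> : \det (\matrix_(k < n, j < n) (map_poly phi 1 * map_poly phi 1 ^+ k * 'X^(n - k.+1)).[y j])
      = alt y (fun=> 0%N).
    congr (\det _); apply/matrixP => k j; rewrite !mxE rmorph1 expr1n !mul1r.
    by rewrite hornerXn.
  rewrite -EdetP mulrCA -(sum_alt_jt phi H _ _ yM) mulr_sumr.
  under eq_bigr do rewrite vE.
  transitivity (\sum_(la <- pl n M) \sum_(ga <- pl n M) \sum_(mu <- parts_le n)
      (if even_part b ga then alt y (nth 0%N mu) * phi (v la *~ c la ga mu) else 0)).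
    rewrite big_seq [RHS]big_seq; apply: eq_bigr => la la_pl.
    rewrite mulr_suml big_mkcond big_seq [RHS]big_seq; apply: eq_bigr => ga ga_pl.
    case: ifP => _; last by rewrite big1.
    rewrite mulrA [sy ga * _]mulrC (mulE _ _ la_pl ga_pl) mulr_suml.
    by apply: eq_bigr => mu _; rewrite raddfMz /= mulrzAl mulrzAr.
  rewrite (sum_parts (fun la => \sum_(ga <- pl n M) \sum_(mu <- parts_le n)
      (if even_part b ga then alt y (nth 0%N mu) * phi (v la *~ c la ga mu) else 0)))
    => [|la _ la_n]; last first.
    rewrite big1 // => ga _; rewrite big_seq big1 // => mu mu_n.
    by rewrite (c_big _ _ _ mu_n) ?la_n // mulr0z rmorph0 mulr0 if_same.
  transitivity (\sum_(la <- parts_le n) \sum_(ga <- parts_le n) \sum_(mu <- parts_le n)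
      (if even_part b ga then alt y (nth 0%N mu) * phi (v la *~ c la ga mu) else 0)).
    apply: eq_bigr => la _; apply: sum_parts => ga _ ga_n.
    rewrite big_seq big1 // => mu mu_n.
    by rewrite (c_big _ _ _ mu_n) ?ga_n ?orbT // mulr0z rmorph0 mulr0 if_same.
  under eq_bigr do rewrite exchange_big.
  rewrite exchange_big; apply: eq_bigr => mu _.
  have -> : phi (\sum_(la <- parts_le n) \sum_(ga <- parts_le n | even_part b ga) v la *~ c la ga mu)
      = \sum_(la <- parts_le n) \sum_(ga <- parts_le n | even_part b ga) phi (v la *~ c la ga mu).
    by rewrite rmorph_sum; apply: eq_bigr => la _; rewrite rmorph_sum.
  rewrite mulr_sumr; apply: eq_bigr => la _.
  by rewrite mulr_sumr [RHS]big_mkcond.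
have [d dE] : {d : part -> B | forall mu, h mu -
    \sum_(la <- parts_le n) \sum_(ga <- parts_le n | even_part b ga) v la *~ c la ga mu = d mu}.
  by exists (fun mu => h mu -
    \sum_(la <- parts_le n) \sum_(ga <- parts_le n | even_part b ga) v la *~ c la ga mu).
(* The difference of the two sides, lifted to a polynomial: its coefficient in degree psize nu + w0,
   read at the monomial nu + delta, is [d nu]. *)
have key2 : ka (\sum_(mu <- parts_le n) 'X^(psize mu + w0) *
    (alt (fun j => 'X_j) (nth 0%N mu) * (d mu)%:MP)%:P) = 0.
  transitivity (\sum_(mu <- parts_le n) alt y (nth 0%N mu) * phi (d mu)).
    rewrite rmorph_sum big_seq [RHS]big_seq; apply: eq_bigr => mu; rewrite mem_parts_le => mu_n.
    rewrite (altE _ (leq_trans (size_le_psize mu) mu_n)) polyCM mulrA.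
    exact: (rmorphM ka).
  transitivity (\sum_(mu <- parts_le n) alt y (nth 0%N mu) * phi (h mu) -
     \sum_(mu <- parts_le n) alt y (nth 0%N mu) * phi (\sum_(la <- parts_le n)
      \sum_(ga <- parts_le n | even_part b ga) v la *~ c la ga mu)).
    rewrite -[RHS]sumrB; apply: eq_bigr => mu _; rewrite -[RHS]mulrBr; congr (_ * _).
    by rewrite -dE; exact: (rmorphB phi).
  by apply/eqP; rewrite subr_eq0; apply/eqP.
have nu_le : (psize nu + w0 <= n + w0)%N by rewrite leq_add2r.
apply/eqP; rewrite -subr_eq0 dE -(@coef_alt_comb B n (parts_le n) d w0 nu (parts_le_uniq n)).
- by apply/eqP; rewrite (ka0 _ key2 _ nu_le); exact: mcoeff0.
- by rewrite mem_parts_le.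
by move=> mu; rewrite mem_parts_le; apply: leq_trans (size_le_psize _).
Qed.

End Branching.

(** * Jacobi-Trudi formulas for Schur functions and universal characters *)

Lemma rmorph_jt (A B : comNzRingType) (f : {rmorphism A -> B}) n (H : ser A) (P Q : {poly A}) l :
  f (jt n H P Q l) = jt n (mapser f H) (map_poly f P) (map_poly f Q) l.
Proof.
rewrite -det_map_mx; congr (\det _); apply/matrixP => i k; rewrite !mxE.
rewrite -(map_polyXn f) -rmorphXn -!rmorphM -mapser_pser -rmorphM //.
Qed.

(* The generating series of the complete symmetric functions. *)
Definition hser (A : comNzRingType) N (p : 'I_N -> A) : ser A :=
  \prod_i (geometric (p i) : ser A).

Lemma hser0 (A : comNzRingType) N (p : 'I_N -> A) : hser p 0%N = 1.
Proof.
rewrite /hser; elim/big_ind: _ => // f g f0 g0.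
by rewrite serE big_ord1 f0 g0 mul1r.
Qed.

Lemma mapser_hser (A B : comNzRingType) (f : {rmorphism A -> B}) N (p : 'I_N -> A) :
  mapser f (hser p) = hser (f \o p).
Proof. by rewrite rmorph_prod; apply: eq_bigr => i _; rewrite /= mapser_geometric. Qed.

Lemma hser_cofactor (A : comNzRingType) N (p : 'I_N -> A) (j : 'I_N) :
  hser p * pser (\prod_(k < N | k != j) (1 - p k *: 'X)) = geometric (p j).
Proof.
rewrite /hser (bigD1 j) //= rmorph_prod -mulrA -big_split /=.
by rewrite big1 ?mulr1 // => k _; rewrite geometricK.
Qed.

Lemma fsum_seq (V : nmodType) (I : choiceType) (r : seq I) (G : set I) (P : pred I) (F : I -> V) :
    uniq r -> (forall i, G i <-> P i) -> (forall i, P i -> i \notin r -> F i = 0) ->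
  \sum_(i \in G) F i = \sum_(i <- r | P i) F i.
Proof.
move=> r_uniq GP F0; rewrite (bigfs _ r_uniq F0); apply: eq_fsbigl.
by apply/seteqP; split=> i /=; rewrite GP.
Qed.

Lemma bigmax_attained (I : eqType) (F : I -> nat) (r : seq I) i : i \in r ->
  exists2 j, j \in r & F j = \max_(k <- r) F k.
Proof.
elim: r i => // a [|b r] IH i _.
  by exists a; rewrite ?inE // big_seq1.
have [j j_r jE] := IH b (mem_head _ _); rewrite big_cons.
have [le_j|lt_j] := leqP (F a) (\max_(k <- b :: r) F k).
  by exists j; rewrite // inE j_r orbT.
by exists a; rewrite // mem_head.
Qed.

Section Characters.
Variables (s_gl : part -> symfun) (c : part -> part -> part -> int).
Hypotheses (hs : schur_functions s_gl) (hc : littlewood_richardson s_gl c).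

(** The alternant is a determinant of coefficients of geometric series, each being [hser] times the
    factors 1 - x_k q of the other variables. This gives a determinant of size n + r, cut to size n
    by [jtG_widen]. *)
Lemma schur_jt (B : comNzRingType) n r (p : 'I_(n + r) -> B) (la : part) : (size la <= n)%N ->
  spec p (inN (n + r) (s_gl la)) = jt n (hser p) 1 1 (nth 0%N la).
Proof.
move=> la_n; set N := (n + r)%N; pose X (j : 'I_N) : {mpoly int[N]} := 'X_j.
have -> : inN N (s_gl la) = jt n (hser X) 1 1 (nth 0%N la).
  apply: (mulIf (alt0_neq0 N)); rewrite -{1}alternant0E (hs (leq_trans la_n (leq_addr _ _))).
  rewrite alternantE -(jtG_widen r (hser0 X)) => [|i le_i]; last first.
    by rewrite nth_default // (leq_trans la_n).
  have coef10 : (1 : {poly {mpoly int[N]}})`_0 = 1 by rewrite coef1.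
  have b_eq j : (geometric (X j) : ser {mpoly int[N]}) = pser 1%:P * (hser X *
      pser (1 * \prod_(k < N | k != j) (1 - (X k)%:P * 'X))).
    rewrite rmorph1 mul1r mul1r -hser_cofactor; congr (_ * pser _).
    by apply: eq_bigr => k _; rewrite mul_polyC.
  rewrite mulrC; have := jacobi_trudi (hser0 X) coef10 coef10 (nth 0%N la) b_eq.
  move=> E; transitivity (\det (\matrix_(i < N, j < N) geometric (X j) (nth 0%N la i + (N - i.+1))%N)) => //.
rewrite (rmorph_jt (spec p)) !rmorph1 mapser_hser; congr (jt n (\prod_i _) 1 1 _).
by apply: funext => i; rewrite /= specX.
Qed.

Section Universal.
Variables (b : bool) (u : part -> symfun).
Hypothesis hu : universal_characters [set ga : part | even_part b ga]%classic s_gl c u.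

Lemma LR_eq0 la ga nu : (psize nu < psize la + psize ga)%N -> c la ga nu = 0.
Proof.
by move=> lt_nu; have [//|/(LR_degree hs hc) E] := eqVneq (c la ga nu) 0; move: lt_nu; rewrite E ltnn.
Qed.

Lemma universal_expansion n N nu : (psize nu <= n)%N ->
  inN N (s_gl nu) = \sum_(la <- parts_le n) \sum_(ga <- parts_le n | even_part b ga)
    inN N (u la) *~ c la ga nu.
Proof.
move=> nu_n; rewrite hu.
have c0 la ga : (n < psize la)%N || (n < psize ga)%N -> c la ga nu = 0.
  by move=> lt_n; apply: LR_eq0; lia.
rewrite (fsum_seq (P := predT) (parts_le_uniq n)) // => [|la _]; last first.
  rewrite mem_parts_le -ltnNge => la_n; apply: fsbig1 => ga _.
  by rewrite c0 ?la_n.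
rewrite rmorph_sum; apply: eq_bigr => la _.
rewrite (fsum_seq (P := even_part b) (parts_le_uniq n)) // => [|ga _]; last first.
  by rewrite mem_parts_le -ltnNge => ga_n; rewrite c0 ?ga_n ?orbT.
by rewrite rmorph_sum; apply: eq_bigr => ga _; rewrite raddfMz.
Qed.

(** The system is unitriangular for the size: a nonempty ga only leaves smaller la, and the empty ga
    contributes [x nu] alone. *)
Lemma LR_solve (V : zmodType) n (x : part -> V) :
    (forall nu, (psize nu <= n)%N -> \sum_(la <- parts_le n)
       \sum_(ga <- parts_le n | even_part b ga) x la *~ c la ga nu = 0) ->
  forall nu, (psize nu <= n)%N -> x nu = 0.
Proof.
move=> x_eq nu; have [m le_m] := ubnP (psize nu); elim: m nu le_m => // m IH nu lt_m nu_n.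
have := x_eq _ nu_n; rewrite (bigD1_seq nu) ?parts_le_uniq ?mem_parts_le //=.
rewrite [X in _ + X]big1_seq ?addr0 => [|la /andP[la_nu]]; last first.
  rewrite mem_parts_le => la_n; rewrite big1 // => ga _.
  have [lt_la|le_nu] := ltnP (psize la) (psize nu).
    by rewrite (IH la) ?mul0rz // (leq_trans lt_la).
  have [ga0|] := eqVneq ga empty_part.
    by rewrite ga0 (LR_nil hs hc la nu).2 (negPf la_nu) mulr0z.
  by rewrite -psize_eq0 -lt0n => ga0; rewrite LR_eq0 ?mulr0z //; lia.
rewrite big_mkcond (bigD1_seq empty_part) ?parts_le_uniq ?mem_parts_le //=.
rewrite (LR_nil hs hc nu nu).2 eqxx ifT ?big1 ?addr0 //; last by case: b.
move=> ga; rewrite -psize_eq0 -lt0n => ga0.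
by rewrite LR_eq0 ?mulr0z ?if_same //; lia.
Qed.

(** Both families solve the same unitriangular system, the left one by definition and the right one
    by [branching_rule]; the Schur functions on the other side agree by [schur_jt]. *)
Lemma universal_character_jt (B : comNzRingType) n r (p : 'I_(n + r) -> B) (la : part) :
    (psize la <= n)%N ->
  spec p (inN (n + r) (u la)) = jt n (hser p) (twist B b) (1 + 'X^2) (nth 0%N la).
Proof.
move=> la_n; apply/eqP; rewrite -subr_eq0; apply/eqP.
pose x (la : part) := spec p (inN (n + r) (u la)) - jt n (hser p) (twist B b) (1 + 'X^2) (nth 0%N la).
apply: (LR_solve (x := x) _ la_n) => nu nu_n.
transitivity (spec p (inN (n + r) (s_gl nu)) - jt n (hser p) 1 1 (nth 0%N nu)); last first.
  by rewrite schur_jt ?subrr // (leq_trans (size_le_psize _)).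
rewrite (branching_rule hs hc b (hser p) nu_n) (universal_expansion _ nu_n).
rewrite rmorph_sum -sumrB; apply: eq_bigr => mu _.
rewrite rmorph_sum -sumrB; apply: eq_bigr => ga _.
by rewrite raddfMz /x mulrzBl.
Qed.

(** A universal character is the Schur function of the same partition plus terms of lower degree. *)
Lemma universal_top N la i : (psize la <= N)%N -> (psize la <= i)%N ->
  (spec (fun j => ('X_j)%:P * 'X : {poly {mpoly int[N]}}) (inN N (u la)))`_i
    = if i == psize la then inN N (s_gl la) else 0.
Proof.
have [m le_m] := ubnP (psize la); elim: m la i le_m => // m IH la i lt_m la_N le_i.
have la_sz := leq_trans (size_le_psize la) la_N.
have coef_s : (spec (fun j => ('X_j)%:P * 'X : {poly {mpoly int[N]}}) (inN N (s_gl la)))`_i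
   = if i == psize la then inN N (s_gl la) else 0.
  rewrite (graded_schur hs la_sz) coefMXn coefC ltnNge le_i /= subn_eq0.
  by rewrite eqn_leq le_i andbT.
rewrite -[RHS]coef_s (universal_expansion N (leqnn (psize la))).
rewrite [in RHS]rmorph_sum [RHS]coef_sum [RHS](bigD1_seq la) ?parts_le_uniq ?mem_parts_le //=.
rewrite [X in _ = _ + X]big1_seq ?addr0 => [|mu /andP[mu_la]]; last first.
  rewrite mem_parts_le => mu_n; rewrite rmorph_sum [LHS]coef_sum big1 // => ga _.
  rewrite raddfMz coefMrz; have [lt_mu|le_la] := ltnP (psize mu) (psize la).
    rewrite IH; try lia.
    by rewrite gtn_eqF ?mul0rz // (leq_trans lt_mu).
  have [ga0|] := eqVneq ga empty_part.
    by rewrite ga0 (LR_nil hs hc mu la).2 (negPf mu_la) mulr0z.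
  by rewrite -psize_eq0 -lt0n => ga0; rewrite LR_eq0 ?mulr0z //; lia.
rewrite rmorph_sum [RHS]coef_sum [RHS]big_mkcond [RHS](bigD1_seq empty_part) ?parts_le_uniq ?mem_parts_le //=.
rewrite (LR_nil hs hc la la).2 eqxx ifT; last by case: b.
rewrite [X in _ = _ + X]big1 ?addr0 // => ga; rewrite -psize_eq0 -lt0n => ga0.
by rewrite LR_eq0 ?mulr0z ?rmorph0 ?coef0 ?if_same //; lia.
Qed.

(** If the largest size m in the support exceeded d, the degree m part would be a nontrivial
    relation between Schur functions; m variables are enough for these to be independent. *)
Lemma universal_coef_eq0 (F : forall N, {mpoly int[N]}) d (K : part -> int) :
    (forall N (S := spec (fun j => ('X_j)%:P * 'X : {poly {mpoly int[N]}})),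
       (size (S (F N)) <= d.+1)%N) ->
    finite_set [set la | K la != 0]%classic ->
    (forall N, in_vars (\sum_(la \in [set: part]) u la *~ K la) N = F N) ->
  exists2 L : seq part, uniq L /\ (forall la, K la != 0 -> la \in L) &
    (forall N, F N = \sum_(la <- L) inN N (u la) *~ K la) /\
    (forall la, la \in L -> psize la <= d)%N.
Proof.
move=> F_d fin KE; pose L0 : seq part := fset_set [set la | K la != 0]%classic.
have L0_uniq : uniq L0 by exact: fset_uniq.
have L0P la : (la \in L0) = (K la != 0).
  by rewrite in_fset_set //; apply/idP/idP => [/set_mem|/mem_set].
have FE N : F N = \sum_(la <- L0) inN N (u la) *~ K la.
  rewrite -KE -/(inN N _) (fsum_seq (P := predT) L0_uniq) // => [|la _]; last first.
    by rewrite L0P negbK => /eqP ->.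
  by rewrite rmorph_sum; apply: eq_bigr => la _; rewrite raddfMz.
exists L0; first by split=> // la; rewrite L0P.
split=> // la la_L; rewrite leqNgt; apply/negP => lt_d.
pose m := \max_(mu <- L0) psize mu.
have le_m mu : mu \in L0 -> (psize mu <= m)%N.
  by move=> mu_L; exact: (@leq_bigmax_seq _ _ predT psize).
have [mu mu_L mu_m] := bigmax_attained psize la_L.
have lt_dm : (d < m)%N by apply: leq_trans lt_d (le_m _ la_L).
have := nth_default 0 (leq_trans (F_d m) lt_dm).
rewrite FE rmorph_sum /= coef_sum => E.
have : \sum_(la <- L0) inN m (s_gl la) *~ (if psize la == m then K la else 0) = 0.
  rewrite -[RHS]E big_seq [RHS]big_seq; apply: eq_bigr => nu nu_L.
  rewrite raddfMz coefMrz universal_top ?le_m // eq_sym.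
  by case: eqP; rewrite ?mulr0z ?mul0rz.
have L_m (nu : part) : nu \in L0 -> (size nu <= m)%N.
  by move=> /le_m; apply: leq_trans (size_le_psize _).
move/(schur_free hs L0_uniq L_m)/(_ mu mu_L); rewrite mu_m eqxx => /eqP.
by rewrite -[_ == _]negbK -L0P mu_L.
Qed.

End Universal.
End Characters.

(** * The series defining the universal coefficients *)

(** The flag [true] is the symplectic product, which expands in Schur functions with even rows,
    whereas the universal characters attached to even rows are the orthogonal ones. *)
Definition pair_ser (A : comNzRingType) (b : bool) N (p : 'I_N -> A) : ser A :=
  \prod_(i < N) \prod_(j < N | (if b then i <= j else i < j)%N)
    (geometric (p i * p j) : ser A).

Lemma so_seriesE N k : so_series N k =
  ((even_euler _ : ser {mpoly int[N]}) * pair_ser false (fun j => 'X_j)) k.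
Proof. by []. Qed.

Lemma sp_seriesE N k : sp_series N k =
  ((even_euler _ : ser {mpoly int[N]}) * pair_ser true (fun j => 'X_j)) k.
Proof. by []. Qed.

Lemma mapser_pair_ser (A B : comNzRingType) (f : {rmorphism A -> B}) b N (p : 'I_N -> A) :
  mapser f (pair_ser b p) = pair_ser b (f \o p).
Proof.
rewrite /pair_ser rmorph_prod; apply: eq_bigr => i _.
rewrite rmorph_prod; apply: eq_bigr => j _.
by rewrite /= mapser_geometric rmorphM.
Qed.

Section Degree.
Variable N : nat.
Let S : {mpoly int[N]} -> {poly {mpoly int[N]}} := spec (fun j => ('X_j)%:P * 'X).
Let small (f : ser {mpoly int[N]}) := forall k, (size (S (f k)) <= (2 * k).+1)%N.

Lemma smallM f g : small f -> small g -> small (f * g).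
Proof.
move=> fs gs k; rewrite serE /S rmorph_sum /=; apply: (leq_trans (size_sum _ _ _)).
apply/bigmax_leqP => i _; rewrite rmorphM /=; apply: (leq_trans (size_polyMleq _ _)).
move: (fs i) (gs (k - i)%N) (ltn_ord i); rewrite /S.
by set a := size _; set b := size _; lia.
Qed.

(** Each power of q brings at most two variables. *)
Lemma small_series b : small ((even_euler _ : ser {mpoly int[N]}) * pair_ser b (fun j => 'X_j)).
Proof.
have small1 : small 1.
  move=> k; rewrite /S -[X in spec _ X]/((k == 0%N)%:R) rmorph_nat.
  by rewrite -polyC_natr (leq_trans (size_polyC_leq1 _)).
apply: smallM => [k|].
  rewrite /S /even_euler rmorph_int -(rmorph_int (@polyC _)).
  by rewrite (leq_trans (size_polyC_leq1 _)).
rewrite /pair_ser; elim/big_ind: _ => // [|i _]; first exact: smallM.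
elim/big_ind: _ => // [|j _]; first exact: smallM.
move=> k; rewrite /geometric /S rmorphXn rmorphM /= !specX.
rewrite (_ : _ * _ * _ = ('X_i * 'X_j)%:P * 'X^2); last by rewrite polyCM; ring.
rewrite exprMn -exprM -(rmorphXn (@polyC _)) /=; apply: (leq_trans (size_polyMleq _ _)).
move: (size_polyC_leq1 (('X_i * 'X_j : {mpoly int[N]}) ^+ k)); rewrite size_polyXn.
by set a := size _; lia.
Qed.
End Degree.

(** Substitutes t^2 for q: with y_j = t x_j the factor 1 - y_i y_j is 1 - x_i x_j t^2, so degree 2k
    in t corresponds to q^k. *)
Definition inflate (A : comNzRingType) (f : ser A) : ser A :=
  fun k => if odd k then 0 else f k./2.

Lemma inflateE (A : comNzRingType) (f : ser A) m k : (k < m)%N ->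
  inflate f k = (trunc m f \Po 'X^2)`_k.
Proof.
move=> lt_km; rewrite coef_comp_poly_Xn // dvdn2 /inflate; case: ifP => //= _.
by rewrite divn2 coef_poly ifT //; lia.
Qed.

Lemma inflateM (A : comNzRingType) (f g : ser A) : inflate (f * g) = (inflate f : ser A) * inflate g.
Proof.
apply: funext => k; rewrite -[RHS]/(serM _ _ k) (serM_coef _ _ (ltnSn k)).
rewrite /inflate; transitivity (((trunc k.+1 f * trunc k.+1 g) \Po 'X^2)`_k).
  rewrite coef_comp_poly_Xn // dvdn2; case: ifP => //= _.
  by rewrite divn2 -serM_coef //; lia.
rewrite comp_polyM !coefM; apply: eq_bigr => i _.
have lt_ki : (k - i < k.+1)%N by rewrite ltnS leq_subr.
rewrite -(inflateE f (ltn_ord i)) -(inflateE g lt_ki).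
by rewrite !coef_poly ltn_ord lt_ki.
Qed.

Lemma inflate1 (A : comNzRingType) : inflate (1 : ser A) = 1 :> ser A.
Proof.
apply: funext => k; rewrite /inflate -[LHS]/(if odd k then 0 else (k./2 == 0%N)%:R).
rewrite -[RHS]/((k == 0%N)%:R); case: ifP => od; first by case: k od.
by congr (nat_of_bool _)%:R; lia.
Qed.

Lemma inflate_prod (A : comNzRingType) (I : Type) (r : seq I) (P : pred I) (F : I -> ser A) :
  inflate (\prod_(i <- r | P i) F i : ser A) = \prod_(i <- r | P i) (inflate (F i) : ser A).
Proof. exact: (big_morph (@inflate A : ser A -> ser A) (@inflateM A) (@inflate1 A)). Qed.

Lemma inflate_geometric (A : comNzRingType) (a : A) :
  (inflate (geometric a) : ser A) * pser (1 - a *: 'X^2) = 1.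
Proof.
have E : inflate (pser (1 - a *: 'X)) = pser (1 - a *: 'X^2) :> ser A.
  apply: funext => k; rewrite /inflate /pser !coefB !coefZ !coef1 coefX coefXn.
  case: ifP => od; first by case: k od => [|[|[|k]]] //= _; rewrite mulr0 subr0.
  by congr ((nat_of_bool _)%:R - _ * (nat_of_bool _)%:R); lia.
by rewrite -E -inflateM geometricK inflate1.
Qed.

Section LittlewoodSeries.
Variables (s_gl : part -> symfun).
Hypothesis (hs : schur_functions s_gl).

(** Littlewood's identity at y_j = t x_j says that [U], the even Schur functions graded by size, is
    inverse to [pair_prod] up to degree N in t. The inflated product is an inverse too, so the
    coefficients agree. *)
Lemma pair_ser_schur b N k : (2 * k <= N)%N ->
  pair_ser b (fun j => 'X_j : {mpoly int[N]}) k
    = \sum_(ga <- parts_le N | (psize ga == 2 * k)%N && even_part b ga) inN N (s_gl ga).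
Proof.
move=> le_kN; pose A := {mpoly int[N]}; pose w0 := wt N (fun=> 0%N).
have [R [ka [kaX ka0]]] := truncated_poly_ring A (N + w0).
set M := (N + w0).+1 in kaX.
pose Y (j : 'I_N) : {poly A} := 'X * ('X_j)%:P.
pose y (j : 'I_N) : R := ka (Y j).
have yM j : y j ^+ M = 0 by rewrite /y rmorphM exprMn kaX mul0r.
pose a0 : A := alt (fun j => 'X_j) (fun=> 0%N).
pose U : {poly A} := \sum_(la <- pl N M | even_part b la) 'X^(psize la) * (inN N (s_gl la))%:P.
have altE (la : part) : (size la <= N)%N -> alt y (nth 0%N la)
    = ka ('X^w0 * a0%:P * ('X^(psize la) * (inN N (s_gl la))%:P)).
  move=> la_N; rewrite (_ : _ * _ = 'X^(psize la + w0) * (alt (fun j => 'X_j) (nth 0%N la))%:P).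
    rewrite -(wt_part la_N) (rmorph_alt (@polyC A)) -alt_scale.
    by rewrite rmorph_alt.
  by rewrite -alternantE -(hs la_N) alternant0E polyCM exprD; ring.
have alt0E : alt y (fun=> 0%N) = ka ('X^w0 * a0%:P).
  by rewrite (rmorph_alt (@polyC A)) -alt_scale rmorph_alt.
have key : ka ('X^w0 * (a0%:P * (U * pair_prod b Y - 1))) = 0.
  have sumE : \sum_(la <- pl N M | even_part b la) alt y (nth 0%N la) = ka ('X^w0 * a0%:P * U).
    rewrite mulr_sumr rmorph_sum big_seq_cond [RHS]big_seq_cond.
    by apply: eq_bigr => la /andP[+ _]; rewrite mem_pl => /andP[/altE].
  have prodE : pair_prod b y = ka (pair_prod b Y).
    rewrite /pair_prod rmorph_prod; apply: eq_bigr => i _.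
    by rewrite rmorph_prod; apply: eq_bigr => j _; rewrite rmorphB rmorph1 rmorphM.
  rewrite (_ : _ * _ = 'X^w0 * a0%:P * U * pair_prod b Y - 'X^w0 * a0%:P); last by ring.
  by rewrite rmorphB rmorphM -sumE -prodE (littlewood b yM) alt0E subrr.
(* The Vandermonde alternant [a0] is nonzero in an integral domain, so it can be cancelled once the
   degree w0 is shifted away. *)
have UP i : (i <= N)%N -> (U * pair_prod b Y)`_i = (1 : {poly A})`_i.
  move=> le_iN; have := ka0 _ key (w0 + i)%N; rewrite coefXnM addKn ltnNge leq_addr /=.
  rewrite addnC leq_add2r coefCM coefB => /(_ le_iN)/eqP; rewrite mulf_eq0 (negPf (alt0_neq0 N)) /=.
  by rewrite subr_eq0 => /eqP.
pose V := inflate (pair_ser b (fun j => 'X_j : A)).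
have VP : (V : ser A) * pser (pair_prod b Y) = 1.
  rewrite /V /pair_ser inflate_prod /pair_prod rmorph_prod -big_split big1 //= => i _.
  rewrite inflate_prod rmorph_prod -big_split big1 //= => j _.
  rewrite (_ : Y i * Y j = ('X_i * 'X_j) *: 'X^2); first exact: inflate_geometric.
  by rewrite /Y -mul_polyC polyCM; ring.
have UV i : (i <= N)%N -> U`_i = V i.
  move=> le_iN; rewrite -[LHS]/(pser U i) -[pser U]mulr1 -VP.
  rewrite (_ : pser U * _ = pser (U * pair_prod b Y) * V); last by rewrite rmorphM; ring.
  rewrite -[V in RHS]mul1r -(rmorph1 (@pser A)) !serE; apply: eq_bigr => j _.
  by rewrite {1}/pser UP //; have := ltn_ord j; lia.
transitivity (V (2 * k)%N); first by rewrite /V /inflate oddM /= mul2n doubleK.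
rewrite -UV // coef_sum.
transitivity (\sum_(la <- pl N M) if (psize la == 2 * k)%N && even_part b la then inN N (s_gl la) else 0).
  rewrite big_mkcond; apply: eq_bigr => la _; rewrite andbC; case: ifP => //= _.
  rewrite coefXnM coefC; case: ltngtP => [lt|lt|->]; last by rewrite subnn.
    by [].
  by rewrite subn_eq0 leqNgt lt.
rewrite [RHS]big_mkcond; apply: big_eq_supp; rewrite ?pl_uniq ?parts_le_uniq //.
  by move=> la _; rewrite mem_parts_le; case: eqP => //= ->; rewrite le_kN.
move=> la; rewrite mem_parts_le mem_pl => la_n.
by rewrite (leq_trans (size_le_psize _)) // (leq_trans (nth_le_psize _ _)) // (leq_trans la_n) ?leq_addr.
Qed.
End LittlewoodSeries.

(** * Partitions with even rows and even columns *)

Definition even_even (ga : part) : bool := even_rows ga && even_columns ga.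

Lemma coef_mul_1subXn (A : comNzRingType) (p : {poly A}) d j : (j < d)%N ->
  (p * (1 - 'X^d))`_j = p`_j.
Proof. by move=> lt_jd; rewrite mulrBr mulr1 coefB coefMXn lt_jd subr0. Qed.

Lemma coef_prod_1subXn (A : comNzRingType) m (d : nat -> nat) j :
    (forall i, (i < m)%N -> (j < d i)%N) ->
  (\prod_(i < m) (1 - 'X^(d i)) : {poly A})`_j = (j == 0%N)%:R.
Proof.
elim: m => [|m IH] lt_d; first by rewrite big_ord0 coef1.
by rewrite big_ord_recr /= coef_mul_1subXn ?lt_d // IH // => i lt_im; rewrite lt_d // ltnW.
Qed.

Lemma even_euler_prod m j : (j <= m)%N ->
  even_euler int j = (\prod_(i < m) (1 - 'X^(2 * i.+1)) : {poly int})`_j.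
Proof.
rewrite /even_euler intz => /subnKC <-; rewrite big_add1 big_mkord /=.
elim: (m - j)%N => [|d IH]; first by rewrite addn0.
by rewrite addnS big_ord_recr /= coef_mul_1subXn ?IH //; lia.
Qed.

(* Multiplicities [d i] of the 2 x 2 blocks of columns of length [2 * i.+1]. *)
Definition doubled_fun m (d : 'I_m -> nat) (i : nat) : nat :=
  (2 * \sum_(l < m | i./2 <= l) d l)%N.

Lemma doubled_fun_dec m (d : 'I_m -> nat) i : (doubled_fun d i.+1 <= doubled_fun d i)%N.
Proof.
rewrite leq_mul2l /= [leqLHS]big_mkcond [leqRHS]big_mkcond; apply: leq_sum => l _.
by case: ifP => // le_l; rewrite ifT //; lia.
Qed.

Lemma doubled_fun_out m (d : 'I_m -> nat) i : (m.*2 <= i)%N -> doubled_fun d i = 0%N.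
Proof.
move=> le_i; rewrite /doubled_fun big1 ?muln0 // => l le_l.
by have := ltn_ord l; lia.
Qed.

Definition doubled m (d : 'I_m -> nat) : part :=
  xget empty_part [set la : part | forall i, nth 0%N la i = doubled_fun d i]%classic.

Lemma nth_doubled m (d : 'I_m -> nat) i : nth 0%N (doubled d) i = doubled_fun d i.
Proof.
rewrite /doubled; case: xgetP => [la _ /(_ i) //|no].
have [la [_ laE]] := part_of_fun (doubled_fun_dec d) (doubled_fun_out d).
by case: (no la).
Qed.

Lemma doubled_size m (d : 'I_m -> nat) : (size (doubled d) <= m.*2)%N.
Proof. by rewrite leqNgt -nth_part_gt0 nth_doubled doubled_fun_out. Qed.

Lemma even_even_doubled m (d : 'I_m -> nat) : even_even (doubled d).
Proof.
apply/andP; split; first by apply/even_rowsP => i; rewrite nth_doubled oddM.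
apply/even_columnsP => i ev_i; rewrite !nth_doubled /doubled_fun.
by rewrite (_ : i.+1./2 = i./2) //; lia.
Qed.

Lemma psize_doubled m (d : 'I_m -> nat) :
  psize (doubled d) = (2 * \sum_(l < m) 2 * l.+1 * d l)%N.
Proof.
rewrite (psizeE (doubled_size d)).
under eq_bigr do rewrite nth_doubled /doubled_fun.
rewrite -big_distrr /=; congr (_ * _)%N.
under eq_bigr do rewrite big_mkcond.
rewrite exchange_big; apply: eq_bigr => l _ /=.
rewrite -big_mkcond /= sum_nat_const; congr (_ * _)%N.
rewrite -sum1_card (eq_bigl (fun i : 'I_m.*2 => (i < 2 * l.+1)%N)); last first.
  by move=> i; rewrite -topredE /=; lia.
rewrite -(big_ord_widen m.*2 (fun=> 1%N)); first by rewrite sum1_card card_ord.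
by have := ltn_ord l; lia.
Qed.

Lemma doubled_diff m (d : 'I_m -> nat) (l : 'I_m) :
  nth 0%N (doubled d) l.*2 = (nth 0%N (doubled d) l.*2.+2 + 2 * d l)%N.
Proof.
rewrite !nth_doubled /doubled_fun -mulnDr addnC; congr (_ * _)%N.
rewrite (bigD1 l) /=; last by lia.
by congr addn; apply: eq_bigl => k; rewrite -val_eqE /=; lia.
Qed.

Lemma doubled_surj m (ga : part) : (size ga <= m.*2)%N -> even_even ga ->
  exists2 d : 'I_m -> nat, doubled d = ga & forall l, (d l <= psize ga)%N.
Proof.
move=> ga_m /andP[/even_rowsP ev_r /even_columnsP ev_c].
exists (fun l : 'I_m => (nth 0 ga l.*2 - nth 0 ga l.*2.+2)./2); last first.
  by move=> l; move: (nth_le_psize ga l.*2); set a := nth _ _ _; set b := nth _ _ _; set c := psize _; lia.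
have tel e : (forall i, i + e = m -> 2 * \sum_(l < m | i <= l) (nth 0 ga l.*2 - nth 0 ga l.*2.+2)./2
    = nth 0 ga i.*2)%N.
  elim: e => [|e IH] i ie.
    rewrite big1 ?muln0 => [|l]; last by have := ltn_ord l; lia.
    by rewrite nth_default //; lia.
  have lt_im : (i < m)%N by lia.
  rewrite (bigD1 (Ordinal lt_im)) //= mulnDr.
  rewrite (eq_bigl (fun l : 'I_m => i.+1 <= l)%N) => [|l]; last by rewrite -val_eqE /=; lia.
  rewrite IH; last by lia.
  move: (ev_r i.*2) (ev_r i.*2.+2) (nth_part_le ga (leqW (leqnSn i.*2))); rewrite doubleS.
  by set a := nth _ _ _; set b := nth _ _ _; lia.
apply: part_eq => i; rewrite nth_doubled /doubled_fun.
have [le_i|lt_i] := leqP i./2 m; last first.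
  rewrite nth_default; last by lia.
  by rewrite big1 // => l; have := ltn_ord l; lia.
rewrite (tel (m - i./2)%N) ?subnKC //.
case od: (odd i); last by congr nth; lia.
have ev : ~~ odd i.-1 by lia.
by have := ev_c _ ev; rewrite (_ : i.-1.+1 = i); [move=> <-; congr nth; lia | lia].
Qed.

Definition even_even_ser n : ser int := fun k =>
  \sum_(ga <- parts_le n | (psize ga == 2 * k)%N && even_even ga) 1.

(** The diagram is cut into pairs of columns of length 2(l+1), with d_l pairs of each kind. A pair
    has 4(l+1) boxes, so size 2j means that the 2(l+1) d_l add up to j, and no d_l exceeds m. *)
Lemma even_even_count n m j : (j <= m)%N -> (2 * j <= n)%N ->
  even_even_ser n j = \sum_(d : {ffun 'I_m -> 'I_m.+1} | (\sum_(l < m) 2 * l.+1 * d l == j)%N) 1.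
Proof.
move=> le_jm le_jn.
pose P := [pred d : {ffun 'I_m -> 'I_m.+1} | (\sum_(l < m) 2 * l.+1 * d l == j)%N].
pose dbl (d : {ffun 'I_m -> 'I_m.+1}) := doubled (fun l => d l : nat).
transitivity (\sum_(ga <- [seq dbl d | d <- enum P]) (1 : int)); last first.
  by rewrite big_map big_enum.
rewrite /even_even_ser -big_filter; apply: perm_big; apply: uniq_perm.
- by rewrite filter_uniq ?parts_le_uniq.
- rewrite map_inj_in_uniq ?enum_uniq // => d d' _ _ E.
  apply/ffunP => l; apply/val_inj => /=.
  move: (doubled_diff (fun l => d l : nat) l) (doubled_diff (fun l => d' l : nat) l).
  rewrite -[doubled (fun l => d l : nat)]/(dbl d) E -[doubled _]/(dbl d').
  by rewrite /=; set a := nth _ _ _; set a' := nth _ _ _; lia.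
move=> ga; rewrite mem_filter mem_parts_le.
apply/idP/mapP => [/andP[/andP[/eqP ga_j ee] _]|[d]]; last first.
  rewrite mem_enum => /eqP d_j ->.
  by rewrite even_even_doubled psize_doubled d_j eqxx /= le_jn.
have ga_m : (size ga <= m.*2)%N by apply: leq_trans (size_le_psize _) _; lia.
have [d dE d_le] := doubled_surj ga_m ee.
have d_lt l : (d l < m.+1)%N.
  have := psize_doubled d; rewrite dE ga_j (bigD1 l) //=; nia.
exists [ffun l => Ordinal (d_lt l)]; last first.
  by rewrite -dE /dbl; congr doubled; apply: funext => l; rewrite ffunE.
rewrite mem_enum; apply/eqP.
have := psize_doubled d; rewrite dE ga_j => /eqP; rewrite eqn_mul2l /= => /eqP ->.
by apply: eq_bigr => l _; rewrite ffunE.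
Qed.

Lemma even_even_euler n k : (2 * k <= n)%N ->
  ((even_euler int : ser int) * even_even_ser n) k = (k == 0%N)%:R.
Proof.
move=> le_kn; pose E : {poly int} := \prod_(i < k) (1 - 'X^(2 * i.+1)).
(* Truncated geometric series: E P is the product of the 1 - q^(2(i+1)(k+1)), which is 1 up to
   degree k. *)
pose P : {poly int} := \prod_(i < k) \sum_(d < k.+1) 'X^(2 * i.+1 * d).
have PE j : (j <= k)%N -> even_even_ser n j = P`_j.
  move=> le_jk; rewrite (even_even_count le_jk); last by lia.
  rewrite /P bigA_distr_bigA coef_sum big_mkcond; apply: eq_bigr => d _.
  rewrite prodrXr coefXn eq_sym.
  by case: eqP.
transitivity ((E * P)`_k).
  rewrite serE coefM; apply: eq_bigr => i _.
  by rewrite PE ?leq_subr // (even_euler_prod (m := k)) // -ltnS.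
rewrite /E /P -big_split /= -(@coef_prod_1subXn int k (fun i => 2 * i.+1 * k.+1)%N).
  congr (polyseq _)`_k; apply: eq_bigr => i _; set D := (2 * i.+1)%N.
  under eq_bigr do rewrite exprM.
  have := subrXX (1 : {poly int}) 'X^D k.+1; rewrite expr1n -exprM => ->.
  by congr (_ * _); apply: eq_bigr => d _; rewrite expr1n mul1r.
by move=> i _; nia.
Qed.

(** * Integral group rings *)

(** Only the additive structure of finitely supported functions is taken over; the product [gmul] is
    convolution for the addition of K. *)
Definition gring (K : zmodType) : Type := monalg.malg K int.
HB.instance Definition _ (K : zmodType) := GRing.Zmodule.on (gring K).

Section GroupRing.
Variable K : zmodType.
Implicit Types (f g h : gring K) (a b : K).

Definition gcoef a f : int := monalg.mcoeff a f.
Definition gmono a (x : int) : gring K := monalg.mkmalgU a x.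
Local Notation supp f := (monalg.msupp (f : monalg.malg K int)).

Fact gcoef_is_zmod_morphism a : zmod_morphism (gcoef a).
Proof. by move=> f g; exact: monalg.mcoeffB. Qed.
HB.instance Definition _ a := GRing.isZmodMorphism.Build (gring K) int (gcoef a)
  (gcoef_is_zmod_morphism a).

Fact gmono_is_zmod_morphism a : zmod_morphism (gmono a).
Proof. by move=> x y; exact: monalg.monalgUB. Qed.
HB.instance Definition _ a := GRing.isZmodMorphism.Build int (gring K) (gmono a)
  (gmono_is_zmod_morphism a).

Lemma gcoef_mono x a b : gcoef b (gmono a x) = x *+ (a == b).
Proof. exact: monalg.mcoeffU. Qed.

Lemma gringP f g : (forall a, gcoef a f = gcoef a g) -> f = g.
Proof. by move=> fg; apply/monalg.malgP. Qed.

Lemma gring_expand f (A : {fset K}) : (supp f `<=` A)%fset ->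
  f = \sum_(a <- A) gmono a (gcoef a f).
Proof. exact: monalg.monalgEw. Qed.

Definition gmul f g : gring K :=
  \sum_(a <- supp f) \sum_(b <- supp g) gmono (a + b) (gcoef a f * gcoef b g).

Definition gmulr g f := gmul f g.

Lemma gmulEw f g (A B : {fset K}) : (supp f `<=` A)%fset -> (supp g `<=` B)%fset ->
  gmul f g = \sum_(a <- A) \sum_(b <- B) gmono (a + b) (gcoef a f * gcoef b g).
Proof.
move=> fA gB; rewrite /gmul; transitivity (\sum_(a <- supp f) \sum_(b <- B) gmono (a + b) (gcoef a f * gcoef b g)).
  apply: eq_bigr => a _; apply: big_fset_incl => // b _ /monalg.mcoeff_outdom.
  by rewrite -/(gcoef b g) => ->; rewrite mulr0 raddf0.
apply: big_fset_incl => // a _ /monalg.mcoeff_outdom; rewrite -/(gcoef a f) => ->.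
by rewrite big1 // => b _; rewrite mul0r raddf0.
Qed.

Lemma gmulC : commutative gmul.
Proof.
move=> f g; rewrite /gmul exchange_big; apply: eq_bigr => b _; apply: eq_bigr => a _.
by rewrite mulrC addrC.
Qed.

Lemma gmulBl g : zmod_morphism (gmulr g).
Proof.
move=> f f'; rewrite /gmulr; pose A := (supp f `|` supp f' `|` supp (f - f'))%fset.
have fA : (supp f `<=` A)%fset by rewrite /A -fsetUA fsubsetUl.
have f'A : (supp f' `<=` A)%fset by rewrite /A fsetUAC fsubsetUr.
have ffA : (supp (f - f') `<=` A)%fset by rewrite fsubsetUr.
rewrite !(gmulEw (A := A) (B := supp g)) // -sumrB; apply: eq_bigr => a _.
rewrite -sumrB; apply: eq_bigr => b _.
by rewrite raddfB mulrBl raddfB.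
Qed.
Lemma gmulBr f : zmod_morphism (gmul f).
Proof. by move=> g g'; rewrite ![gmul f _]gmulC; exact: gmulBl. Qed.

HB.instance Definition _ g := GRing.isZmodMorphism.Build (gring K) (gring K) (gmulr g) (gmulBl g).
HB.instance Definition _ f := GRing.isZmodMorphism.Build (gring K) (gring K) (gmul f) (gmulBr f).

Lemma gmul_mono x y a b : gmul (gmono a x) (gmono b y) = gmono (a + b) (x * y).
Proof.
rewrite (gmulEw (A := [fset a]%fset) (B := [fset b]%fset)) ?monalg.msuppU_le //.
by rewrite !big_seq_fset1 !gcoef_mono !eqxx.
Qed.

Lemma gmul_suml I (r : seq I) (F : I -> gring K) g :
  gmul (\sum_(i <- r) F i) g = \sum_(i <- r) gmul (F i) g.
Proof. exact: (raddf_sum (gmulr g)). Qed.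
Lemma gmul_sumr I (r : seq I) (F : I -> gring K) g :
  gmul g (\sum_(i <- r) F i) = \sum_(i <- r) gmul g (F i).
Proof. exact: (raddf_sum (gmul g)). Qed.

Lemma gmulA : associative gmul.
Proof.
move=> f g h; rewrite (gring_expand (fsubset_refl (supp f))) !gmul_suml.
apply: eq_bigr => a _.
rewrite (gring_expand (fsubset_refl (supp g))) !(gmul_suml, gmul_sumr).
apply: eq_bigr => b _.
rewrite (gring_expand (fsubset_refl (supp h))) !gmul_sumr.
by apply: eq_bigr => d _; rewrite !gmul_mono mulrA addrA.
Qed.

Lemma gmul1 : left_id (gmono 0 1) gmul.
Proof.
move=> f; rewrite [in RHS](gring_expand (fsubset_refl (supp f))).
rewrite {1}(gring_expand (fsubset_refl (supp f))) gmul_sumr.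
by apply: eq_bigr => a _; rewrite gmul_mono mul1r add0r.
Qed.

Lemma gmulDl : left_distributive gmul +%R.
Proof. by move=> f g h; exact: (raddfD (gmulr h)). Qed.

Lemma gmono1_neq0 : gmono 0 1 != 0.
Proof. by apply/eqP => /(congr1 (gcoef 0)); rewrite gcoef_mono eqxx raddf0. Qed.

HB.instance Definition _ := GRing.Zmodule_isComNzRing.Build (gring K)
  gmulA gmulC gmul1 gmulDl gmono1_neq0.

End GroupRing.

HB.lock Definition gexp (K : zmodType) (a : K) : gring K := gmono a 1.

Section Exponentials.
Variable K : zmodType.
Implicit Types (f g h : gring K) (a b : K).

Lemma gexp0 : gexp (0 : K) = 1. Proof. by rewrite unlock. Qed.
Lemma gexpD a b : gexp (a + b) = gexp a * gexp b.
Proof. by rewrite unlock -[RHS]/(gmul _ _) gmul_mono mulr1. Qed.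
Lemma gexpMn a k : gexp (a *+ k) = gexp a ^+ k.
Proof. by elim: k => [|k IH]; rewrite ?mulr0n ?gexp0 // mulrS exprS gexpD IH. Qed.
Lemma gcoef_exp a b : gcoef b (gexp a) = (a == b)%:R.
Proof. by rewrite unlock gcoef_mono; case: eqP. Qed.
Lemma gcoef_expM a b f : gcoef b (gexp a * f) = gcoef (b - a) f.
Proof.
rewrite unlock {1}(gring_expand (fsubset_refl (monalg.msupp (f : monalg.malg K int)))) mulr_sumr raddf_sum /=.
rewrite [f in RHS](gring_expand (fsubset_refl (monalg.msupp (f : monalg.malg K int)))) raddf_sum /=.
apply: eq_bigr => d _; rewrite -[_ * _]/(gmul _ _) gmul_mono !gcoef_mono mul1r.
by rewrite [in RHS]eq_sym subr_eq eq_sym addrC.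
Qed.

End Exponentials.

(** * The Weyl group as a group of signed permutations *)

Section SignedPerm.
Variable n : nat.
Implicit Types (s : 'S_n) (e : {ffun 'I_n -> bool}).

(** As (i, a) encodes (-1)^a eps_i, this is the linear map sending eps_i to (-1)^(e i) eps_(s i). *)
Definition sgp_fun s e (x : 'I_n * bool) : 'I_n * bool := (s x.1, x.2 (+) e x.1).

Lemma sgp_fun_inj s e : injective (sgp_fun s e).
Proof.
move=> [i a] [j b]; rewrite /sgp_fun /= => -[/perm_inj -> /eqP].
by rewrite (can_eq (addbK _)) => /eqP ->.
Qed.

Definition sgp s e : {perm 'I_n * bool} := perm (@sgp_fun_inj s e).

Lemma sgpE s e i a : sgp s e (i, a) = (s i, a (+) e i).
Proof. by rewrite permE. Qed.

Definition eff0 : {ffun 'I_n -> bool} := [ffun=> false].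
Definition emul s e e' : {ffun 'I_n -> bool} := [ffun i => e i (+) e' (s i)].

Lemma sgpM s e s' e' : (sgp s e * sgp s' e')%g = sgp (s * s') (emul s e e').
Proof. by apply/permP => -[i a]; rewrite permM !sgpE permM ffunE addbA. Qed.

Lemma sgp1 : sgp 1 eff0 = 1%g.
Proof. by apply/permP => -[i a]; rewrite sgpE !perm1 ffunE addbF. Qed.

Lemma sgp_inj s e s' e' : sgp s e = sgp s' e' -> s = s' /\ e = e'.
Proof.
move=> E; split; first by apply/permP => i; have := congr1 (@^~ (i, false)) (congr1 (@fun_of_perm _) E); rewrite !sgpE => -[].
by apply/ffunP => i; have := congr1 (@^~ (i, false)) (congr1 (@fun_of_perm _) E); rewrite !sgpE => -[].
Qed.

Definition eparity e : bool := \big[addb/false]_i e i.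

Lemma eparityM s e e' : eparity (emul s e e') = eparity e (+) eparity e'.
Proof.
rewrite /eparity [X in _ = _ (+) X](reindex_inj (@perm_inj _ s)) -big_split /=.
by apply: eq_bigr => i _; rewrite ffunE.
Qed.

Lemma eparity0 : eparity eff0 = false.
Proof. by rewrite /eparity big1 // => i _; rewrite ffunE. Qed.

Lemma refl_subE (i j : 'I_n) : i != j -> refl_sub i j = sgp (tperm i j) eff0.
Proof.
move=> /eqP ij; apply/permP => -[k a]; rewrite permM sgpE ffunE addbF /=.
by case: a; do 3! case: tpermP; congruence.
Qed.

Definition epair (i j : 'I_n) : {ffun 'I_n -> bool} := [ffun k => (k == i) || (k == j)].
Definition eone (i : 'I_n) : {ffun 'I_n -> bool} := [ffun k => k == i].

Lemma refl_addE (i j : 'I_n) : i != j -> refl_add i j = sgp (tperm i j) (epair i j).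
Proof.
move=> /eqP ij; apply/permP => -[k a]; rewrite permM sgpE ffunE /=.
by case: a; case: (k =P i); case: (k =P j); do 3! case: tpermP; rewrite /=; congruence.
Qed.

Lemma refl_oneE (i : 'I_n) : refl_one i = sgp 1 (eone i).
Proof.
apply/permP => -[k a]; rewrite sgpE ffunE perm1 permE /= !xpair_eqE /=.
by case: a; case: (eqVneq k i) => [->|ki].
Qed.

Lemma sgp_conj s e : (sgp s^-1 eff0 * sgp 1 e * sgp s eff0)%g
  = sgp 1 [ffun i => e (s^-1 i)%g].
Proof.
rewrite !sgpM mulg1 mulVg; congr sgp; apply/ffunP => i.
by rewrite !ffunE addFb addbF.
Qed.

Definition signed_perms (t : lie_type) : {set {perm 'I_n * bool}} :=
  [set sgp se.1 se.2 | se : 'S_n * {ffun 'I_n -> bool}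
     & (if t is so_even then ~~ eparity se.2 else true)].

Lemma signed_perms_group t : group_set (signed_perms t).
Proof.
apply/group_setP; split.
  apply/imsetP; exists (1%g, eff0); last by rewrite sgp1.
  by rewrite inE /= eparity0; case: t.
move=> _ _ /imsetP[[s e] se ->] /imsetP[[s' e'] se' ->].
apply/imsetP; exists ((s * s')%g, emul s e e'); last by rewrite sgpM.
by move: se se'; rewrite !inE /= eparityM; case: t => // /negPf-> /negPf->.
Qed.

Lemma eparity_one i : eparity (eone i).
Proof.
rewrite /eparity (bigD1 i) //= ffunE eqxx big1 // => j /negPf ji.
by rewrite ffunE ji.
Qed.

Lemma eparity_pair i j : i != j -> eparity (epair i j) = false.
Proof.
move=> ij; have -> : epair i j = emul 1 (eone i) (eone j).
  apply/ffunP => k; rewrite !ffunE perm1.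
  by case: (eqVneq k i) => [->|//]; rewrite (negPf ij).
by rewrite eparityM !eparity_one.
Qed.

(** The determinant of the signed permutation is -1 to this power. *)
Definition sgp_sign s e : bool := odd_perm s (+) eparity e.

Lemma simple_reflection_sgp t w : w \in simple_reflections t n ->
  w \in signed_perms t /\ exists s e, w = sgp s e /\ sgp_sign s e.
Proof.
have ne_succ (i j : 'I_n) : j == i.+1 :> nat -> i != j.
  by move=> /eqP ji; rewrite -val_eqE /= ji; lia.
rewrite inE => /orP[/imsetP[[i j]]|].
  rewrite inE /= => ji ->; have ij := ne_succ _ _ ji; rewrite refl_subE //; split.
    apply/imsetP; exists (tperm i j, eff0) => //.
    by rewrite inE /= eparity0; case: t.
  by exists (tperm i j), eff0; split; rewrite // /sgp_sign odd_tperm ij eparity0.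
case: t => /imsetP[].
- move=> i _ ->; rewrite refl_oneE; split; first by apply/imsetP; exists (1%g, eone i); rewrite ?inE.
  by exists 1%g, (eone i); split; rewrite // /sgp_sign odd_perm1 eparity_one.
- move=> i _ ->; rewrite refl_oneE; split; first by apply/imsetP; exists (1%g, eone i); rewrite ?inE.
  by exists 1%g, (eone i); split; rewrite // /sgp_sign odd_perm1 eparity_one.
move=> [i j]; rewrite inE /= => /andP[ji _] ->; have ij := ne_succ _ _ ji; rewrite refl_addE //; split.
  apply/imsetP; exists (tperm i j, epair i j) => //.
  by rewrite inE /= eparity_pair.
by exists (tperm i j), (epair i j); split; rewrite // /sgp_sign odd_tperm ij eparity_pair.
Qed.

Lemma weyl1 t : 1%g \in weyl_group t n. Proof. exact: group1. Qed.
Lemma weylM t x y : x \in weyl_group t n -> y \in weyl_group t n ->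
  (x * y)%g \in weyl_group t n.
Proof. exact: groupM. Qed.

(** Adjacent transpositions are simple reflections in every type; the others follow by conjugation,
    by induction on the distance of the two indices. *)
Lemma sgp_perm_weyl t s : sgp s eff0 \in weyl_group t n.
Proof.
have sgp_mul0 s1 s2 : sgp (s1 * s2) eff0 = (sgp s1 eff0 * sgp s2 eff0)%g.
  by rewrite sgpM; congr sgp; apply/ffunP => i; rewrite !ffunE.
have adj (i j : 'I_n) : j = i.+1 :> nat -> sgp (tperm i j) eff0 \in weyl_group t n.
  move=> ji; rewrite -refl_subE; last by rewrite -val_eqE /=; lia.
  apply: mem_gen; rewrite inE; apply/orP; left; apply/imsetP; exists (i, j) => //.
  by rewrite inE /= ji.
have tp d : forall i j : 'I_n, j = (i + d.+1)%N :> nat -> sgp (tperm i j) eff0 \in weyl_group t n.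
  elim: d => [|d IH] i j ji; first by apply: adj; lia.
  have lt_k : (i + d.+1 < n)%N by have := ltn_ord j; lia.
  pose k := Ordinal lt_k.
  have -> : tperm i j = (tperm i k ^ tperm k j)%g.
    by rewrite tpermJ tpermL tpermD // -val_eqE /=; lia.
  rewrite conjgE tpermV !sgp_mul0; apply: weylM; last apply: weylM.
  - by apply: adj => /=; lia.
  - by apply: IH.
  - by apply: adj => /=; lia.
have [ts -> dts] := prod_tpermP s; elim: ts dts => [|[i j] ts IH] /=.
  by rewrite big_nil sgp1 weyl1.
move=> /andP[ij /IH]; rewrite big_cons sgp_mul0 /= => ts_W; apply: weylM => //.
move: ij; rewrite /dpair /= -val_eqE /= neq_ltn => /orP[lt_ij|lt_ji].
  by apply: (tp (j - i).-1); lia.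
by rewrite tpermC; apply: (tp (i - j).-1); lia.
Qed.

(** Conjugating by permutations, the last simple reflection yields every single sign change (types B
    and C) or every change of two signs (type D). A sign vector is then reduced by induction on its
    number of signs. *)
Lemma weyl_groupE t : (1 < n)%N -> weyl_group t n = signed_perms t.
Proof.
move=> n_gt1; apply/eqP; rewrite finset.eqEsubset; apply/andP; split.
  rewrite -[signed_perms t]/(gval (Group (signed_perms_group t))) gen_subG.
  by apply/fintype.subsetP => w /simple_reflection_sgp[].
apply/fintype.subsetP => _ /imsetP[[s e] /= +  ->]; rewrite inE /= => ok_e.
have -> : sgp s e = (sgp 1 e * sgp s eff0)%g.
  rewrite sgpM mul1g; congr sgp; apply/ffunP => i.
  by rewrite !ffunE addbF.
apply: weylM (sgp_perm_weyl t s).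
have conj_W s' e' : sgp 1 e' \in weyl_group t n -> sgp 1 [ffun i => e' (s'^-1 i)%g] \in weyl_group t n.
  by move=> e'_W; rewrite -sgp_conj !weylM ?sgp_perm_weyl.
have [last lastE] : exists i : 'I_n, i.+1 = n.
  have lt_n : (n.-1 < n)%N by lia.
  by exists (Ordinal lt_n) => /=; lia.
pose wtE (e : {ffun 'I_n -> bool}) := #|[set i | e i]|.
have [k le_k] := ubnP (wtE e); elim: k e ok_e le_k => // k IH e ok_e lt_k.
have [e0|] := set_0Vmem [set i | e i].
  have -> : e = eff0 by apply/ffunP => i; have := finset.in_set0 i; rewrite -e0 inE ffunE.
  by rewrite sgp1 weyl1.
case=> i; rewrite inE => ei.
have splitE e1 e2 : sgp 1 [ffun k => e1 k (+) e2 k] = (sgp 1 e1 * sgp 1 e2)%g.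
  rewrite sgpM mulg1; congr sgp; apply/ffunP => j; rewrite !ffunE perm1 //.
have one_case : sgp 1 (eone last) \in weyl_group t n ->
    (if t is so_even then false else true) -> sgp 1 e \in weyl_group t n.
  move=> last_W t_ok; have one_W : sgp 1 (eone i) \in weyl_group t n.
    rewrite (_ : eone i = [ffun k => eone last ((tperm last i)^-1 k)%g]); first exact: conj_W.
    apply/ffunP => j.
    by rewrite !ffunE tpermV -(inj_eq (@perm_inj _ (tperm last i)) _ last) tpermK tpermL.
  have -> : e = [ffun k => eone i k (+) [ffun j => e j && (j != i)] k].
    by apply/ffunP => j; rewrite !ffunE; case: eqP => [->|_]; rewrite ?ei ?andbT ?andbF.
  rewrite splitE; apply: weylM one_W (IH _ _ _).
    by case: (t) t_ok.
  rewrite -ltnS; apply: leq_trans lt_k; rewrite ltnS; apply: proper_card; apply/properP; split.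
    by apply/fintype.subsetP => j; rewrite !inE ffunE => /andP[].
  by exists i; rewrite !inE ?ffunE ?eqxx ?andbF.
case: t ok_e IH conj_W one_case => ok_e IH conj_W one_case.
- apply: one_case => //; rewrite -refl_oneE; apply: mem_gen; rewrite inE; apply/orP; right.
  by apply/imsetP; exists last; rewrite ?inE ?lastE.
- apply: one_case => //; rewrite -refl_oneE; apply: mem_gen; rewrite inE; apply/orP; right.
  by apply/imsetP; exists last; rewrite ?inE ?lastE.
have lt_p : (n.-2 < n)%N by lia.
pose prev := Ordinal lt_p.
have prev_last : prev != last by rewrite -val_eqE /=; lia.
have pair_W : sgp 1 (epair prev last) \in weyl_group so_even n.
  have -> : sgp 1 (epair prev last) = (refl_add prev last * sgp (tperm prev last) eff0)%g.
    rewrite refl_addE // sgpM tperm2; congr sgp; apply/ffunP => j; rewrite !ffunE addbF //.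
  apply: weylM (sgp_perm_weyl _ _); apply: mem_gen; rewrite inE; apply/orP; right.
  by apply/imsetP; exists (prev, last) => //; rewrite inE /=; lia.
(* Even parity provides a second sign, to be removed together with that of i. *)
have [j ej ij] : exists2 j, e j & i != j.
  apply/exists_inP; apply: contraT; rewrite negb_exists_in => /forall_inP no_j.
  move: ok_e; rewrite (_ : e = eone i) ?eparity_one //; apply/ffunP => j; rewrite ffunE.
  by case: (eqVneq j i) => [->|]; [rewrite ei | apply: contraNF => /no_j; rewrite negbK eq_sym].
have ij_W : sgp 1 (epair i j) \in weyl_group so_even n.
  (* [s'] has to send prev to i and last to j. The first transposition moves last to m, which
     differs from i, so the second one can carry m to j and leave i fixed. *)
  pose m := tperm prev i last; have mi : m != i.
    by rewrite /m -(inj_eq (@perm_inj _ (tperm prev i))) tpermK tpermR eq_sym.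
  pose s' := (tperm prev i * tperm m j)%g.
  have s'p : s' prev = i by rewrite permM tpermL tpermD // eq_sym.
  have s'l : s' last = j by rewrite permM -/m tpermL.
  rewrite (_ : epair i j = [ffun k => epair prev last (s'^-1 k)%g]); first exact: conj_W.
  apply/ffunP => l.
  by rewrite !ffunE -(inj_eq (@perm_inj _ s') _ prev) -(inj_eq (@perm_inj _ s') _ last) permKV s'p s'l.
have -> : e = [ffun k => epair i j k (+) [ffun l => e l && (l != i) && (l != j)] k].
  apply/ffunP => l; rewrite !ffunE; case: (eqVneq l i) => [->|_]; rewrite ?ei ?andbF //=.
  by case: (eqVneq l j) => [->|_]; rewrite ?ej ?andbF ?andbT.
rewrite splitE; apply: weylM ij_W (IH _ _ _).
  have := eparityM 1 (epair i j) [ffun l => e l && (l != i) && (l != j)].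
  rewrite eparity_pair // addFb => <-; rewrite (_ : emul _ _ _ = e) //.
  apply/ffunP => l; rewrite !ffunE perm1; case: (eqVneq l i) => [->|_]; rewrite ?ei ?andbF //=.
  by case: (eqVneq l j) => [->|_]; rewrite ?ej ?andbF ?andbT.
rewrite -ltnS; apply: leq_trans lt_k; rewrite ltnS; apply: proper_card; apply/properP; split.
  by apply/fintype.subsetP => l; rewrite !inE ffunE => /andP[/andP[]].
by exists i; rewrite !inE ?ffunE ?eqxx ?andbF.
Qed.

End SignedPerm.

(** The prefixes of a word of minimal length are distinct elements of the group. Hence the search in
    [weyl_length] succeeds within its range. *)
Lemma short_word (gT : finGroupType) (A : {set gT}) (w : gT) : w \in <<A>>%g ->
  exists2 l, (l < #|<<A>>%g|)%N & w \in (A ^+ l)%g.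
Proof.
move=> /gen_prodgP[m0 [c0 c0A wE]].
have : exists l, w \in (A ^+ l)%g.
  exists m0; rewrite wE; elim: m0 c0 c0A {wE} => [|m IH] c cA; first by rewrite big_ord0 expg0 inE.
  rewrite big_ord_recl expgS; apply: mem_mulg; first exact: cA.
  by apply: IH => i; exact: cA.
case/ex_minnP => l w_l l_min; exists l => //.
have prefix j : (j <= l)%N -> exists u v, [/\ u \in (A ^+ j)%g, v \in (A ^+ (l - j))%g & w = (u * v)%g].
  move=> le_j; move: w_l; rewrite -{1}(subnKC le_j) expgD => /mulsgP[u v uA vA ->].
  by exists u, v.
have /choice[f fP] (j : 'I_l.+1) : exists u, u \in (A ^+ j)%g /\ exists2 v, v \in (A ^+ (l - j))%g & w = (u * v)%g.
  by have [u [v [uA vA wE']]] := prefix j (ltn_ord j); exists u; split=> //; exists v.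
have f_lt (i j : 'I_l.+1) : (i < j)%N -> f i != f j.
  move=> lt_ij; apply/eqP => fij; have [_ [v vA wE']] := fP j; have [uA _] := fP i.
  have : (l <= i + (l - j))%N; last by have := ltn_ord j; lia.
  by apply: l_min; rewrite wE' -fij expgD mem_mulg.
have f_inj : injective f.
  move=> i j fij; apply/val_inj => /=; case: (ltngtP i j) => // /f_lt; first by rewrite fij eqxx.
  by rewrite fij eqxx.
rewrite -[l.+1]card_ord -(card_imset _ f_inj); apply: subset_leq_card.
apply/fintype.subsetP => _ /imsetP[j _ ->]; have [uA _] := fP j.
elim: (nat_of_ord j) (f j) uA => [|m IH] u; first by rewrite expg0 inE => /eqP->; exact: group1.
by rewrite expgS => /mulsgP[a b aA bA ->]; apply: groupM (mem_gen aA) (IH _ bA).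
Qed.

(** Every simple reflection has determinant -1, so any word for w has the parity of its
    determinant. *)
Lemma weyl_length_sign t n s e : sgp s e \in weyl_group t n ->
  ((-1) ^+ weyl_length t (sgp s e) = (-1) ^+ sgp_sign s e :> int)%R.
Proof.
move=> w_W; rewrite /weyl_length; set a := fun l => _; set r := iota _ _.
have : has a r.
  have [l lt_l w_l] := short_word w_W; apply/hasP; exists l => //.
  by rewrite mem_iota.
move=> has_a; have := nth_find 0%N has_a; rewrite nth_iota; last first.
  by rewrite -(size_iota 0 #|weyl_group t n|) -has_find.
rewrite add0n /a; move: (find _ _) => l {has_a w_W a r}.
elim: l s e => [|l IH] s e.
  rewrite expg0 inE => /eqP; rewrite -sgp1 => /sgp_inj[-> ->].
  by rewrite /sgp_sign odd_perm1 eparity0.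
rewrite expgS => /mulsgP[a b /simple_reflection_sgp[_ [s1 [e1 [-> sign1]]]] b_l E].
have bE : b = sgp (s1^-1 * s)%g [ffun i => e1 (s1^-1 i)%g (+) e (s1^-1 i)%g].
  apply: (mulgI (sgp s1 e1)); rewrite -E sgpM mulKVg; congr sgp; apply/ffunP => i.
  by rewrite !ffunE permK addbA addbb.
rewrite bE in b_l; rewrite exprS (IH _ _ b_l).
move: sign1; rewrite /sgp_sign odd_permM odd_permV.
have -> : eparity [ffun i => e1 (s1^-1 i)%g (+) e (s1^-1 i)%g] = eparity e1 (+) eparity e.
  rewrite /eparity -big_split [RHS](reindex_inj (@perm_inj _ (s1^-1)%g)) /=.
  by apply: eq_bigr => i _; rewrite ffunE.
by case: (odd_perm s1); case: (odd_perm s); case: (eparity e); case: (eparity e1).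
Qed.

(** * Lusztig's q-analogues as coefficients of alternating sums *)

Lemma kostant_coef n (R : seq 'rV[rat]_n) k b :
  kostant R k b = gcoef b ((\prod_(a <- R) (geometric (gexp a) : ser (gring 'rV[rat]_n))) k).
Proof.
elim: R k b => [|a R IH] k b /=.
  rewrite big_nil -[X in gcoef b X]/((k == 0%N)%:R : gring _).
  case: eqP => _ /=; last by rewrite !mulr0n raddf0.
  by rewrite mulr1n -gexp0 gcoef_exp eq_sym.
rewrite big_cons serE raddf_sum; apply: eq_bigr => j _ /=.
by rewrite IH -[geometric _ _ in RHS]/(gexp a ^+ j) -gexpMn; exact: esym (gcoef_expM _ _ _).
Qed.

Section Action.
Variable n : nat.
Local Notation V := ('rV[rat]_n).
Implicit Types (s : 'S_n) (e : {ffun 'I_n -> bool}) (b : V).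

Definition act s e b : V := \sum_i ((-1) ^+ e i * b 0 i) *: eps (s i).

Lemma weyl_act_sgp s e b : weyl_act (sgp s e) b = act s e b.
Proof.
apply: eq_bigr => i _; rewrite sgpE /signed_eps /= scalerA; congr (_ *: _).
by rewrite mulrC.
Qed.

Lemma actE s e b i : act s e b 0 (s i) = (-1) ^+ e i * b 0 i.
Proof.
rewrite summxE (bigD1 i) //= big1 ?addr0; first by rewrite !mxE !eqxx mulr1.
by move=> j ji; rewrite !mxE eqxx (inj_eq perm_inj) eq_sym (negPf ji) mulr0.
Qed.

Fact act_is_zmod_morphism s e : zmod_morphism (act s e).
Proof.
move=> b b'; apply/rowP => j; rewrite -[j](permKV s) !(mxE, actE).
by rewrite mulrBr.
Qed.
End Action.

HB.instance Definition _ n s e := GRing.isZmodMorphism.Build 'rV[rat]_n 'rV[rat]_n (act s e)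
  (act_is_zmod_morphism s e).

Section WeylSums.
Variables (t : lie_type) (n : nat).
Local Notation V := ('rV[rat]_n).
Implicit Types (s : 'S_n) (e : {ffun 'I_n -> bool}) (b : V).

Lemma act_eps s e i : act s e (eps i) = (-1) ^+ e i *: eps (s i).
Proof.
rewrite /act (bigD1 i) //= big1 ?addr0 => [|j ji]; first by rewrite mxE !eqxx mulr1.
by rewrite mxE (negPf ji) andbF mulr0 scale0r.
Qed.

Lemma actZ s e c b : act s e (c *: b) = c *: act s e b.
Proof.
rewrite scaler_sumr; apply: eq_bigr => i _.
by rewrite scalerA mxE mulrCA.
Qed.

Definition einv s e : {ffun 'I_n -> bool} := [ffun i => e (s^-1 i)%g].

Lemma act_inv s e : cancel (act s e) (act s^-1 (einv s e)).
Proof.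
move=> b; apply/rowP => j.
by rewrite -[j in LHS](permK s) actE ffunE permK actE mulrA -expr2 sqrr_sign mul1r.
Qed.

Lemma act_invK s e : cancel (act s^-1 (einv s e)) (act s e).
Proof.
move=> b; apply/rowP => j; rewrite -[j in LHS](permKV s) actE.
have := actE s^-1 (einv s e) b j; rewrite ffunE => ->.
by rewrite mulrA -expr2 sqrr_sign mul1r.
Qed.

Definition ok_sign e : bool := if t is so_even then ~~ eparity e else true.

Lemma eparity_inv s e : eparity (einv s e) = eparity e.
Proof.
rewrite /eparity [RHS](reindex_inj (@perm_inj _ (s^-1)%g)).
by apply: eq_bigr => i _; rewrite ffunE.
Qed.

Lemma sgp_sign_inv s e : sgp_sign s^-1 (einv s e) = sgp_sign s e.
Proof. by rewrite /sgp_sign odd_permV eparity_inv. Qed.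

Lemma lusztig_sum (la : part) k : (1 < n)%N ->
  lusztig_coef t n la empty_part k = \sum_(s : 'S_n) \sum_(e | ok_sign e)
    (-1) ^+ sgp_sign s e *
      kostant (positive_roots t n) k (act s e (part_weight n la + rho t n) - rho t n).
Proof.
move=> n_gt1; rewrite /lusztig_coef.
transitivity (\sum_(w in signed_perms n t) (-1) ^+ weyl_length t w
    * kostant (positive_roots t n) k (weyl_dot t w (part_weight n la))).
  rewrite (weyl_groupE t n_gt1); apply: eq_bigr => w _; congr (_ * kostant _ _ _).
  by rewrite (_ : part_weight n empty_part = 0) ?subr0 //; apply/rowP => i; rewrite !mxE nth_nil.
rewrite big_imset /=; last first.
  by move=> [s e] [s' e'] _ _ /= /sgp_inj[] /= -> ->.
rewrite (eq_bigl (fun se => true && ok_sign se.2)); last by move=> se; rewrite inE.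
rewrite -(pair_big_dep xpredT (fun _ e => ok_sign e) (fun s e => (-1) ^+ weyl_length t (sgp s e) *
  kostant (positive_roots t n) k (weyl_dot t (sgp s e) (part_weight n la)))) /=.
apply: eq_bigr => s _; apply: eq_bigr => e ok_e.
rewrite weyl_length_sign; first by rewrite /weyl_dot weyl_act_sgp.
rewrite (weyl_groupE t n_gt1); apply/imsetP; exists (s, e) => //.
by rewrite inE.
Qed.

Lemma big_roots (T : Type) (idx : T) (op : Monoid.com_law idx) (F : V -> T) :
  \big[op/idx]_(a <- positive_roots t n) F a
  = op (\big[op/idx]_(p : 'I_n * 'I_n | (p.1 < p.2)%N)
          op (F (eps p.1 - eps p.2)) (F (eps p.1 + eps p.2)))
       (\big[op/idx]_(i < n) match t with so_odd => F (eps i) | sp => F (2 *: eps i)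
          | so_even => idx end).
Proof.
rewrite /positive_roots !big_cat /= !big_map !big_enum /= big_split /= Monoid.mulmA.
congr (op _ _); case: t.
- by rewrite big_map big_enum.
- by rewrite big_map big_enum.
- by rewrite big_nil big1.
Qed.

Definition rho_shift : rat := match t with so_odd => 2^-1 | sp => 1 | so_even => 0 end.

(** The roots eps_i - eps_j and eps_i + eps_j add up to 2 eps_i, so each j > i contributes 1 to the
    coordinate i of rho. *)
Lemma rhoE i : rho t n 0 i = (n - i.+1)%:R + rho_shift.
Proof.
have sumE : \sum_(a <- positive_roots t n) a 0 i = 2 * ((n - i.+1)%:R + rho_shift).
  rewrite (big_roots _ (fun a : V => a 0 i)) /= mulrDr; congr (_ + _).
    transitivity (\sum_(p : 'I_n * 'I_n | (p.1 < p.2)%N) if i == p.1 then 2%:R else 0 : rat).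
      apply: eq_bigr => p _; rewrite !mxE eqxx /=.
      by case: (i == p.1); case: (i == p.2); rewrite /= ?addr0 ?add0r ?subr0 ?sub0r; lra.
    rewrite -(pair_big_dep xpredT (fun j k : 'I_n => (j < k)%N) (fun j k => if i == j then 2%:R else 0)) /=.
    rewrite (bigD1 i) //= [X in _ + X]big1 ?addr0 => [|j ji]; last first.
      by rewrite big1 // => k _; rewrite eq_sym (negPf ji).
    rewrite eqxx; have := big_geq_mkord i.+1 n xpredT (fun=> 2%:R : rat) => <-.
    by rewrite sumr_const_nat -[LHS]mulr_natr.
  rewrite /rho_shift; case: t.
  - rewrite (bigD1 i) //= big1 ?mxE ?eqxx ?addr0 //= => j ji.
    by rewrite mxE eq_sym (negPf ji) andbF.
  - rewrite (bigD1 i) //= big1 ?mxE ?eqxx ?addr0 //= => j ji.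
    by rewrite !mxE eq_sym (negPf ji) andbF mulr0.
  - by rewrite big1 // mulr0.
by rewrite /rho mxE summxE sumE mulrA mulVf ?mul1r.
Qed.

End WeylSums.

Definition dot n (u v : 'rV[rat]_n) : rat := \sum_i u 0 i * v 0 i.

Lemma dotDl n (u u' v : 'rV[rat]_n) : dot (u + u') v = dot u v + dot u' v.
Proof. by rewrite /dot -big_split; apply: eq_bigr => i _; rewrite mxE mulrDl. Qed.
Lemma dotNl n (u v : 'rV[rat]_n) : dot (- u) v = - dot u v.
Proof. by rewrite /dot -sumrN; apply: eq_bigr => i _; rewrite mxE mulNr. Qed.
Lemma dotMnl n (u v : 'rV[rat]_n) k : dot (u *+ k) v = dot u v *+ k.
Proof. by rewrite /dot -sumrMnl; apply: eq_bigr => i _; rewrite mulmxnE mulrnAl. Qed.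
Lemma dotZl n c (u v : 'rV[rat]_n) : dot (c *: u) v = c * dot u v.
Proof. by rewrite /dot mulr_sumr; apply: eq_bigr => i _; rewrite mxE mulrA. Qed.
Lemma dot_eps n (v : 'rV[rat]_n) i : dot (eps i) v = v 0 i.
Proof.
rewrite /dot (bigD1 i) //= mxE !eqxx mul1r big1 ?addr0 // => j ji.
by rewrite mxE (negPf ji) andbF mul0r.
Qed.

(** A nonzero coefficient makes [b] a sum of k elements of [R]. *)
Lemma kostant_dot n (R : seq 'rV[rat]_n) v k b :
    (forall a, a \in R -> 0 < dot a v) -> kostant R k b != 0 ->
  (k = 0%N /\ b = 0) \/ 0 < dot b v.
Proof.
elim: R k b => [|a R IH] k b R_gt0 /=.
  by case: (k =P 0%N) => [->|_]; case: (b =P 0) => [->|_] //= _; left.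
have [j kj|no] := pickP (fun j : 'I_k.+1 => kostant R (k - j) (b - a *+ j) != 0); last first.
  by rewrite big1 ?eqxx // => j _; apply/eqP; have := no j => /negbT; rewrite negbK.
have a_gt0 : 0 < dot a v by apply: R_gt0; rewrite mem_head.
have aj_ge0 : 0 <= dot a v *+ j by rewrite mulrn_wge0 // ltW.
move=> _; have [|[kj0 bj]|] := IH _ _ _ kj.
- by move=> a' a'R; apply: R_gt0; rewrite inE a'R orbT.
- have bE : b = a *+ j by apply/eqP; rewrite -subr_eq0; apply/eqP.
  have jk : j = k :> nat by have := ltn_ord j; lia.
  case: (posnP k) => [k0|k_gt0]; first by left; rewrite bE jk k0 mulr0n.
  by right; rewrite bE dotMnl jk pmulrn_lgt0.
by rewrite dotDl dotNl dotMnl => lt0; right; lra.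
Qed.

Lemma kostant0 n (R : seq 'rV[rat]_n) b : kostant R 0 b = (b == 0)%:R.
Proof. by elim: R b => [|a R IH] b //=; rewrite big_ord1 /= mulr0n !subr0 IH. Qed.

Section Finite.
Variables (t : lie_type) (n : nat).
Local Notation V := ('rV[rat]_n).
Local Notation rho := (rho t n).
Implicit Types (s : 'S_n) (e : {ffun 'I_n -> bool}) (b : V).

(* Dominant regular weights, up to the last coordinate being zero. *)
Definition strict_dom b :=
  (forall i, 0 <= b 0 i) /\ (forall i j : 'I_n, (i < j)%N -> b 0 j < b 0 i).

Lemma rho_shift_ge0 : 0 <= rho_shift t.
Proof. by rewrite /rho_shift; case: t. Qed.

Lemma part_rhoE (la : part) i :
  (part_weight n la + rho) 0 i = (nth 0%N la i + (n - i.+1))%:R + rho_shift t.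
Proof.
rewrite -[LHS]/(((part_weight n la : V) + (rho : V)) 0 i) [LHS]mxE rhoE addrA.
by congr (_ + _); rewrite mxE natrD.
Qed.

Lemma strict_dom_part (la : part) : strict_dom (part_weight n la + rho).
Proof.
split=> [i|i j lt_ij]; rewrite !part_rhoE; first by rewrite addr_ge0 ?ler0n ?rho_shift_ge0.
rewrite ltrD2r ltr_nat.
have := nth_part_le la (ltnW lt_ij); have := ltn_ord j.
by set x := nth _ _ _; set y := nth _ _ _; lia.
Qed.

Lemma strict_dom_rho : strict_dom rho.
Proof.
have := strict_dom_part empty_part; rewrite (_ : part_weight n empty_part = 0) ?add0r //.
by apply/rowP => i; rewrite !mxE nth_nil.
Qed.

(** All coordinates are nonnegative, so signs can only change at zeros; then s preserves the strict
    order of the coordinates. *)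
Lemma act_strict_dom s e b b' : strict_dom b -> strict_dom b' -> act s e b = b' ->
  [/\ s = 1%g, b = b' & forall i, e i -> b 0 i = 0].
Proof.
move=> [b_ge0 b_dec] [b'_ge0 b'_dec] E.
have bE i : b' 0 (s i) = b 0 i /\ (e i -> b 0 i = 0).
  have := b_ge0 i; have := b'_ge0 (s i); rewrite -E actE.
  by case: (e i); rewrite ?expr1 ?expr0 ?mulN1r ?mul1r //; split; lra.
have s1 : s = 1%g.
  apply: incr_perm_id => i j lt_ij; have := b_dec _ _ lt_ij.
  rewrite -(bE i).1 -(bE j).1; case: (ltngtP (s i) (s j)) => // [lt_s|/val_inj ->].
    by have := b'_dec _ _ lt_s; lra.
  by rewrite ltxx.
split=> [//||i]; last by case: (bE i).
by apply/rowP => i; have [] := bE i; rewrite s1 perm1.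
Qed.

Lemma root_rho_gt0 a : a \in positive_roots t n -> 0 < dot a rho.
Proof.
have [ge0 dec] := strict_dom_rho.
rewrite /positive_roots !mem_cat => /or3P[/mapP[[i j]]|/mapP[[i j]]|].
- rewrite mem_enum inE /= => lt_ij ->; rewrite dotDl dotNl !dot_eps subr_gt0.
  exact: dec.
- rewrite mem_enum inE /= => lt_ij ->; rewrite dotDl !dot_eps.
  by have := dec _ _ lt_ij; have := ge0 j; lra.
case: (t) => //.
- move=> /mapP[i _ ->]; rewrite dot_eps rhoE /=; have : 0 <= (n - i.+1)%:R :> rat by [].
  by rewrite /rho_shift; lra.
- move=> /mapP[i _ ->]; rewrite dotZl dot_eps rhoE /=; have : 0 <= (n - i.+1)%:R :> rat by [].
  by rewrite /rho_shift; lra.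
Qed.

Lemma dot_act s e b : dot (act s e b) (act s e b) = dot b b.
Proof.
rewrite /dot (reindex_inj (@perm_inj _ s)) /=; apply: eq_bigr => i _.
by rewrite actE mulrACA -expr2 sqrr_sign mul1r.
Qed.

(** Expand |w b - b|^2 >= 0, using that w is an isometry. *)
Lemma dot_act_le s e b : dot (act s e b - b) b <= 0.
Proof.
rewrite dotDl dotNl; set u := act s e b.
suff : 0 <= \sum_i (u 0 i - b 0 i) ^+ 2.
  have -> : \sum_i (u 0 i - b 0 i) ^+ 2 = dot u u + dot b b - 2 * dot u b.
    rewrite /dot mulr_sumr -big_split -sumrB; apply: eq_bigr => i _ /=; ring.
  by rewrite /u dot_act; lra.
by apply: sumr_ge0 => i _; exact: sqr_ge0.
Qed.

Lemma rho_eq0 i : rho 0 i = 0 -> t = so_even /\ i.+1 = n :> nat.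
Proof.
rewrite rhoE => E; have ge0 : 0 <= (n - i.+1)%:R :> rat by [].
move: E; rewrite /rho_shift; case: (t) => E; [exfalso; lra | exfalso; lra |].
by move: E => /eqP; rewrite addr0 pnatr_eq0; have := ltn_ord i; split=> //; lia.
Qed.

(** The pairing of w rho - rho with rho is at most 0, while a nonzero Kostant value in degree k > 0
    needs a positive one. For k = 0 only the w fixing rho contribute; in type D a single sign at the
    zero coordinate is excluded by parity. *)
Lemma lusztig_nil k : (1 < n)%N ->
  lusztig_coef t n empty_part empty_part k = (k == 0%N)%:R.
Proof.
move=> n_gt1; rewrite lusztig_sum //.
rewrite (_ : part_weight n empty_part = 0) ?add0r; last by apply/rowP => i; rewrite !mxE nth_nil.
have [k0|k_gt0] := posnP k; last first.
  rewrite big1 // => s _; rewrite big1 // => e _.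
  have [->|] := eqVneq (kostant (positive_roots t n) k (act s e rho - rho)) 0; first by rewrite mulr0.
  move=> /(kostant_dot root_rho_gt0)[[k0 _]|]; first by rewrite k0 in k_gt0.
  by rewrite ltNge dot_act_le.
rewrite k0 (bigD1 1%g) //= [X in _ + X]big1 ?addr0 => [|s s1]; last first.
  rewrite big1 // => e _; rewrite kostant0 subr_eq0; case: eqP => [E|_]; last by rewrite mulr0.
  by have [s1' _ _] := act_strict_dom strict_dom_rho strict_dom_rho E; rewrite s1' eqxx in s1.
have act1 : act 1 (eff0 n) rho = rho.
  by apply/rowP => i; have := actE 1 (eff0 n) rho i; rewrite perm1 ffunE mul1r.
rewrite (bigD1 (eff0 n)) /=; last by rewrite /ok_sign eparity0; case: t.
rewrite big1 ?addr0 => [|e /andP[ok_e e0]]; last first.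
  rewrite kostant0 subr_eq0; case: eqP => [E|_]; last by rewrite mulr0.
  have [_ _ e_rho] := act_strict_dom strict_dom_rho strict_dom_rho E.
  case/eqP: e0; apply/ffunP => i; rewrite ffunE; apply/negP => ei.
  have last j : e j -> t = so_even /\ j.+1 = n :> nat by move=> /e_rho /rho_eq0.
  have [tD iE] := last _ ei; move: ok_e; rewrite /ok_sign tD (_ : e = eone i) ?eparity_one //.
  apply/ffunP => j; rewrite ffunE; apply/idP/eqP => [/last[_ jE]|->//].
  by apply/val_inj => /=; lia.
by rewrite act1 subrr kostant0 eqxx /sgp_sign odd_perm1 eparity0 mulr1.
Qed.

End Finite.

(** * Straightening *)

(** The staircase has the least sum among n distinct naturals, attained only by 0, ..., n - 1 in
    some order. *)
Lemma staircase_perm n (f : 'I_n -> nat) : injective f ->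
    (\sum_i f i <= \sum_(i < n) (n - i.+1))%N ->
  exists s : 'S_n, forall i, f i = (n - (s i).+1)%N.
Proof.
move=> f_inj f_le; have [s d_dec] := sort_perm f_inj; exists s => i.
pose d (i : 'I_n) : nat := f (s^-1 i)%g.
have d_ge (j : 'I_n) : (n - j.+1 <= d j)%N by exact: decreasing_ge.
rewrite -[in LHS](permK s i) -/(d (s i)); move: (s i) => {}i.
have sum_d : (\sum_i d i <= \sum_(i < n) (n - i.+1))%N.
  rewrite (_ : (\sum_i d i = \sum_i f i)%N) //.
  by rewrite [RHS](reindex_inj (@perm_inj _ (s^-1)%g)).
have : (\sum_(j | j != i) (n - j.+1) <= \sum_(j | j != i) d j)%N.
  by apply: leq_sum => j _; exact: d_ge.
move: sum_d; rewrite (bigD1 i) //= [X in (_ <= X)%N -> _](bigD1 i) //=.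
by have := d_ge i; set x := bigop.body _ _ _; set y := bigop.body _ _ _; lia.
Qed.

Section Alternating.
Variables (t : lie_type) (n : nat).
Local Notation V := ('rV[rat]_n).
Local Notation G := (gring V).
Local Notation rho := (rho t n).
Implicit Types (s : 'S_n) (e : {ffun 'I_n -> bool}) (b : V).

(** The alternating orbit sum of e^b; at rho it is the Weyl denominator. *)
Definition wsum b : G :=
  \sum_(s : 'S_n) \sum_(e | ok_sign t e) (-1) ^+ sgp_sign s e * gexp (act s e b).

Lemma act_act s e s1 e1 b : act s e (act s1 e1 b) = act (s1 * s)%g (emul s1 e1 e) b.
Proof.
apply/rowP => j; rewrite -[j](permKV (s1 * s)%g) actE permM !actE ffunE.
by rewrite signr_addb mulrA [in LHS](mulrC ((-1) ^+ _)).
Qed.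

Lemma sgp_signM s1 e1 s e :
  sgp_sign (s1 * s)%g (emul s1 e1 e) = sgp_sign s1 e1 (+) sgp_sign s e.
Proof.
by rewrite /sgp_sign odd_permM eparityM; case: (odd_perm s1); case: (eparity e1); case: (odd_perm s); case: (eparity e).
Qed.

Lemma ok_signM s1 e1 e : ok_sign t e1 -> ok_sign t (emul s1 e1 e) = ok_sign t e.
Proof. by rewrite /ok_sign; case: t => // /negPf e1F; rewrite eparityM e1F. Qed.

Lemma emul_inj s e : injective (emul s e).
Proof.
move=> e1 e2 /ffunP E; apply/ffunP => i; have := E (s^-1 i)%g.
by rewrite !ffunE permKV => /addbI.
Qed.

Lemma wsum_act s1 e1 b : ok_sign t e1 ->
  wsum (act s1 e1 b) = (-1) ^+ sgp_sign s1 e1 * wsum b.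
Proof.
move=> ok1; rewrite /wsum [in RHS](reindex_inj (mulgI s1)) mulr_sumr.
apply: eq_bigr => s _; rewrite [in RHS](reindex_inj (@emul_inj s1 e1)) mulr_sumr.
apply: eq_big => [e|e _]; first by rewrite ok_signM.
by rewrite act_act sgp_signM mulrA -signr_addb addbA addbb.
Qed.

(** A symmetry of determinant -1 fixing b makes the sum its own opposite, and the coefficients are
    integers. *)
Lemma wsum_eq0 s1 e1 b : ok_sign t e1 -> sgp_sign s1 e1 -> act s1 e1 b = b -> wsum b = 0.
Proof.
move=> ok1 odd1 E; have := wsum_act s1 b ok1; rewrite E odd1 expr1 mulN1r => W.
apply: gringP => a; rewrite raddf0; have := congr1 (gcoef a) W; rewrite raddfN /=; lia.
Qed.

Lemma wsum_eq_abs (i j : 'I_n) b : i != j -> `|b 0 i| = `|b 0 j| -> wsum b = 0.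
Proof.
move=> ij /eqP; rewrite eqr_norm2 => /orP[/eqP E|/eqP E].
  apply: (@wsum_eq0 (tperm i j) (eff0 n)).
  - by rewrite /ok_sign eparity0; case: t.
  - by rewrite /sgp_sign odd_tperm ij eparity0.
  apply/rowP => k; rewrite -[k](tpermK i j) actE ffunE mul1r.
  by rewrite tpermK; case: tpermP => // ->.
apply: (@wsum_eq0 (tperm i j) (epair i j)).
- by rewrite /ok_sign eparity_pair //; case: t.
- by rewrite /sgp_sign odd_tperm ij eparity_pair.
apply/rowP => k; rewrite -[k](tpermK i j) actE ffunE.
case: (tpermP i j k) => [_|_|/eqP ki /eqP kj]; rewrite ?eqxx ?orbT ?tpermL ?tpermR.
- by rewrite E mulN1r.
- by rewrite E mulN1r opprK.
by rewrite (negPf ki) (negPf kj) mul1r tpermD // eq_sym.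
Qed.

Lemma wsum_zero_coord (i : 'I_n) b : t <> so_even -> b 0 i = 0 -> wsum b = 0.
Proof.
move=> tD bi; apply: (@wsum_eq0 1 (eone i)).
- by rewrite /ok_sign; case: t tD.
- by rewrite /sgp_sign odd_perm1 eparity_one.
apply/rowP => k; have := actE 1 (eone i) b k; rewrite perm1 ffunE => ->.
by case: eqP => [->|_]; rewrite ?bi ?mulr0 ?mul1r.
Qed.

Definition in_rho_lattice b := forall i, exists z : int, b 0 i = z%:~R + rho_shift t.

(** The shift 1/2, 1 or 0 is the least absolute value allowed; for sp the value 0 lies below it and
    must be excluded. *)
Lemma abs_in_rho_lattice b i : in_rho_lattice b -> t <> sp \/ b 0 i != 0 ->
  exists m : nat, `|b 0 i| = m%:R + rho_shift t.
Proof.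
move=> /(_ i)[z ->]; rewrite /rho_shift; case: t.
- move=> _; have [z_ge0|z_lt0] := lerP 0 z.
    by exists `|z|%N; rewrite natr_absz (ger0_norm z_ge0) ger0_norm // addr_ge0 // ler0z.
  exists `|(z + 1)%R|%N; have z1 : z + 1 <= 0 by lia.
  have : (z + 1)%:~R <= 0 :> rat by rewrite lerz0.
  rewrite natr_absz (ler0_norm z1) rmorphN rmorphD /= -[1%:~R]/(1 : rat) => zR.
  by rewrite ler0_norm; lra.
- case=> // nz; exists (`|(z + 1)%R|%N - 1)%N.
  have z1 : z + 1 != 0 by move: nz; rewrite -[1 : rat]/(1%:~R) -rmorphD /= intr_eq0.
  rewrite -[1 : rat]/(1%:~R) -rmorphD /= -intr_norm -[(_ - _)%:R]/((_ - _)%N%:R).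
  by rewrite -pmulrn -natrD subnK ?natr_absz // absz_gt0.
- by move=> _; exists `|z|%N; rewrite !addr0 natr_absz intr_norm.
Qed.

(** The sum vanishes if two coordinates agree up to sign, or if one is 0 for sp. Otherwise the
    absolute values minus the shift are n distinct naturals with at most the sum of the staircase,
    so b is a signed permutation of rho. *)
Lemma wsum_straighten b : in_rho_lattice b -> \sum_i `|b 0 i| <= \sum_i rho 0 i ->
  exists z : int, wsum b = wsum rho *~ z.
Proof.
move=> b_lat b_le.
have [[i [tC bi]]|no_zero] := pselect (exists i, t = sp /\ b 0 i = 0).
  by exists 0; rewrite mulr0z (wsum_zero_coord _ bi) // tC.
have /choice[f fE] i : exists m : nat, `|b 0 i| = m%:R + rho_shift t.
  apply: abs_in_rho_lattice => //; have [bi|] := eqVneq (b 0 i) 0; last by right.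
  by left=> tC; apply: no_zero; exists i.
have [f_inj|/injectivePn[i [j ij fij]]] := boolP (injectiveb f); last first.
  by exists 0; rewrite mulr0z (wsum_eq_abs ij) // !fE fij.
have [s sE] : exists s : 'S_n, forall i, f i = (n - (s i).+1)%N.
  apply: staircase_perm (injectiveP _ f_inj) _.
  rewrite -(ler_nat rat) !natr_sum; move: b_le.
  rewrite (eq_bigr _ (fun i _ => fE i)) (eq_bigr _ (fun i _ => rhoE t i)).
  by rewrite !big_split /= lerD2r.
pose e := [ffun i => b 0 i < 0].
have rhoE' e' : (forall i, e' i != e i -> b 0 i = 0) -> act s e' b = rho.
  move=> e'E; apply/rowP => j; rewrite -[j](permKV s) actE rhoE -sE -fE.
  have := e'E (s^-1 j)%g; move: (s^-1 j)%g => i; rewrite ffunE.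
  case: (e' i) => /=; have [lt0|ge0] := ltrP (b 0 i) 0 => /= h.
  - by rewrite mulN1r ltr0_norm.
  - by rewrite h // normr0 mulr0.
  - by rewrite h // normr0 mulr0.
  - by rewrite mul1r ger0_norm.
suff [e' ok_e' E] : exists2 e', ok_sign t e' & act s e' b = rho.
  exists ((-1) ^+ sgp_sign s e'); rewrite -E wsum_act // -mulrzl.
  by rewrite rmorphXn rmorphN1 mulrA -expr2 sqrr_sign mul1r.
have [ok_e|] := boolP (ok_sign t e).
  by exists e => //; apply: rhoE' => i; rewrite eqxx.
rewrite /ok_sign => odd_e.
have tD : t = so_even by case: (t) odd_e.
have e_odd : eparity e by move: odd_e; rewrite tD negbK.
have n_gt0 : (0 < n)%N.
  by case: (posnP n) => // n0; move: e_odd; rewrite /eparity big1 // => i _; have := ltn_ord i; lia.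
have lt_last : (n.-1 < n)%N by lia.
(* In type D an odd number of signs is corrected at the coordinate of b that goes to the last one of
   rho, where both are 0. *)
pose i0 := (s^-1 (Ordinal lt_last))%g; exists (emul 1 (eone i0) e).
  by rewrite tD eparityM eparity_one e_odd.
apply: rhoE' => i; rewrite !ffunE perm1; case: (eqVneq i i0) => [-> _|]; last by rewrite addFb eqxx.
apply/eqP; rewrite -normr_eq0 fE sE permKV tD addr0 pnatr_eq0 /=; lia.
Qed.

End Alternating.

Lemma sub_linear_factor (A : comNzRingType) (x g h : A) (Q : {poly A}) :
  (x * g)%:P * ((1 - h *: 'X) * Q) = (x * g)%:P * Q - 'X * ((x * (g * h))%:P * Q).
Proof. by rewrite -mul_polyC mulrA [in RHS]polyCM; ring. Qed.

Section Numerator.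
Variables (t : lie_type) (n : nat).
Local Notation V := ('rV[rat]_n).
Local Notation G := (gring V).
Local Notation rho := (rho t n).
Local Notation wsum := (@wsum t n).
Implicit Types (s : 'S_n) (e : {ffun 'I_n -> bool}) (b : V).

(** [R] and [b] are left free so that the roots can be multiplied out one at a time. *)
Definition numer (R : seq V) b : {poly G} :=
  \sum_(s : 'S_n) \sum_(e | ok_sign t e)
    ((-1) ^+ sgp_sign s e * gexp (act s e b))%:P
      * \prod_(a <- R) (1 - gexp (- act s e a) *: 'X).

Lemma numer_cons a R b : numer (a :: R) b = numer R b - 'X * numer R (b - a).
Proof.
rewrite /numer mulr_sumr -sumrB; apply: eq_bigr => s _.
rewrite mulr_sumr -sumrB; apply: eq_bigr => e _.
rewrite big_cons (raddfB (act s e)) (gexpD (act s e b)).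
exact: sub_linear_factor.
Qed.

Lemma numer_nil b : numer [::] b = (wsum b)%:P.
Proof.
rewrite /numer /wsum rmorph_sum; apply: eq_bigr => s _.
by rewrite rmorph_sum; apply: eq_bigr => e _; rewrite big_nil mulr1.
Qed.

Definition sign_vec e : V := \row_i (-1) ^+ e i.

(* [b] minus the sum of any subset of [R] stays in the cross-polytope through
   [rho]. *)
Definition straightenable R b := forall e,
  dot b (sign_vec e) + \sum_(a <- R) Num.max 0 (- dot a (sign_vec e)) <= \sum_i rho 0 i.

Lemma straightenable_tail a R b : straightenable (a :: R) b -> straightenable R b.
Proof.
move=> H e; apply: le_trans (H e); rewrite big_cons lerD2l lerDr.
by rewrite le_max lexx.
Qed.

Lemma straightenable_shift a R b : straightenable (a :: R) b -> straightenable R (b - a).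
Proof.
move=> H e; apply: le_trans (H e); rewrite big_cons dotDl dotNl -addrA lerD2l lerD2r.
by rewrite le_max lexx orbT.
Qed.

(** Multiplying out a root a replaces b by b or b - a. Both stay in the lattice and in the
    cross-polytope, so the recursion ends at integer multiples of the Weyl denominator. *)
Lemma numer_straighten (R : seq V) b :
    (forall a i, a \in R -> exists z : int, a 0 i = z%:~R) ->
    in_rho_lattice t b -> straightenable R b ->
  exists C : {poly int}, numer R b = (wsum rho)%:P * map_poly intr C.
Proof.
elim: R b => [|a R IH] b R_int b_lat b_st.
  have [|z zE] := wsum_straighten b_lat.
    (* Pairing b with the vector of its own signs gives its l1-norm. *)
    apply: le_trans (b_st [ffun i => b 0 i < 0]); rewrite big_nil addr0.
    apply: ler_sum => i _; rewrite !mxE ffunE.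
    have [lt0|ge0] := ltrP (b 0 i) 0; first by rewrite mulrN1 ltr0_norm.
    by rewrite mulr1 ger0_norm.
  exists z%:P; rewrite numer_nil zE map_polyC /= -polyCM.
  by rewrite mulrzr.
have R_int' a' i : a' \in R -> exists z : int, a' 0 i = z%:~R.
  by move=> a'R; apply: R_int; rewrite inE a'R orbT.
have [C CE] := IH b R_int' b_lat (straightenable_tail b_st).
have [|C' C'E] := IH (b - a) R_int' _ (straightenable_shift b_st).
  move=> i; have [z zE] := b_lat i; have [z' z'E] := R_int a i (mem_head _ _).
  by exists (z - z'); rewrite !mxE zE z'E rmorphB /=; ring.
exists (C - 'X * C'); rewrite numer_cons CE C'E rmorphB rmorphM /= map_polyX; ring.
Qed.

Lemma root_int a i : a \in positive_roots t n -> exists z : int, a 0 i = z%:~R.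
Proof.
have eps_int (j k : 'I_n) : exists z : int, eps j 0 k = z%:~R.
  by exists (k == j : nat)%:Z; rewrite mxE eqxx.
rewrite /positive_roots !mem_cat => /or3P[/mapP[[j k] _ ->]|/mapP[[j k] _ ->]|].
- have [z zE] := eps_int j i; have [z' z'E] := eps_int k i.
  by exists (z - z'); rewrite [LHS]mxE [X in _ + X]mxE zE z'E rmorphB.
- have [z zE] := eps_int j i; have [z' z'E] := eps_int k i.
  by exists (z + z'); rewrite [LHS]mxE zE z'E rmorphD.
case: (t) => // /mapP[j _ ->]; have [z zE] := eps_int j i; first by exists z.
by exists (2 * z); rewrite [LHS]mxE zE rmorphM.
Qed.

Lemma rho_in_lattice : in_rho_lattice t rho.
Proof. by move=> i; exists (n - i.+1)%N%:Z; rewrite rhoE. Qed.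

(** As rho is half the sum of the roots, the left side is half the sum of the |a . v|. Since |v_i -
    v_j| + |v_i + v_j| = 2 whatever the signs, v may be replaced by the all-ones vector, which gives
    the right side: equality holds. *)
Lemma straightenable_rho : straightenable (positive_roots t n) rho.
Proof.
move=> e; set v := sign_vec e.
have dot_rho u : dot rho u = 2^-1 * \sum_(a <- positive_roots t n) dot a u.
  rewrite dotZl; congr (_ * _); elim: (positive_roots t n) => [|a R IH].
    by rewrite !big_nil /dot big1 // => i _; rewrite mxE mul0r.
  by rewrite !big_cons dotDl IH.
pose one_vec : V := const_mx 1.
have -> : \sum_i rho 0 i = dot rho one_vec.
  by apply: eq_bigr => i _; rewrite [X in _ * X]mxE mulr1.
have two_max a : 2 * Num.max 0 (- dot a v) = `|dot a v| - dot a v.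
  by case: ltrP => h; [rewrite ltr0_norm | rewrite ger0_norm]; lra.
have abs_sum : \sum_(a <- positive_roots t n) `|dot a v| = \sum_(a <- positive_roots t n) dot a one_vec.
  rewrite (big_roots _ _ (fun a : V => `|dot a v|)) (big_roots _ _ (fun a : V => dot a one_vec)) /=.
  congr (_ + _).
    apply: eq_bigr => p _; rewrite !(dotDl, dotNl, dot_eps) !mxE.
    by case: (e p.1); case: (e p.2).
  case: (t); last by [].
    by apply: eq_bigr => i _; rewrite !dot_eps !mxE; case: (e i).
  by apply: eq_bigr => i _; rewrite !dotZl !dot_eps !mxE; case: (e i).
have maxE : \sum_(a <- positive_roots t n) Num.max 0 (- dot a v)
    = 2^-1 * (\sum_(a <- positive_roots t n) `|dot a v| - \sum_(a <- positive_roots t n) dot a v).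
  rewrite -sumrB mulr_sumr; apply: eq_bigr => a _; rewrite -two_max; lra.
rewrite maxE !dot_rho abs_sum; lra.
Qed.

Lemma numer_rho : exists C : {poly int},
  numer (positive_roots t n) rho = (wsum rho)%:P * map_poly intr C.
Proof.
apply: numer_straighten rho_in_lattice straightenable_rho.
by move=> a i; exact: root_int.
Qed.

End Numerator.

(** * Generating series of Lusztig's q-analogues *)

(** [h] maps a pair by the permutation and puts it back in increasing order; [h s] and [h s^-1] are
    inverse bijections. *)
Lemma perm_pairs (A : comNzRingType) n (s : 'S_n) (psi : 'I_n -> 'I_n -> A) :
    (forall i j, psi i j = psi j i) ->
  \prod_(p : 'I_n * 'I_n | (p.1 < p.2)%N) psi (s p.1) (s p.2)
  = \prod_(p : 'I_n * 'I_n | (p.1 < p.2)%N) psi p.1 p.2.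
Proof.
move=> psiC.
pose srt (p : 'I_n * 'I_n) := if (p.1 < p.2)%N then p else (p.2, p.1).
pose h (u : 'S_n) p := srt (u p.1, u p.2).
have hK (u : 'S_n) (p : 'I_n * 'I_n) : (p.1 < p.2)%N -> h (u^-1)%g (h u p) = p.
  case: p => i j /= lt_ij; rewrite /h /srt /=.
  by case: (u i < u j)%N => /=; rewrite !permK ?lt_ij // ltnNge ltnW.
have h_lt (u : 'S_n) (p : 'I_n * 'I_n) : (p.1 < p.2)%N -> ((h u p).1 < (h u p).2)%N.
  case: p => i j /= lt_ij; rewrite /h /srt /=.
  have [//|//|/val_inj /perm_inj E] := ltngtP (u i) (u j).
  by rewrite E ltnn in lt_ij.
rewrite [RHS](reindex_onto (h s) (h s^-1)%g) /=; last first.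
  by move=> p lt_p; have := hK (s^-1)%g _ lt_p; rewrite invgK.
apply: eq_big => [[i j] /=|[i j] /= lt_ij]; last by rewrite /h /srt; case: ifP.
apply/idP/andP => [lt_ij|[lt_h /eqP E]]; last by have := h_lt (s^-1)%g _ lt_h; rewrite E.
by rewrite h_lt // hK.
Qed.

Section WeylDenominator.
Variables (t : lie_type) (n : nat).
Local Notation V := ('rV[rat]_n).
Local Notation rho := (rho t n).
Variables (A : comNzRingType) (X : V -> A).
Local Notation geo v := (geometric (X v) : ser A).
Implicit Types (s : 'S_n) (e : {ffun 'I_n -> bool}) (b v : V).

Definition geo2 v : ser A := geo v * geo (- v).

Lemma geo2N v : geo2 (- v) = geo2 v.
Proof. by rewrite /geo2 opprK mulrC. Qed.

Lemma geo2_sign (c : bool) v : geo2 ((-1) ^+ c *: v) = geo2 v.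
Proof. by case: c; rewrite ?scaleN1r ?scale1r // geo2N. Qed.

Definition root_ser : ser A := \prod_(a <- positive_roots t n) geo2 a.

(** Groups the vectors +-v +-v', a set stable under changing the signs of v and v'. *)
Definition geo4 v v' : ser A := geo2 (v - v') * geo2 (v + v').

Lemma geo4_sign (c c' : bool) v v' : geo4 ((-1) ^+ c *: v) ((-1) ^+ c' *: v') = geo4 v v'.
Proof.
have geo4Nl u u' : geo4 (- u) u' = geo4 u u'.
  by rewrite /geo4 -opprD geo2N (addrC (- u)) -(opprB u u') geo2N mulrC.
have geo4Nr u u' : geo4 u (- u') = geo4 u u' by rewrite /geo4 opprK mulrC.
by case: c; case: c'; rewrite ?expr1 ?expr0 ?scaleN1r ?scale1r ?geo4Nl ?geo4Nr.
Qed.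

Lemma root_ser_act s e : \prod_(a <- positive_roots t n) geo2 (act s e a) = root_ser.
Proof.
rewrite /root_ser (big_roots _ _ (fun a => geo2 (act s e a))) (big_roots _ _ geo2) /=.
congr (_ * _).
  rewrite -/(geo4 _ _) -(perm_pairs s (psi := fun i j => geo4 (eps i) (eps j))); last first.
    by move=> i j; rewrite /geo4 -(opprB (eps j)) geo2N (addrC (eps j) (eps i)).
  apply: eq_bigr => p _; rewrite raddfB raddfD /= !act_eps.
  exact: geo4_sign.
have one c : \prod_i geo2 (act s e (c *: eps i)) = \prod_(i < n) geo2 (c *: eps i).
  rewrite [RHS](reindex_inj (@perm_inj _ s)); apply: eq_bigr => i _.
  by rewrite actZ act_eps scalerA mulrC -scalerA geo2_sign.
by case: (t); rewrite ?one //; have := one 1; under eq_bigr do rewrite scale1r;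
  under [in RHS]eq_bigr do rewrite scale1r.
Qed.

Definition weyl_ser : ser A :=
  \sum_(s : 'S_n) \sum_(e | ok_sign t e)
    pser ((-1) ^+ sgp_sign s e * X (act s e rho))%:P
      * \prod_(a <- positive_roots t n) geo (act s e a).

Lemma weyl_ser_numer : weyl_ser =
  pser (\sum_(s : 'S_n) \sum_(e | ok_sign t e) ((-1) ^+ sgp_sign s e * X (act s e rho))%:P
          * \prod_(a <- positive_roots t n) (1 - X (- act s e a) *: 'X)) * root_ser.
Proof.
rewrite rmorph_sum mulr_suml; apply: eq_bigr => s _.
rewrite rmorph_sum mulr_suml; apply: eq_bigr => e _.
rewrite (rmorphM (@pser A)) -mulrA -(root_ser_act s e) rmorph_prod; congr (_ * _).
rewrite -big_split /=; apply: eq_bigr => a _.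
by rewrite /geo2 mulrC -mulrA geometricK mulr1.
Qed.

Lemma kostant_act s e (R : seq V) k b :
  kostant (map (act s e) R) k (act s e b) = kostant R k b.
Proof.
elim: R k b => [|a R IH] k b /=.
  by rewrite (raddf_eq0 _ (can_inj (act_inv s e))).
by apply: eq_bigr => j _; rewrite -raddfMn -raddfB IH.
Qed.

End WeylDenominator.

(** After replacing w by its inverse, which has the same sign, w is applied to both the roots and
    the argument of Kostant's function: w^-1 (la + rho) - rho becomes la + rho - w rho. *)
Lemma lusztig_weyl_ser t n (la : part) k : (1 < n)%N ->
  lusztig_coef t n la empty_part k
  = gcoef (part_weight n la + rho t n) (weyl_ser t (@gexp 'rV[rat]_n) k).
Proof.
move=> n_gt1; rewrite lusztig_sum // /weyl_ser ser_sum raddf_sum /=.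
rewrite (reindex_inj (h := fun s : 'S_n => (s^-1)%g)) /=; last exact: invg_inj.
apply: eq_bigr => s _.
rewrite ser_sum raddf_sum /= (reindex_inj (h := einv s)); last first.
  by move=> e e' /ffunP E; apply/ffunP => i; have := E (s i); rewrite !ffunE permK.
apply: eq_big => [e|e _]; first by rewrite /ok_sign eparity_inv.
rewrite sgp_sign_inv coef_pserC -mulrA; set b := _ + rho _ _.
rewrite -(kostant_act s e) (raddfB (act s e)) /= act_invK kostant_coef big_map.
rewrite -gcoef_expM.
by case: (sgp_sign s e); rewrite ?expr1 ?expr0 ?mul1r // !mulN1r raddfN.
Qed.

Lemma prod_square (A : comNzRingType) n (F : 'I_n -> 'I_n -> A) :
  \prod_i \prod_j F i j
  = \prod_i F i i * \prod_(p : 'I_n * 'I_n | (p.1 < p.2)%N) (F p.1 p.2 * F p.2 p.1).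
Proof.
rewrite big_split /= -!(pair_big_dep xpredT (fun i j : 'I_n => (i < j)%N)
  (fun i j => F i j)) /=.
rewrite -(pair_big_dep xpredT (fun i j : 'I_n => (i < j)%N) (fun i j => F j i)) /=.
rewrite [X in _ * (_ * X)](exchange_big_dep xpredT) //= -!big_split /=.
apply: eq_bigr => i _; rewrite (bigD1 i) //=; congr (_ * _).
rewrite (bigID (fun j : 'I_n => (i < j)%N)) /=; congr (_ * _).
  by apply: eq_bigl => j; rewrite -val_eqE /=; lia.
by apply: eq_bigl => j; rewrite -val_eqE /=; lia.
Qed.

Section PairSeries.
Variable (A : comNzRingType).
Local Notation geo a := (geometric a : ser A).

Lemma pair_serE (b : bool) n (p : 'I_n -> A) : pair_ser b p =
  (if b then \prod_i geo (p i * p i) else 1)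
  * \prod_(ij : 'I_n * 'I_n | (ij.1 < ij.2)%N) geo (p ij.1 * p ij.2).
Proof.
rewrite -(pair_big_dep xpredT (fun i j : 'I_n => (i < j)%N) (fun i j => geo (p i * p j))) /=.
case: b; last by rewrite mul1r.
rewrite -big_split; apply: eq_bigr => i _; rewrite (bigD1 i) //=; congr (_ * _).
by apply: eq_bigl => j; rewrite -val_eqE /=; lia.
Qed.

Lemma pair_ser_split (b : bool) m r (p : 'I_(m + r) -> A) : pair_ser b p =
  pair_ser b (fun i => p (lshift r i)) * pair_ser b (fun j => p (rshift m j))
  * \prod_(i < m) \prod_(j < r) geo (p (lshift r i) * p (rshift m j)).
Proof.
rewrite /pair_ser big_split_ord /= [RHS]mulrAC -big_split /=; congr (_ * _).
  apply: eq_bigr => i _; rewrite big_split_ord /=; congr (_ * _).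
  by apply: eq_bigl => j; have := ltn_ord i; case: b; lia.
apply: eq_bigr => i _; rewrite big_split_ord /= big1 ?mul1r => [|j].
  by apply: eq_bigl => j; case: b; lia.
by have := ltn_ord j; case: b; lia.
Qed.

Lemma pair_ser1 (b : bool) (p : 'I_1 -> A) : pair_ser b p = if b then geo (p 0 * p 0) else 1.
Proof. by rewrite pair_serE big_ord1 [X in _ * X]big1 ?mulr1 // => -[i j]; rewrite !ord1. Qed.

End PairSeries.

(** n + corank is the dimension of the vector representation, 2n + 1 or 2n. *)
Definition corank (t : lie_type) n : nat := if t is so_odd then n.+1 else n.

Section Weights.
Variables (t : lie_type) (n : nat).
Local Notation V := ('rV[rat]_n).
Variables (A : comNzRingType) (X : V -> A).
Hypotheses (X0 : X 0 = 1) (XD : {morph X : u v / u + v >-> u * v}).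
Local Notation geo v := (geometric v : ser A).

Definition is_sp : bool := if t is sp then true else false.

(** For so_odd the first entry is the zero weight. *)
Definition neg_weight : 'I_(corank t n) -> A :=
  match t return 'I_(corank t n) -> A with
  | so_odd => fun j : 'I_(1 + n) => if split j is inr i then X (- eps i) else 1
  | _ => fun i => X (- eps i)
  end.

(* The exponentials of the weights of the vector representation. *)
Definition weight (j : 'I_(n + corank t n)) : A :=
  match split j with inl i => X (eps i) | inr i => neg_weight i end.

Lemma weight_l i : weight (lshift _ i) = X (eps i).
Proof. by rewrite /weight (unsplitK (inl _ i)). Qed.
Lemma weight_r i : weight (rshift _ i) = neg_weight i.
Proof. by rewrite /weight (unsplitK (inr _ i)). Qed.

(** Products of two weights are the exponentials of the roots and their opposites, together with
    e^(eps_i) e^(-eps_i) = 1 for each i, whence n factors 1 / (1 - q). The short roots of so_odd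
    come from the zero weight, the long ones of sp from the squares. *)
Lemma pair_ser_weight : pair_ser is_sp weight = geo 1 ^+ n * root_ser t X.
Proof.
have XK v : X v * X (- v) = 1 by rewrite -XD subrr.
have plain (b : bool) :
    pair_ser b (fun i => X (eps i)) * pair_ser b (fun i => X (- eps i))
      * \prod_(i < n) \prod_(j < n) geo (X (eps i) * X (- eps j))
    = geo 1 ^+ n * ((\prod_(p : 'I_n * 'I_n | (p.1 < p.2)%N)
          (geo2 X (eps p.1 - eps p.2) * geo2 X (eps p.1 + eps p.2)))
      * (if b then \prod_(i < n) geo2 X (2 *: eps i) else 1)).
  rewrite !pair_serE prod_square (eq_bigr _ (fun i _ => congr1 (fun a => geo a) (XK (eps i)))).
  have mulE (c P c' P' g Q : ser A) : c * P * (c' * P') * (g * Q) = g * ((P * P' * Q) * (c * c')) by ring.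
  rewrite prodr_const card_ord mulE -!big_split /=; congr (_ * (_ * _)).
    apply: eq_bigr => p _; rewrite -!XD /geo2 opprB -opprD mulrC [eps p.2 + - eps p.1]addrC.
    by rewrite (addrC (- _)).
  case: b; last by rewrite mul1r.
  rewrite -big_split; apply: eq_bigr => i _ /=.
  by rewrite -!XD /geo2 scaler_nat mulr2n opprD.
rewrite pair_ser_split /root_ser big_roots /=.
rewrite (_ : (fun i => weight (lshift _ i)) = fun i => X (eps i)); last by apply: funext => i; exact: weight_l.
rewrite (_ : (fun i => weight (rshift _ i)) = neg_weight); last by apply: funext => i; exact: weight_r.
rewrite [X in _ * X = _](eq_bigr (fun i => \prod_j geo (X (eps i) * neg_weight j))); last first.
  by move=> i _; apply: eq_bigr => j _; rewrite weight_l weight_r.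
rewrite /is_sp /neg_weight; case: (t) => /=; last 2 first.
- by rewrite -(plain true).
- by rewrite big1_eq -(plain false).
set q := fun j : 'I_(1 + n) => _.
have q0 i : q (lshift _ i) = 1 by rewrite /q (unsplitK (inl _ i)).
have q1 i : q (rshift _ i) = X (- eps i) by rewrite /q (unsplitK (inr _ i)).
rewrite (pair_ser_split _ q) pair_ser1 mul1r big_ord1.
rewrite (_ : (fun i => q (rshift _ i)) = fun i => X (- eps i)); last by apply: funext => i; exact: q1.
rewrite [X in _ * (_ * X) * _](eq_bigr (fun j => geo (X (- eps j)))) => [|j _]; last by rewrite q0 q1 mul1r.
rewrite [X in _ * X = _](eq_bigr (fun i => geo (X (eps i)) * \prod_(j < n) geo (X (eps i) * X (- eps j)))); last first.
  move=> i _; rewrite -[LHS]/(\prod_(j < 1 + n) geo (X (eps i) * q j)).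
  rewrite big_split_ord big_ord1 q0 mulr1; congr (_ * _).
  by apply: eq_bigr => j _; rewrite q1.
rewrite big_split /=.
have := plain false; rewrite !mulr1 => E.
rewrite [RHS]mulrA -E big_split /=; ring.
Qed.

End Weights.

Lemma integral_factor (A : comNzRingType) (w : A) (C : {poly int}) (R : ser A) m :
  exists D : ser int, forall k, (pser (w%:P * map_poly intr C) * R) k
    = \sum_(i < k.+1) (w * ((geometric 1 : ser A) ^+ m * R) (k - i)%N) *~ D i.
Proof.
exists (pser (C * (1 - 'X) ^+ m)) => k.
have -> : pser (w%:P * map_poly intr C) * R = pser w%:P *
    (mapser intr (pser (C * (1 - 'X) ^+ m)) * ((geometric 1 : ser A) ^+ m * R)).
  have gK : (1 - pser 'X) * (geometric 1 : ser A) = 1.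
    rewrite -(rmorph1 (@pser A)) -rmorphB rmorph1 mulrC.
    by have := geometricK (1 : A); rewrite scale1r.
  rewrite mapser_pser !rmorphM !rmorphXn rmorphB rmorph1 /= map_polyX rmorphB rmorph1 -!mulrA; congr (_ * (_ * _)).
  by rewrite mulrA -exprMn gK expr1n mul1r.
rewrite coef_pserC serE mulr_sumr; apply: eq_bigr => i _.
by rewrite mulrCA -mulrzl.
Qed.

Lemma lusztig_factor t n : (1 < n)%N -> exists D : ser int, forall la k,
  lusztig_coef t n la empty_part k = \sum_(i < k.+1) D i *
    gcoef (part_weight n la + rho t n)
      (wsum t (rho t n) * pair_ser (is_sp t) (weight (t := t) (@gexp 'rV[rat]_n)) (k - i)%N).
Proof.
move=> n_gt1; have [C CE] := numer_rho t n.
have [D DE] := integral_factor (wsum t (rho t n)) C (root_ser t (@gexp 'rV[rat]_n)) n.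
exists D => la k; rewrite lusztig_weyl_ser // weyl_ser_numer.
rewrite (pair_ser_weight t (gexp0 _) (@gexpD _)).
rewrite -/(numer t (positive_roots t n) (rho t n)) CE DE raddf_sum.
by apply: eq_bigr => i _; rewrite raddfMz -mulrzl intz.
Qed.

(** * Bialternants of the classical groups *)

Section RowFunctions.
Variable (A : comNzRingType).
Local Notation geo a := (geometric a : ser A).
Local Notation cst a := (pser (a : A)%:P).
Local Notation q := (pser ('X : {poly A})).

Lemma geoK (a : A) : geo a * (1 - cst a * q) = 1.
Proof. by rewrite -rmorphM /= mul_polyC -(rmorph1 (@pser A)) -rmorphB geometricK rmorph1. Qed.

Variables (x y : A).
Hypothesis xy : x * y = 1.
Let cxy : cst x * cst y = 1.
Proof. by rewrite -rmorphM /= -polyCM xy rmorph1. Qed.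

(** The generating series of x^(m+1) - y^(m+1), the row entries of sp. *)
Lemma geo_sub : cst x * geo x - cst y * geo y = cst (x - y) * (geo x * geo y).
Proof.
have Ex := geoK x; have Ey := geoK y; rewrite polyCB rmorphB.
transitivity (cst x * geo x * (geo y * (1 - cst y * q)) - cst y * geo y * (geo x * (1 - cst x * q))).
  by rewrite Ex Ey !mulr1.
by ring.
Qed.

(** The generating series of x^m + y^m, with constant term 1 instead of 2: the row entries of
    so_even. *)
Lemma geo_add : geo x + geo y - 1 = (1 - q ^+ 2) * (geo x * geo y).
Proof.
have Ex := geoK x; have Ey := geoK y.
transitivity (geo x * (geo y * (1 - cst y * q)) + geo y * (geo x * (1 - cst x * q))
    - (geo x * (1 - cst x * q)) * (geo y * (1 - cst y * q))); first by rewrite Ex Ey !mulr1.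
transitivity ((1 - cst x * cst y * q ^+ 2) * (geo x * geo y)); first by ring.
by rewrite cxy mul1r.
Qed.

(** The generating series of x^(2m+1) - y^(2m+1), for so_odd with x the exponential of eps_j / 2. *)
Lemma geo_half : cst x * geo (x ^+ 2) - cst y * geo (y ^+ 2)
  = cst (x - y) * (1 + q) * (geo (x ^+ 2) * geo (y ^+ 2)).
Proof.
have Ex := geoK (x ^+ 2); have Ey := geoK (y ^+ 2); rewrite polyCB rmorphB.
transitivity (cst x * geo (x ^+ 2) * (geo (y ^+ 2) * (1 - cst (y ^+ 2) * q))
    - cst y * geo (y ^+ 2) * (geo (x ^+ 2) * (1 - cst (x ^+ 2) * q))).
  by rewrite Ex Ey !mulr1.
have x2y : cst (x ^+ 2) * cst y = cst x by rewrite !rmorphXn -mulrA cxy mulr1.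
have y2x : cst (y ^+ 2) * cst x = cst y by rewrite !rmorphXn -mulrA (mulrC (cst y) (cst x)) cxy mulr1.
transitivity ((cst x - (cst (y ^+ 2) * cst x) * q - cst y + (cst (x ^+ 2) * cst y) * q)
  * (geo (x ^+ 2) * geo (y ^+ 2))); first by ring.
by rewrite x2y y2x; ring.
Qed.

Lemma quadratic_factor : 1 + 'X^2 - (x + y)%:P * 'X = (1 - x *: 'X) * (1 - y *: 'X).
Proof.
rewrite -!mul_polyC polyCD.
transitivity (1 + (x * y)%:P * 'X^2 - (x%:P + y%:P) * 'X); first by rewrite xy mul1r.
by rewrite polyCM; ring.
Qed.

End RowFunctions.

Section Bialternant.
Variables (t : lie_type) (n : nat).
Local Notation V := ('rV[rat]_n).
Variables (A : comNzRingType) (X : V -> A).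
Hypotheses (X0 : X 0 = 1) (XD : {morph X : u v / u + v >-> u * v}).
Local Notation geo a := (geometric a : ser A).

Let XK v : X v * X (- v) = 1.
Proof. by rewrite -XD subrr. Qed.

Let XMn v k : X (v *+ k) = X v ^+ k.
Proof. by elim: k => [|k IH]; rewrite ?mulr0n // mulrS exprS XD IH. Qed.

(** In type D the entry at m = 0 is 1 and not 1 + 1. *)
Definition neg_coef (m : nat) : A := if t is so_even then (m != 0%N)%:R else -1.

Definition row_coef (j : 'I_n) (m : nat) : A :=
  X ((m%:R + rho_shift t) *: eps j) + neg_coef m * X (- ((m%:R + rho_shift t) *: eps j)).

Definition row_factor (j : 'I_n) : A :=
  match t with
  | so_odd => X (2^-1 *: eps j) - X (- (2^-1 *: eps j))
  | sp => X (eps j) - X (- eps j)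
  | so_even => 1
  end.

Lemma hser_weight : hser (weight (t := t) X)
  = (if t is so_odd then geo 1 else 1) * \prod_i (geo (X (eps i)) * geo (X (- eps i))).
Proof.
rewrite /hser big_split_ord /= (eq_bigr (fun i => geo (X (eps i)))); last first.
  by move=> i _; rewrite weight_l.
rewrite [X in _ * X](eq_bigr (fun i => geo (neg_weight X i))); last first.
  by move=> i _; rewrite weight_r.
rewrite big_split /= mulrCA; congr (_ * _).
rewrite /neg_weight; case: (t) => /=; rewrite ?mul1r //.
rewrite -[LHS]/(\prod_(j < 1 + n) geo (if split j is inr i then X (- eps i) else 1)).
rewrite big_split_ord big_ord1 (unsplitK (inl _ ord0)); congr (_ * _).
by apply: eq_bigr => i _; rewrite (unsplitK (inr _ i)).
Qed.

(** The series of column j has denominator (1 - x_j q)(1 - q / x_j). Completing it to that of [hser]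
    leaves the quadratic factors of the other k, the form [jacobi_trudi] expects. In type B the zero
    weight gives 1 / (1 - q), which turns the twist 1 - q^2 into the numerator 1 + q. *)
Lemma row_serE j : (row_coef j : ser A) = pser (row_factor j)%:P * (hser (weight (t := t) X) *
  pser (twist A (~~ is_sp t) * \prod_(k < n | k != j)
    (1 + 'X^2 - (X (eps k) + X (- eps k))%:P * 'X))).
Proof.
rewrite hser_weight (bigD1 j) //= rmorphM rmorph_prod.
have cancel_k k : (geo (X (eps k)) * geo (X (- eps k))) *
    pser (1 + 'X^2 - (X (eps k) + X (- eps k))%:P * 'X) = 1.
  rewrite quadratic_factor // rmorphM mulrACA (geometricK (X (eps k))) mul1r.
  exact: geometricK.
set P := \prod_(i < n | i != j) (geo _ * geo _); set Q := \prod_(i < n | i != j) pser _.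
have PQ : P * Q = 1 by rewrite -big_split big1 // => k _; exact: cancel_k.
set a := geo (X (eps j)); set b := geo (X (- eps j)); set c := (if t is so_odd then _ else _).
have -> : c * (a * b * P) * (pser (twist A (~~ is_sp t)) * Q)
    = c * pser (twist A (~~ is_sp t)) * (a * b) * (P * Q) by ring.
rewrite PQ mulr1 /c /a /b; apply: funext => m.
have Xm (h : rat) : X ((m%:R + h) *: eps j) = X (h *: eps j) * X (eps j) ^+ m.
  by rewrite scalerDl XD mulrC -XMn scaler_nat.
have XNm (h : rat) : X (- ((m%:R + h) *: eps j)) = X (- (h *: eps j)) * X (- eps j) ^+ m.
  by rewrite scalerDl opprD XD mulrC -XMn scaler_nat mulNrn.
rewrite /row_coef /row_factor /neg_coef /is_sp /twist Xm XNm /rho_shift; case: (t) => /=.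
- have half2 : X (2^-1 *: eps j) ^+ 2 = X (eps j).
    by rewrite -XMn -scaler_nat scalerA mulfV // scale1r.
  have Nhalf2 : X (- (2^-1 *: eps j)) ^+ 2 = X (- eps j).
    by rewrite -XMn mulNrn -scaler_nat scalerA mulfV // scale1r.
  have := geo_half (XK (2^-1 *: eps j)); rewrite half2 Nhalf2 => E.
  have -> : geo 1 * pser (1 - 'X^2) = 1 + pser 'X.
    have := geoK (1 : A); rewrite rmorph1 mul1r => geo1.
    rewrite rmorphB rmorphXn rmorph1; set z := pser 'X.
    transitivity (geo 1 * (1 - z) * (1 + z)); first by ring.
    by rewrite geo1 mul1r.
  by rewrite (mulrA (pser _)) -E -[RHS]/(_ - _) !coef_pserC mulN1r.
- have := geo_sub (X (eps j)) (X (- eps j)); rewrite rmorph1 !mul1r => <-.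
  by rewrite -[RHS]/(_ - _) !coef_pserC mulN1r scale1r.
- rewrite mul1r rmorph1 mul1r rmorphB rmorph1 rmorphXn -(geo_add (XK (eps j))).
  rewrite scale0r oppr0 X0 !mul1r -[RHS]/(_ + _ - ser1 m) /ser1 /geometric.
  by case: m {Xm XNm} => [|m]; rewrite ?mul0r ?mul1r ?subr0 //= !expr0; ring.
Qed.

Lemma row_jacobi_trudi (l : nat -> nat) :
  \det (\matrix_(i < n, j < n) row_coef j (l i + (n - i.+1))%N) =
    \det (\matrix_(i < n, j < n) row_coef j (n - i.+1)%N) *
      jt n (hser (weight (t := t) X)) (twist A (~~ is_sp t)) (1 + 'X^2) l.
Proof.
apply: (jacobi_trudi _ _ _ _ row_serE).
- exact: hser0.
- by rewrite /twist; case: ifP => _; rewrite ?coefB ?coef1 // coefXn subr0.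
- by rewrite coefD coef1 coefXn addr0.
Qed.

End Bialternant.

Section RowDeterminant.
Variables (t : lie_type) (n : nat).
Local Notation V := ('rV[rat]_n).
Implicit Types (s : 'S_n) (e : {ffun 'I_n -> bool}) (l : nat -> nat).

Definition shifted_weight l : V := \row_(i < n) ((l i + (n - i.+1))%:R + rho_shift t).

(* In type D a zero coordinate counts only one of its two signs. *)
Definition free_sign l e : bool :=
  if t is so_even then [forall i : 'I_n, e i ==> (l i + (n - i.+1) != 0)%N] else true.
Definition row_sign s e : bool :=
  if t is so_even then odd_perm s else sgp_sign s e.

Section Generic.
Variables (A : comNzRingType) (X : V -> A).
Hypotheses (X0 : X 0 = 1) (XD : {morph X : u v / u + v >-> u * v}).

(** Leibniz expansion, where [e] records which of its two exponentials is taken from each entry. *)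
Lemma row_det l :
  \det (\matrix_(i < n, j < n) row_coef t X j (l i + (n - i.+1))%N)
  = \sum_(s : 'S_n) \sum_(e | free_sign l e)
      (-1) ^+ row_sign s e * X (act s e (shifted_weight l)).
Proof.
apply: eq_bigr => s _; set f := fun i : 'I_n => (l i + (n - i.+1))%N.
pose F (i : 'I_n) (c : bool) : A := (if c then neg_coef t A (f i) else 1)
  * X (((-1) ^+ c * shifted_weight l 0 i) *: eps (s i)).
transitivity ((-1) ^+ s * \prod_i \sum_c F i c).
  congr (_ * _); apply: eq_bigr => i _; rewrite mxE big_bool /F /row_coef /= !mxE addrC.
  by rewrite expr1 expr0 mulN1r scaleNr !mul1r.
rewrite bigA_distr_bigA mulr_sumr [RHS]big_mkcond; apply: eq_bigr => e _ /=.
rewrite big_split /= -(big_morph X XD X0) -/(act s e _) mulrA.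
have -> : \prod_i (if e i then neg_coef t A (f i) else 1)
    = if t is so_even then (free_sign l e)%:R else (-1) ^+ eparity e.
  rewrite /neg_coef /free_sign /eparity.
  have sgn : \prod_i (if e i then -1 else 1 : A) = (-1) ^+ (\big[addb/false]_i e i).
    rewrite (big_morph (id1 := 1) (op1 := *%R) (fun c : bool => (-1) ^+ c : A)) //; last exact: signr_addb.
    by apply: eq_bigr => i _; case: (e i).
  case: (t) => //; case: forallP => [H|/forallP].
    by rewrite big1 // => i _; have := H i; case: (e i) => //= ->.
  move=> /forallPn[i]; rewrite negb_imply => /andP[ei fi].
  by rewrite (bigD1 i) //= ei (negPf fi) mul0r.
rewrite /row_sign /free_sign /sgp_sign; case: (t) => //; rewrite ?signr_addb //.
by case: ifP; rewrite ?mulr1 // mulr0 mul0r.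
Qed.

End Generic.

Lemma act_eq_sign s e e' (b : V) : (forall i, e i != e' i -> b 0 i = 0) ->
  act s e b = act s e' b.
Proof.
move=> H; apply: eq_bigr => i _; have := H i.
by case: (e i); case: (e' i) => //= -> //; rewrite !mulr0.
Qed.

Lemma shifted_weight_part (la : part) :
  shifted_weight (nth 0%N la) = part_weight n la + rho t n.
Proof. by apply/rowP => i; rewrite part_rhoE mxE. Qed.

Lemma shifted_weight0 : shifted_weight (fun=> 0%N) = rho t n.
Proof. by apply/rowP => i; rewrite rhoE mxE add0n. Qed.

(** Flipping the sign at i matches the even vectors with a sign there and the odd ones without. *)
Lemma sum_even_sign (W : nmodType) (F : {ffun 'I_n -> bool} -> W) (i : 'I_n) :
    (forall e, F (emul 1 (eone i) e) = F e) ->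
  \sum_(e : {ffun 'I_n -> bool} | ~~ eparity e) F e = \sum_(e : {ffun 'I_n -> bool} | ~~ e i) F e.
Proof.
move=> F_flip; rewrite (bigID (fun e : {ffun 'I_n -> bool} => e i)) [RHS](bigID (@eparity n)) /=.
congr (_ + _); last by apply: eq_bigl => e; rewrite andbC.
rewrite (reindex_inj (@emul_inj n 1 (eone i))); apply: eq_big => e; last by rewrite F_flip.
by rewrite eparityM eparity_one negbK ffunE perm1 ffunE eqxx andbC.
Qed.

Lemma free_sign_last e (last : 'I_n) : last.+1 = n ->
  [forall i : 'I_n, e i ==> (0 + (n - i.+1) != 0)%N] = ~~ e last.
Proof.
move=> lastE; apply/forallP/idP => [/(_ last)|e_last i].
  by rewrite add0n lastE subnn implybF.
apply/implyP => ei; have ne_i : i != last by apply: contraNneq e_last => <-.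
by move: ne_i (ltn_ord i); rewrite -val_eqE /= => /eqP; lia.
Qed.

(** In type D the last coordinate of rho is 0, so the even sign vectors can be traded for those
    without a sign in the last place. *)
Lemma wsum_rho : (0 < n)%N -> wsum t (rho t n) =
  \det (\matrix_(i < n, j < n) row_coef t (@gexp V) j (n - i.+1)%N).
Proof.
move=> n_gt0; have := row_det (gexp0 _) (@gexpD V) (fun=> 0%N); rewrite shifted_weight0.
rewrite /wsum => ->; apply: eq_bigr => s _.
have lt_last : (n.-1 < n)%N by lia.
pose last := Ordinal lt_last; have lastE : last.+1 = n by exact: prednK.
rewrite /ok_sign /free_sign /row_sign.
have rho_last : t = so_even -> rho t n 0 last = 0.
  by rewrite rhoE lastE subnn => ->; rewrite addr0.
move: (rho t n) rho_last => r; case: (t) => r_last; [exact: erefl | exact: erefl |].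
pose F e : gring V := (-1) ^+ odd_perm s * gexp (act s e r).
transitivity (\sum_(e : {ffun 'I_n -> bool} | ~~ eparity e) F e).
  by apply: eq_bigr => e /negPf e_even; rewrite /sgp_sign e_even addbF.
rewrite (sum_even_sign (i := last)); last first.
  move=> e; congr (_ * gexp _); apply: act_eq_sign => i; rewrite !ffunE perm1.
  by case: (eqVneq i last) => [-> _|_]; [exact: r_last | rewrite eqxx].
by apply: eq_bigl => e; rewrite (free_sign_last _ lastE).
Qed.

(** Both weights are strictly dominant, so only the identity can carry one to the other. In type D
    the determinant of a partition with n parts also has terms with an odd number of signs, but
    these have a negative coordinate. *)
Lemma gcoef_row_det (la mu : part) : (size la <= n)%N -> (size mu <= n)%N ->
  gcoef (part_weight n la + rho t n)
    (\det (\matrix_(i < n, j < n) row_coef t (@gexp V) j (nth 0%N mu i + (n - i.+1))%N))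
  = (la == mu)%:R.
Proof.
move=> la_n mu_n; rewrite (row_det (gexp0 _) (@gexpD V)) shifted_weight_part.
set b := _ + _; set b' := _ + _.
have coefE (c : bool) v : gcoef b ((-1) ^+ c * gexp v) = (-1) ^+ c * (v == b)%:R.
  by case: c; rewrite ?expr1 ?expr0 ?mulN1r ?mul1r ?raddfN /= gcoef_exp.
rewrite raddf_sum; under eq_bigr => s _.
  rewrite raddf_sum; under eq_bigr do rewrite /= coefE; over.
have dom : strict_dom b by exact: strict_dom_part.
have dom' : strict_dom b' by exact: strict_dom_part.
have eqb : (b' == b) = (la == mu).
  apply/eqP/eqP => [/rowP E|E]; last by rewrite /b /b' E.
  apply: part_eq => i.
  have [lt_in|le_ni] := ltnP i n; last by rewrite !nth_default // (leq_trans _ le_ni).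
  have := E (Ordinal lt_in); rewrite !part_rhoE => /addIr/eqP; rewrite eqr_nat => /eqP /=.
  by set u := nth _ _ _; set v := nth _ _ _; lia.
have e_eq0 e : free_sign (nth 0%N mu) e -> (forall i, e i -> b' 0 i = 0) -> e = eff0 n.
  move=> free H; apply/ffunP => i; rewrite ffunE; apply/negP => ei; have := H i ei.
  rewrite part_rhoE; move: free; rewrite /free_sign; have ge0 : 0 <= (nth 0%N mu i + (n - i.+1))%:R :> rat by [].
  rewrite /rho_shift; case: (t) => [_ E|_ E|/forallP/(_ i)].
  - by lra.
  - by lra.
  by rewrite ei /= addr0 => ne0 /eqP; rewrite pnatr_eq0 (negPf ne0).
have free0 : free_sign (nth 0%N mu) (eff0 n).
  by rewrite /free_sign; case: (t) => //; apply/forallP => i; rewrite ffunE.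
have act1 v : act 1 (eff0 n) v = v.
  by apply/rowP => i; have := actE 1 (eff0 n) v i; rewrite perm1 ffunE mul1r.
rewrite (bigD1 1%g) //= [X in _ + X]big1 ?addr0 => [|s s1]; last first.
  rewrite big1 // => e _; case: eqP => [E|_]; last by rewrite mulr0.
  by have [s1' _ _] := act_strict_dom dom' dom E; rewrite s1' eqxx in s1.
rewrite (bigD1 (eff0 n)) //= big1 ?addr0 => [|e /andP[free e0]]; last first.
  case: eqP => [E|_]; last by rewrite mulr0.
  by have [_ _ H] := act_strict_dom dom' dom E; rewrite (e_eq0 e free H) eqxx in e0.
rewrite act1 eqb /row_sign /sgp_sign odd_perm1 eparity0.
by case: (t); rewrite mul1r.
Qed.

End RowDeterminant.

(** * Stability *)

Section Stability.
Variables (t : lie_type) (n : nat).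
Hypothesis n_gt1 : (1 < n)%N.
Local Notation V := ('rV[rat]_n).
Local Notation N := (n + corank t n)%N.
Local Notation p := (weight (t := t) (@gexp V)).

(* The multiplicity of the irreducible character of highest weight [la] in
   the image of [f] in the ring of characters. *)
Definition multiplicity (la : part) (f : {mpoly int[N]}) : int :=
  gcoef (part_weight n la + rho t n) (wsum t (rho t n) * spec p f).

Fact multiplicity_is_zmod_morphism la : zmod_morphism (multiplicity la).
Proof. by move=> f g; rewrite /multiplicity rmorphB mulrBr raddfB. Qed.
HB.instance Definition _ la := GRing.isZmodMorphism.Build {mpoly int[N]} int
  (multiplicity la) (multiplicity_is_zmod_morphism la).

Variables (s_gl : part -> symfun) (c : part -> part -> part -> int) (u : part -> symfun).
Hypotheses (hs : schur_functions s_gl) (hc : littlewood_richardson s_gl c).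
Hypothesis hu : universal_characters [set ga : part | even_part (~~ is_sp t) ga]%classic s_gl c u.

(** By Jacobi-Trudi, the Weyl denominator times the character is the determinant of row functions of
    mu. *)
Lemma multiplicity_character (la mu : part) : (size la <= n)%N -> (psize mu <= n)%N ->
  multiplicity la (inN N (u mu)) = (la == mu)%:R.
Proof.
move=> la_n mu_n; rewrite /multiplicity (universal_character_jt hs hc hu) //.
rewrite (wsum_rho t (ltnW n_gt1)) -(row_jacobi_trudi t (gexp0 _) (@gexpD V)).
by rewrite gcoef_row_det // (leq_trans (size_le_psize _)).
Qed.

Lemma pair_ser_spec k : pair_ser (is_sp t) p k
  = spec p (pair_ser (is_sp t) (fun j => 'X_j : {mpoly int[N]}) k).
Proof.
have := mapser_pair_ser (spec p) (is_sp t) (fun j => 'X_j : {mpoly int[N]}).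
move=> /(congr1 (fun f => f k)); rewrite /mapser => ->.
by congr (pair_ser _ _ k); apply: funext => j; rewrite /= specX.
Qed.

(** The coefficient of q^k is a sum of Schur functions under one evenness condition. The trivial
    character has multiplicity 1 in such a Schur function if the other condition holds, and 0
    otherwise. *)
Lemma multiplicity_nil k : (2 * k <= n)%N ->
  multiplicity empty_part (pair_ser (is_sp t) (fun j => 'X_j : {mpoly int[N]}) k)
  = even_even_ser n k.
Proof.
move=> k_n; have k_N : (2 * k <= N)%N by apply: leq_trans (leq_addr _ _).
rewrite (pair_ser_schur hs) // raddf_sum /= /even_even_ser.
transitivity (\sum_(ga <- parts_le N | (psize ga == 2 * k)%N && even_part (is_sp t) ga)
    (even_part (~~ is_sp t) ga)%:R : int).
  apply: eq_bigr => nu /andP[/eqP nu_k _]; have nu_n : (psize nu <= n)%N by rewrite nu_k.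
  rewrite (universal_expansion hs hc hu N nu_n) raddf_sum.
  rewrite (bigD1_seq empty_part) ?parts_le_uniq ?mem_parts_le //=.
  rewrite [X in _ + X]big1_seq ?addr0 => [|mu /andP[mu0]]; last first.
    rewrite mem_parts_le => mu_n; rewrite raddf_sum big1 // => ga _.
    by rewrite raddfMz /= multiplicity_character // eq_sym (negPf mu0) mul0rz.
  rewrite raddf_sum (eq_bigr (fun ga => (ga == nu)%:R)) => [|ga _]; last first.
    by rewrite raddfMz /= multiplicity_character // eqxx (LR_nil hs hc ga nu).1 intz.
  rewrite big_mkcond (bigD1_seq nu) ?parts_le_uniq ?mem_parts_le //= eqxx.
  rewrite big1 ?addr0 => [|ga /negPf ->]; last by rewrite if_same.
  by case: (even_part _ _).
rewrite big_mkcond [RHS]big_mkcond.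
rewrite (eq_bigr (fun ga => if (psize ga == 2 * k)%N && even_even ga then 1 else 0)); last first.
  move=> ga _; rewrite /even_even /even_part; case: (psize ga == _) => //=.
  by case: (is_sp t) => /=; case: (even_rows ga); case: (even_columns ga).
apply: big_eq_supp; rewrite ?parts_le_uniq // => ga; rewrite !mem_parts_le => h1 h2.
  by case: eqP => // E; move: h2; rewrite E k_n.
by case: eqP => // E; move: h2; rewrite E k_N.
Qed.

(** Convolved with [even_even_ser], both D and the Euler product give 1 in degree 0 and 0 in degrees
    1 to k. As the constant term of [even_even_ser] is 1, equality propagates. *)
Lemma lusztig_factor_euler (D : ser int) k : (2 * k <= n)%N ->
    (forall la k, lusztig_coef t n la empty_part k = \sum_(i < k.+1) D i *
      multiplicity la (pair_ser (is_sp t) (fun j => 'X_j : {mpoly int[N]}) (k - i)%N)) ->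
  D k = even_euler int k.
Proof.
move=> + DE; elim/ltn_ind: k => k IH k_n.
have := esym (DE empty_part k); rewrite lusztig_nil // -(even_even_euler k_n) serE.
rewrite !big_ord_recr /= !subnn !(multiplicity_nil (k := 0%N)) //.
rewrite (eq_bigr (fun i : 'I_k => even_euler int i * even_even_ser n (k - i)%N)) /=; last first.
  by move=> i _; have lt_ik := ltn_ord i; rewrite multiplicity_nil ?IH //; lia.
have -> : even_even_ser n 0%N = 1.
  have := @even_even_euler n 0 (leq0n n).
  by rewrite serE big_ord1 /even_euler big_geq // coef1 mul1r.
by move=> /addrI; rewrite !mulr1.
Qed.

Theorem lusztig_stable (F : forall M, nat -> {mpoly int[M]}) (K : nat -> part -> int) :
    (forall M k, F M k
       = ((even_euler _ : ser {mpoly int[M]}) * pair_ser (is_sp t) (fun j => 'X_j)) k) ->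
    expansion F u K ->
  forall (la : part) k, (size la <= n)%N -> (2 * k <= n)%N -> lusztig_coef t n la empty_part k = K k la.
Proof.
move=> FE KE la k la_n k_n.
have [D DE0] := lusztig_factor t n_gt1.
have DE la' k' : lusztig_coef t n la' empty_part k' = \sum_(i < k'.+1) D i *
    multiplicity la' (pair_ser (is_sp t) (fun j => 'X_j : {mpoly int[N]}) (k' - i)%N).
  by rewrite DE0; apply: eq_bigr => i _; rewrite /multiplicity pair_ser_spec.
have [fin expK] := KE k.
(* Only universal characters of size at most 2k occur in degree k, within the reach of
   [multiplicity_character]. *)
have [M|L [L_uniq K_L] [F_L L_k]] := universal_coef_eq0 (d := (2 * k)%N) hs hc hu _ fin expK.
  by rewrite FE; exact: small_series.
transitivity (multiplicity la (F N k)).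
  rewrite DE FE serE raddf_sum; apply: eq_bigr => i _.
  rewrite (lusztig_factor_euler (D := D)) //; last by have := ltn_ord i; lia.
  by rewrite /even_euler !mulrzl raddfMz.
rewrite F_L raddf_sum (eq_big_seq (fun mu => K k mu *+ (la == mu))) /=.
  have [la_L|la_L] := boolP (la \in L).
    by rewrite (bigD1_seq la) //= eqxx big1 ?addr0 // => mu; rewrite eq_sym => /negPf ->.
  rewrite big1_seq => [|mu /andP[_ mu_L]]; last by case: eqP => // E; rewrite E mu_L in la_L.
  by apply/eqP; apply: contraNT la_L => Kla; apply: K_L; rewrite eq_sym.
move=> mu mu_L; rewrite raddfMz /= multiplicity_character ?(leq_trans (L_k _ mu_L)) //.
by case: eqP; rewrite ?intz // mul0rz.
Qed.

End Stability.

Local Close Scope ring_scope.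
Unset Implicit Arguments.
Set Strict Implicit.
Set Printing Implicit Defensive.

Theorem proposition4p1p2
    (* Schur functions and Littlewood-Richardson coefficients *)
    (s_gl : part -> symfun) (c : part -> part -> part -> int)
    (* universal orthogonal and symplectic characters *)
    (s_so s_sp : part -> symfun)
    (* K_so k la and K_sp k la are the coefficients K_{la,0}^{so,k}, K_{la,0}^{sp,k} *)
    (K_so K_sp : nat -> part -> int)
    (hs : schur_functions s_gl)
    (hc : littlewood_richardson s_gl c)
    (hso : universal_characters [set ga : part | even_rows ga]%classic s_gl c s_so)
    (hsp : universal_characters [set ga : part | even_columns ga]%classic s_gl c s_sp)
    (hKso : expansion so_series s_so K_so)
    (hKsp : expansion sp_series s_sp K_sp)
    (m k : nat) (la : part) (hla : size la <= m) :
  (forall n : nat, m <= n -> 2 * k <= n ->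
     [/\ 2 <= n -> lusztig_coef sp n la empty_part k = K_sp k la,
         2 <= n -> lusztig_coef so_odd n la empty_part k = K_so k la
       & 4 <= n -> lusztig_coef so_odd n la empty_part k
                     = lusztig_coef so_even n la empty_part k
                   /\ lusztig_coef so_even n la empty_part k = K_so k la])
  /\
  (forall n n' : nat, m <= n -> 2 * k <= n -> m <= n' -> 2 * k <= n' ->
     [/\ 2 <= n -> 2 <= n' -> lusztig_coef sp n la empty_part k
                                = lusztig_coef sp n' la empty_part k,
         2 <= n -> 2 <= n' -> lusztig_coef so_odd n la empty_part k
                                = lusztig_coef so_odd n' la empty_part k
       & 4 <= n -> 4 <= n' -> lusztig_coef so_even n la empty_part k
                                = lusztig_coef so_even n' la empty_part k]).
Proof.
have sp_K n : m <= n -> 2 * k <= n -> 2 <= n -> lusztig_coef sp n la empty_part k = K_sp k la.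
  move=> le_mn k_n n_gt1; apply: (lusztig_stable (t := sp) n_gt1 hs hc hsp _ hKsp) => //.
  exact: leq_trans le_mn.
have odd_K n : m <= n -> 2 * k <= n -> 2 <= n -> lusztig_coef so_odd n la empty_part k = K_so k la.
  move=> le_mn k_n n_gt1; apply: (lusztig_stable (t := so_odd) n_gt1 hs hc hso _ hKso) => //.
  exact: leq_trans le_mn.
have even_K n : m <= n -> 2 * k <= n -> 4 <= n -> lusztig_coef so_even n la empty_part k = K_so k la.
  move=> le_mn k_n n_gt3; have n_gt1 : 1 < n by exact: leq_trans n_gt3.
  apply: (lusztig_stable (t := so_even) n_gt1 hs hc hso _ hKso) => //.
  exact: leq_trans le_mn.
split=> [n le_mn k_n|n n' le_mn k_n le_mn' k_n'].
  split=> n_ge; [exact: sp_K | exact: odd_K | split; last exact: even_K].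
  by rewrite even_K // odd_K // (leq_trans _ n_ge).
split=> n_ge n_ge'; first by rewrite !sp_K.
  by rewrite !odd_K.
by rewrite !even_K.
Qed.
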